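(* For an arbitrary fixed number $\delta_1\in(0,1)$ there exists a Blaschke product $B$ in the upper half-plane $\mathbb C_+$ such that 1) $c_1(\delta,H^\infty/BH^\infty)<\infty$ for every $\delta$ with $\delta_1<\delta\le1$; 2) there exists a function $f\in H^\infty$ satisfying $\delta_1\le|f(\lambda)|\le\|f\|_\infty\le1$ for all $\lambda\in\sigma(B)$, but $\frac1f\notin H^\infty/BH^\infty$, i.e. $f$ is not invertible in $H^\infty/BH^\infty$: there are no $g,h\in H^\infty$ with $gf+hB=1$.
   Context: $\mathbb C_+=\{z\in\mathbb C:\operatorname{Im}z>0\}$, and $H^\infty$ is the algebra of bounded holomorphic functions on $\mathbb C_+$ with the norm $\|f\|_\infty=\sup_{z\in\mathbb C_+}|f(z)|$. For a Blaschke product $B$, $\sigma(B)$ denotes the set of its zeros in $\mathbb C_+$. For $0<\delta\le1$, $$c_1(\delta,H^\infty/BH^\infty)=\sup\Big\{\inf\{\|g\|_\infty: g,h\in H^\infty,\ gf+hB=1\}:\ f\in H^\infty,\ \delta\le|f(\lambda)|\le\|f\|_\infty\le1\text{ for all }\lambda\in\sigma(B)\Big\},$$ with the convention $\inf\emptyset=+\infty$. *)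

(* Defs.v *)
From Stdlib Require Import Reals.
From Coquelicot Require Export Coquelicot.
Open Scope R_scope.

(** Functions on the upper half-plane are represented by total functions
    [C -> C]; only their values on [Cplus] matter. *)
Definition Cplus (z : C) : Prop := 0 < Im z.

Definition holomorphic (f : C -> C) : Prop :=
  forall z : C, Cplus z -> @ex_derive C_AbsRing C_NormedModule f z.

Definition Hinf (f : C -> C) : Prop :=
  holomorphic f /\ exists M : R, forall z : C, Cplus z -> Cmod (f z) <= M.

Definition Hinf_norm (f : C -> C) : Rbar :=
  Lub_Rbar (fun r : R => exists z : C, Cplus z /\ r = Cmod (f z)).

(** The unimodular constant [|a^2+1| / (a^2+1)], read as [1] at [a = i], makes
    the factor nonnegative at the point [i] (positive unless [a = i]); this is
    the usual normalization that makes infinite products converge. *)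
Definition blaschke_factor (a z : C) : C :=
  ((if Ceq_dec a Ci then 1 else RtoC (Cmod (a ^ 2 + 1)) / (a ^ 2 + 1))
   * ((z - a) / (z - Cconj a)))%C.

(** Zeros are listed with multiplicity; [None] entries contribute the factor [1],
    so that finite Blaschke products are covered as well as infinite ones. *)
Fixpoint blaschke_partial (a : nat -> option C) (n : nat) (z : C) : C :=
  match n with
  | O => 1%C
  | S m => (blaschke_partial a m z
            * match a m with Some w => blaschke_factor w z | None => 1 end)%C
  end.

Definition blaschke_condition (a : nat -> option C) : Prop :=
  (forall (n : nat) (w : C), a n = Some w -> Cplus w) /\
  @ex_series R_AbsRing R_NormedModule
    (fun n : nat =>
       match a n with Some w => Im w / (1 + Cmod w ^ 2) | None => 0 end).

Definition blaschke_product (B : C -> C) : Prop :=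
  exists a : nat -> option C,
    blaschke_condition a /\
    forall z : C, Cplus z ->
      filterlim (fun n : nat => blaschke_partial a n z) eventually (locally (B z)).

Definition zero_set (B : C -> C) (z : C) : Prop := Cplus z /\ B z = 0%C.

(** [B] is the modulus of the quotient algebra [H^oo / B H^oo]. *)
Definition bezout (B f g h : C -> C) : Prop :=
  Hinf g /\ Hinf h /\ forall z : C, Cplus z -> (g z * f z + h z * B z)%C = 1%C.

Definition invertible_mod (B f : C -> C) : Prop :=
  exists g h : C -> C, bezout B f g h.

Definition admissible (delta : R) (B f : C -> C) : Prop :=
  Hinf f /\
  (forall l : C, zero_set B l ->
     delta <= Cmod (f l) /\ Rbar_le (Cmod (f l)) (Hinf_norm f)) /\
  Rbar_le (Hinf_norm f) 1.

(** [Rbar_glb] of the empty set is [p_infty]. *)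
Definition inverse_norm (B f : C -> C) : Rbar :=
  Rbar_glb (fun t : Rbar =>
    exists g h : C -> C, bezout B f g h /\ t = Hinf_norm g).

Definition c_1 (delta : R) (B : C -> C) : Rbar :=
  Rbar_lub (fun s : Rbar =>
    exists f : C -> C, admissible delta B f /\ s = inverse_norm B f).

(* Main.v *)
(** The zeros of [B] form horizontal rows, dense in the hyperbolic metric, filling
    [{Im z >= 1}]; the gap between the rows [k] and [k + 1] has pseudo-hyperbolic
    radius [r_k > delta1], tending to [delta1].

    If [|f| >= delta > delta1] on the zeros, Schwarz-Pick bounds [|f|] below on
    some half-plane [{Im z > Y}] and on a strip around each row.  Discard the rows
    below a large height: the remaining product [B'] is bounded below on
    [{Im z < 2 Y}].  The Cauchy integral splits the function [1 / (f B')], bounded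
    on the strip [Y < Im z < 2 Y], as [F+ - F-] with [F+] bounded above the strip
    and [F-] bounded below it; then [g = 1/f - B' F+], glued to [g = - B' F-],
    inverts [f] modulo [B'], with [h = F+ f], glued to [1/B' + F- f].
    The same works for each discarded row, with one strip on each side,
    and the inverses combine through [(1 - g1 f) (1 - g2 f)].

    Conversely, let [f] be the Blaschke product vanishing at the centers of very
    sparse gaps.  It is at least [delta1] in modulus on the zeros of [B], because
    [r_k > delta1]; but [f] vanishes at points where [B] tends to [0]. *)

Require Import Defs.
From Stdlib Require Import Reals Lra Lia Classical ClassicalEpsilon Cantor List FinFun.
From Coquelicot Require Import Coquelicot.
Open Scope R_scope.

(** The radii [r_k] obey two opposite demands. They must tend to [delta1], because Schwarz-Pick
    keeps [f] away from 0 in a gap only when the bound on [|f|] exceeds the radius of that gap. They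
    must also exceed [delta1] by a margin, because at each zero of [B] the counterexample loses a
    little through the factors of its distant zeros, and the nearest factor has to make up for that.
    The density of the rows obeys two demands as well: it must be unbounded for [B] to tend to 0 in
    the gaps, yet grow more slowly than the heights for the Blaschke condition to hold. Above the
    threshold the obstacle is the finitely many low gaps, where [f] may vanish, so that [1 / f] is
    available only on some strips and on a high half-plane. This is why each piece of [B] needs a
    region where it is bounded below that overlaps a region where [f] is. Every constant has to be
    fixed before [f] is chosen, since [c_1] is a supremum over all [f]. *)

Notation cdiff f z := (@ex_derive C_AbsRing C_NormedModule f z).

(** * Continuity and complex differentiability by epsilon and delta *)

Definition ccont (f : C -> C) (z : C) : Prop :=
  forall eps, 0 < eps -> exists d, 0 < d /\
    forall w, Cmod (w - z) < d -> Cmod (f w - f z) < eps.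

Lemma Cmod_sub_sym (a b : C) : Cmod (a - b) = Cmod (b - a).
Proof. rewrite <- (Cmod_opp (a - b)). f_equal; ring. Qed.

Lemma Cmod_sub_diag (a : C) : Cmod (a - a) = 0.
Proof. replace (a - a)%C with (RtoC 0) by ring. apply Cmod_0. Qed.

Lemma Cmod_sub_triangle (a b c : C) : Cmod (a - c) <= Cmod (a - b) + Cmod (b - c).
Proof.
  replace (a - c)%C with ((a - b) + (b - c))%C by ring. apply Cmod_triangle.
Qed.

Lemma Cmod_triangle_rev (a b : C) : Cmod a - Cmod b <= Cmod (a - b).
Proof.
  generalize (Cmod_triangle (a - b) b). replace (a - b + b)%C with a by ring. lra.
Qed.

Lemma im_le_Cmod (z : C) : Rabs (Im z) <= Cmod z.
Proof. eapply Rle_trans; [|apply Rmax_Cmod]. apply Rmax_r. Qed.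

Lemma Cmod_le_ReIm (z : C) : Cmod z <= Rabs (Re z) + Rabs (Im z).
Proof.
  apply Rsqr_incr_0_var.
  - rewrite !Rsqr_pow2, Cmod2_alt, <- (pow2_abs (Re z)), <- (pow2_abs (Im z)).
    generalize (Rabs_pos (Re z)) (Rabs_pos (Im z)). nra.
  - generalize (Rabs_pos (Re z)) (Rabs_pos (Im z)). lra.
Qed.

Lemma Im_near (w z : C) (r : R) : Cmod (w - z) < r -> Im z - r < Im w < Im z + r.
Proof.
  intros H. assert (H' := im_le_Cmod (w - z)). change (Im (w - z)) with (Im w - Im z) in H'.
  apply Rle_lt_trans with (2 := H), Rabs_def2 in H'. lra.
Qed.

Lemma Re_near (w z : C) (r : R) : Cmod (w - z) < r -> Re z - r < Re w < Re z + r.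
Proof.
  intros H. assert (H' := re_le_Cmod (w - z)). change (Re (w - z)) with (Re w - Re z) in H'.
  apply Rle_lt_trans with (2 := H), Rabs_def2 in H'. lra.
Qed.

Lemma Cmod_le_box (w z : C) (a b : R) :
  Re z - a <= Re w <= Re z + a -> Im z - b <= Im w <= Im z + b -> Cmod (w - z) <= a + b.
Proof.
  intros H1 H2. eapply Rle_trans; [apply Cmod_le_ReIm|].
  change (Rabs (Re w - Re z) + Rabs (Im w - Im z) <= a + b).
  apply Rplus_le_compat; apply Rabs_le; lra.
Qed.

Lemma Cmod_sub_0 (a b : C) : Cmod (a - b) <= 0 -> a = b.
Proof.
  intros H. assert (a - b = 0)%C.
  { apply Cmod_eq_0. generalize (Cmod_ge_0 (a - b)); lra. }
  replace a with ((a - b) + b)%C by ring. rewrite H0. ring.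
Qed.

Lemma Cmod_pos_neq (z : C) : 0 < Cmod z -> z <> 0%C.
Proof. intros H; now apply Cmod_gt_0. Qed.

Lemma ex_derive_C (f : C -> C) (z : C) :
  cdiff f z <->
  exists l : C, forall eps, 0 < eps -> exists d, 0 < d /\
    forall w, Cmod (w - z) < d -> Cmod (f w - f z - l * (w - z)) <= eps * Cmod (w - z).
Proof.
  split.
  - intros [l [_ H]]. exists l. intros eps He.
    specialize (H z (fun P HP => HP) (mkposreal eps He)).
    destruct H as [d Hd].
    exists d; split; [apply cond_pos|]. intros w Hw.
    generalize (Hd w Hw).
    change (Cmod ((f w - f z) - (w - z) * l) <= eps * Cmod (w - z) ->
      Cmod (f w - f z - l * (w - z)) <= eps * Cmod (w - z)).
    now rewrite (Cmult_comm l).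
  - intros [l H]. exists l. split; [apply is_linear_scal_l|].
    (* Differentiability quantifies over all limits of the filter; by uniqueness the only one is
       [z]. *)
    intros x Hx. apply (is_filter_lim_locally_unique (K := C_AbsRing) (V :=
      AbsRing_NormedModule C_AbsRing)) in Hx. subst x.
    intros eps. destruct (H eps (cond_pos eps)) as [d [Hd Hw]].
    exists (mkposreal d Hd). intros w Hwd. generalize (Hw w Hwd).
    change (Cmod (f w - f z - l * (w - z)) <= eps * Cmod (w - z) ->
            Cmod ((f w - f z) - (w - z) * l) <= eps * Cmod (w - z)).
    now rewrite (Cmult_comm l).
Qed.

(** Carathéodory's characterization turns the differentiation rules into
    statements about continuous functions. *)
Lemma cdiff_caratheodory (f : C -> C) (z : C) :
  cdiff f z <->
  exists phi : C -> C, ccont phi z /\ forall w, (f w - f z = phi w * (w - z))%C.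
Proof.
  rewrite ex_derive_C. split.
  - intros [l H].
    exists (fun w => if Ceq_dec w z then l else ((f w - f z) / (w - z))%C). split.
    + intros eps He. destruct (H (eps / 2)) as [d [Hd Hw]]; [lra|].
      exists d; split; [easy|]. intros w Hwd.
      destruct (Ceq_dec z z) as [_|n]; [|easy].
      destruct (Ceq_dec w z) as [->|n].
      * rewrite Cmod_sub_diag. lra.
      * assert (n' : (w - z)%C <> 0%C).
        { intros E. apply n. replace w with ((w - z) + z)%C by ring. rewrite E. ring. }
        replace ((f w - f z) / (w - z) - l)%C
          with ((f w - f z - l * (w - z)) / (w - z))%C by (now field).
        rewrite Cmod_div by easy. apply Cmod_gt_0 in n'.
        apply Rle_lt_trans with (eps / 2); [|lra].
        apply Rle_div_l; [lra|]. now apply Hw.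
    + intros w. destruct (Ceq_dec w z) as [->|n]; [ring|].
      field. intros E. apply n. replace w with ((w - z) + z)%C by ring. rewrite E. ring.
  - intros [phi [Hphi E]]. exists (phi z). intros eps He.
    destruct (Hphi eps He) as [d [Hd Hw]]. exists d; split; [easy|].
    intros w Hwd. rewrite E.
    replace (phi w * (w - z) - phi z * (w - z))%C with ((phi w - phi z) * (w - z))%C by ring.
    rewrite Cmod_mult. apply Rmult_le_compat_r; [apply Cmod_ge_0|].
    left. now apply Hw.
Qed.

Lemma Rmin_witness (a b : R) : 0 < a -> 0 < b -> exists d, 0 < d /\ d <= a /\ d <= b.
Proof.
  intros Ha Hb. exists (Rmin a b). split; [now apply Rmin_pos|].
    split; [apply Rmin_l|apply Rmin_r].
Qed.

Lemma ccont_const (c z : C) : ccont (fun _ => c) z.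
Proof.
  intros eps He. exists 1; split; [lra|]. intros w _.
  now rewrite Cmod_sub_diag.
Qed.

Lemma ccont_id (z : C) : ccont (fun w => w) z.
Proof. intros eps He. now exists eps. Qed.

Lemma ccont_plus (f g : C -> C) (z : C) :
  ccont f z -> ccont g z -> ccont (fun w => f w + g w)%C z.
Proof.
  intros Hf Hg eps He.
  destruct (Hf (eps / 2)) as [d1 [Hd1 H1]]; [lra|].
  destruct (Hg (eps / 2)) as [d2 [Hd2 H2]]; [lra|].
  destruct (Rmin_witness d1 d2) as (d' & Hd' & L1 & L2); [easy..|].
  exists d'; split; [easy|]. intros w Hw.
  replace (f w + g w - (f z + g z))%C with ((f w - f z) + (g w - g z))%C by ring.
  eapply Rle_lt_trans; [apply Cmod_triangle|].
  generalize (H1 w ltac:(lra)) (H2 w ltac:(lra)). lra.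
Qed.

Lemma ccont_bounded (f : C -> C) (z : C) : ccont f z ->
  exists d, 0 < d /\ forall w, Cmod (w - z) < d -> Cmod (f w) <= Cmod (f z) + 1.
Proof.
  intros Hf. destruct (Hf 1) as [d [Hd H]]; [lra|]. exists d; split; [easy|].
  intros w Hw. generalize (H w Hw) (Cmod_triangle_rev (f w) (f z)). lra.
Qed.

Lemma ccont_mult (f g : C -> C) (z : C) :
  ccont f z -> ccont g z -> ccont (fun w => f w * g w)%C z.
Proof.
  intros Hf Hg eps He.
  set (A := Cmod (f z) + 1). set (G := Cmod (g z) + 1).
  assert (HA : 0 < A) by (unfold A; generalize (Cmod_ge_0 (f z)); lra).
  assert (HG : 0 < G) by (unfold G; generalize (Cmod_ge_0 (g z)); lra).
  destruct (ccont_bounded f z Hf) as [d0 [Hd0 H0]].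
  destruct (Hf (eps / (2 * G))) as [d1 [Hd1 H1]]; [apply Rdiv_lt_0_compat; lra|].
  destruct (Hg (eps / (2 * A))) as [d2 [Hd2 H2]]; [apply Rdiv_lt_0_compat; lra|].
  exists (Rmin d0 (Rmin d1 d2)); split; [now repeat apply Rmin_pos|]. intros w Hw.
  generalize (Rmin_l d1 d2) (Rmin_r d1 d2) (Rmin_l d0 (Rmin d1 d2))
    (Rmin_r d0 (Rmin d1 d2)); intros.
  specialize (H0 w ltac:(lra)). specialize (H1 w ltac:(lra)). specialize (H2 w ltac:(lra)).
  replace (f w * g w - f z * g z)%C
    with (f w * (g w - g z) + (f w - f z) * g z)%C by ring.
  eapply Rle_lt_trans; [apply Cmod_triangle|]. rewrite !Cmod_mult.
  assert (Cmod (f w) * Cmod (g w - g z) <= A * Cmod (g w - g z)).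
  { apply Rmult_le_compat_r; [apply Cmod_ge_0|easy]. }
  assert (A * Cmod (g w - g z) < A * (eps / (2 * A))) by (now apply Rmult_lt_compat_l).
  assert (Cmod (f w - f z) * Cmod (g z) <= Cmod (f w - f z) * G).
  { apply Rmult_le_compat_l; [apply Cmod_ge_0|unfold G; lra]. }
  assert (Cmod (f w - f z) * G < eps / (2 * G) * G) by (now apply Rmult_lt_compat_r).
  replace (A * (eps / (2 * A))) with (eps / 2) in * by (field; lra).
  replace (eps / (2 * G) * G) with (eps / 2) in * by (field; lra).
  lra.
Qed.

Lemma ccont_nonzero (f : C -> C) (z : C) : ccont f z -> f z <> 0%C ->
  exists d, 0 < d /\ forall w, Cmod (w - z) < d -> Cmod (f z) / 2 < Cmod (f w).
Proof.
  intros Hf Hz. apply Cmod_gt_0 in Hz.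
  destruct (Hf (Cmod (f z) / 2)) as [d [Hd H]]; [lra|]. exists d; split; [easy|].
  intros w Hw. generalize (H w Hw) (Cmod_triangle_rev (f z) (f w)).
  rewrite (Cmod_sub_sym (f z)). lra.
Qed.

Lemma ccont_inv (f : C -> C) (z : C) :
  ccont f z -> f z <> 0%C -> ccont (fun w => / f w)%C z.
Proof.
  intros Hf Hz eps He.
  destruct (ccont_nonzero f z Hf Hz) as [d0 [Hd0 H0]].
  assert (Hz' := Hz). apply Cmod_gt_0 in Hz'. set (m := Cmod (f z)) in *.
  destruct (Hf (eps * (m * m / 2))) as [d1 [Hd1 H1]]; [apply Rmult_lt_0_compat; nra|].
  destruct (Rmin_witness d0 d1) as (d' & Hd' & L1 & L2); [easy..|].
  exists d'; split; [easy|]. intros w Hw.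
  specialize (H0 w ltac:(lra)). specialize (H1 w ltac:(lra)).
  assert (Hw' : f w <> 0%C) by (apply Cmod_pos_neq; lra).
  replace (/ f w - / f z)%C with (- (f w - f z) / (f w * f z))%C by (field; easy).
  rewrite Cmod_div, Cmod_opp, Cmod_mult by (now apply Cmult_neq_0).
  fold m. apply Rlt_div_l; [nra|].
  apply Rlt_le_trans with (1 := H1). apply Rmult_le_compat_l; nra.
Qed.

Lemma ccont_ext_loc (f g : C -> C) (z : C) (r : R) : 0 < r ->
  (forall w, Cmod (w - z) < r -> f w = g w) -> ccont f z -> ccont g z.
Proof.
  intros Hr E Hf eps He. destruct (Hf eps He) as [d [Hd H]].
  destruct (Rmin_witness r d) as (d' & Hd' & L1 & L2); [easy..|].
  exists d'; split; [easy|]. intros w Hw.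
  rewrite <- !E; [apply H; lra| |lra].
  now rewrite Cmod_sub_diag.
Qed.

Lemma cdiff_ccont (f : C -> C) (z : C) : cdiff f z -> ccont f z.
Proof.
  rewrite cdiff_caratheodory. intros [phi [H E]].
  assert (ccont (fun w => f z + phi w * (w - z))%C z).
  { apply ccont_plus; [apply ccont_const|]. apply ccont_mult; [easy|].
    apply (ccont_plus (fun w => w) (fun _ => - z)%C); [apply ccont_id|apply ccont_const]. }
  revert H0. apply (ccont_ext_loc _ _ z 1); [lra|]. intros w _. rewrite <- E. ring.
Qed.

Lemma cdiff_const (c z : C) : cdiff (fun _ => c) z.
Proof.
  apply cdiff_caratheodory. exists (fun _ => 0%C). split; [apply ccont_const|].
  intros w. ring.
Qed.

Lemma cdiff_id (z : C) : cdiff (fun w => w) z.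
Proof.
  apply cdiff_caratheodory. exists (fun _ => 1%C). split; [apply ccont_const|].
  intros w. ring.
Qed.

Lemma cdiff_plus (f g : C -> C) (z : C) :
  cdiff f z -> cdiff g z -> cdiff (fun w => f w + g w)%C z.
Proof.
  rewrite !cdiff_caratheodory. intros [p [Hp Ep]] [q [Hq Eq]].
  exists (fun w => p w + q w)%C. split; [now apply ccont_plus|].
  intros w. transitivity ((f w - f z) + (g w - g z))%C; [ring|]. rewrite Ep, Eq. ring.
Qed.

Lemma cdiff_mult (f g : C -> C) (z : C) :
  cdiff f z -> cdiff g z -> cdiff (fun w => f w * g w)%C z.
Proof.
  intros Hf Hg. assert (Cf := cdiff_ccont _ _ Hf). revert Hf Hg.
  rewrite !cdiff_caratheodory. intros [p [Hp Ep]] [q [Hq Eq]].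
  exists (fun w => f w * q w + p w * g z)%C. split.
  - apply ccont_plus; apply ccont_mult; try easy. apply ccont_const.
  - intros w. transitivity (f w * (g w - g z) + (f w - f z) * g z)%C; [ring|].
    rewrite Ep, Eq. ring.
Qed.

Lemma cdiff_opp (f : C -> C) (z : C) : cdiff f z -> cdiff (fun w => - f w)%C z.
Proof.
  rewrite !cdiff_caratheodory. intros [p [Hp Ep]].
  exists (fun w => - (1) * p w)%C. split.
  - apply ccont_mult; [apply ccont_const|easy].
  - intros w. transitivity (- (f w - f z))%C; [ring|]. rewrite Ep. ring.
Qed.

Lemma cdiff_minus (f g : C -> C) (z : C) :
  cdiff f z -> cdiff g z -> cdiff (fun w => f w - g w)%C z.
Proof. intros Hf Hg. apply (cdiff_plus f (fun w => - g w)%C); [easy|now apply cdiff_opp]. Qed.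

Lemma cdiff_ext_loc (f g : C -> C) (z : C) (r : R) : 0 < r ->
  (forall w, Cmod (w - z) < r -> f w = g w) -> cdiff f z -> cdiff g z.
Proof.
  intros Hr E. rewrite !ex_derive_C. intros [l H]. exists l. intros eps He.
  destruct (H eps He) as [d [Hd Hw]].
  destruct (Rmin_witness r d) as (d' & Hd' & L1 & L2); [easy..|].
  exists d'; split; [easy|]. intros w Hwd.
  rewrite <- !E; [apply Hw; lra| |lra].
  now rewrite Cmod_sub_diag.
Qed.

Lemma cdiff_inv (f : C -> C) (z : C) :
  cdiff f z -> f z <> 0%C -> cdiff (fun w => / f w)%C z.
Proof.
  intros Hf Hz. assert (Cf := cdiff_ccont _ _ Hf).
  destruct (ccont_nonzero f z Cf Hz) as [d [Hd Hnz]].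
  revert Hf. rewrite !cdiff_caratheodory. intros [p [Hp Ep]].
  (* The identity must hold for every [w], but the natural factor fails where [f] vanishes. It is
     used near [z] only, and the plain difference quotient elsewhere. *)
  exists (fun w => if Rlt_dec (Cmod (w - z)) d then - (1) * p w * / f w * / f z
                   else (/ f w - / f z) / (w - z))%C. split.
  - apply (ccont_ext_loc (fun w => - (1) * p w * / f w * / f z)%C _ z d); [easy| |].
    + intros w Hw. now destruct (Rlt_dec (Cmod (w - z)) d).
    + apply ccont_mult; [|apply ccont_const]. apply ccont_mult; [|now apply ccont_inv].
      apply ccont_mult; [apply ccont_const|easy].
  - intros w. destruct (Rlt_dec (Cmod (w - z)) d) as [Hw|Hw].
    + assert (f w <> 0%C).
      { apply Cmod_pos_neq. generalize (Hnz w Hw) (Cmod_ge_0 (f z)). lra. }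
      transitivity (- (f w - f z) * / f w * / f z)%C; [field; easy|]. rewrite Ep. field; easy.
    + generalize (/ f w)%C (/ f z)%C. intros u v. field.
      intros E. rewrite E, Cmod_0 in Hw. lra.
Qed.

Lemma cdiff_div (f g : C -> C) (z : C) :
  cdiff f z -> cdiff g z -> g z <> 0%C -> cdiff (fun w => f w / g w)%C z.
Proof. intros Hf Hg Hz. apply (cdiff_mult f (fun w => / g w)%C); [easy|now apply cdiff_inv].
  Qed.

Lemma cdiff_pow (f : C -> C) (z : C) (n : nat) :
  cdiff f z -> cdiff (fun w => f w ^ n)%C z.
Proof.
  intros Hf. induction n as [|n IH].
  - apply (cdiff_const 1%C).
  - apply (cdiff_mult f (fun w => f w ^ n)%C); easy.
Qed.

(** * Integration along rectangles *)

Notation CV := C_R_CompleteNormedModule.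

Definition rcont (f : R -> C) (t : R) : Prop :=
  forall eps, 0 < eps -> exists d, 0 < d /\
    forall s, Rabs (s - t) < d -> Cmod (f s - f t) < eps.

Notation Cint f a b := (RInt (V := CV) f a b).
Notation ex_Cint f a b := (ex_RInt (V := CV) f a b).

Lemma ex_Cint_cont (f : R -> C) (a b : R) : a <= b ->
  (forall t, a <= t <= b -> rcont f t) -> ex_Cint f a b.
Proof.
  intros Hab H. apply (ex_RInt_continuous (V := CV)).
  rewrite Rmin_left, Rmax_right by easy. intros t Ht P [eps HP].
  destruct (H t Ht eps (cond_pos eps)) as [d [Hd Hs]].
  exists (mkposreal d Hd). intros s Hst. apply HP. specialize (Hs s Hst).
  split.
  - eapply Rle_lt_trans; [|apply Hs].
    eapply Rle_trans; [|apply (re_le_Cmod (f s - f t))]. apply Req_le. reflexivity.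
  - eapply Rle_lt_trans; [|apply Hs].
    eapply Rle_trans; [|apply (im_le_Cmod (f s - f t))]. apply Req_le. reflexivity.
Qed.

Lemma Cint_plus (f g : R -> C) (a b : R) : ex_Cint f a b -> ex_Cint g a b ->
  Cint (fun t => f t + g t)%C a b = (Cint f a b + Cint g a b)%C.
Proof. intros Hf Hg. exact (RInt_plus (V := CV) f g a b Hf Hg). Qed.

(** The integral takes values in a normed module over the reals, where a complex [c] is not a
    scalar; the two coordinates are therefore integrated separately. *)
Lemma is_Cint_scal (c : C) (f : R -> C) (a b : R) (l : C) :
  is_RInt (V := CV) f a b l ->
  is_RInt (V := CV) (fun t => c * f t)%C a b (c * l)%C.
Proof.
  intros H.
  assert (H1 := is_RInt_fct_extend_fst (U := R_NormedModule) (V := R_NormedModule) f a b l H).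
  assert (H2 := is_RInt_fct_extend_snd (U := R_NormedModule) (V := R_NormedModule) f a b l H).
  apply (is_RInt_fct_extend_pair (U := R_NormedModule) (V := R_NormedModule)
    (fun t => c * f t)%C a b); simpl.
  - apply (is_RInt_minus (V := R_NormedModule)
      (fun t => fst c * fst (f t)) (fun t => snd c * snd (f t)));
    now apply (is_RInt_scal (V := R_NormedModule)).
  - apply (is_RInt_plus (V := R_NormedModule)
      (fun t => fst c * snd (f t)) (fun t => snd c * fst (f t)));
    now apply (is_RInt_scal (V := R_NormedModule)).
Qed.

Lemma ex_Cint_scal (c : C) (f : R -> C) (a b : R) : ex_Cint f a b ->
  ex_Cint (fun t => c * f t)%C a b.
Proof. intros [l H]. exists (c * l)%C. now apply is_Cint_scal. Qed.

Lemma Cint_scal (c : C) (f : R -> C) (a b : R) : ex_Cint f a b ->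
  Cint (fun t => c * f t)%C a b = (c * Cint f a b)%C.
Proof.
  intros H. apply (is_RInt_unique (V := CV)), is_Cint_scal.
  now apply (RInt_correct (V := CV)).
Qed.

Lemma ex_Cint_minus (f g : R -> C) (a b : R) : ex_Cint f a b -> ex_Cint g a b ->
  ex_Cint (fun t => f t - g t)%C a b.
Proof. intros Hf Hg. exact (ex_RInt_minus (V := CV) f g a b Hf Hg). Qed.

Lemma Cint_minus (f g : R -> C) (a b : R) : ex_Cint f a b -> ex_Cint g a b ->
  Cint (fun t => f t - g t)%C a b = (Cint f a b - Cint g a b)%C.
Proof. intros Hf Hg. exact (RInt_minus (V := CV) f g a b Hf Hg). Qed.

Lemma Cint_ext (f g : R -> C) (a b : R) : a <= b ->
  (forall t, a < t < b -> f t = g t) -> Cint f a b = Cint g a b.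
Proof.
  intros Hab H. apply (RInt_ext (V := CV)).
  now rewrite Rmin_left, Rmax_right.
Qed.

Lemma Cint_const (c : C) (a b : R) : Cint (fun _ => c) a b = (RtoC (b - a) * c)%C.
Proof.
  rewrite (RInt_const (V := CV)).
  apply injective_projections; simpl; unfold scal; simpl; unfold mult; simpl; ring.
Qed.

Lemma Cint_Chasles (f : R -> C) (a b c : R) : ex_Cint f a b -> ex_Cint f b c ->
  Cint f a c = (Cint f a b + Cint f b c)%C.
Proof.
  intros H1 H2. symmetry.
  exact (RInt_Chasles (V := CV) f a b c H1 H2).
Qed.

Lemma Cint_le (f : R -> C) (g : R -> R) (a b l : R) : a <= b -> ex_Cint f a b ->
  is_RInt g a b l -> (forall t, a <= t <= b -> Cmod (f t) <= g t) ->
  Cmod (Cint f a b) <= l.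
Proof.
  intros Hab Hf Hg H. rewrite Cmod_norm.
  apply (norm_RInt_le (V := C_R_NormedModule) f g a b); try easy.
  - intros t Ht. rewrite <- Cmod_norm. now apply H.
  - now apply (RInt_correct (V := CV)).
Qed.

Lemma Cint_le_const (f : R -> C) (a b M : R) : a <= b -> ex_Cint f a b ->
  (forall t, a <= t <= b -> Cmod (f t) <= M) -> Cmod (Cint f a b) <= M * (b - a).
Proof.
  intros Hab Hf H. apply (Cint_le f (fun _ => M)); try easy.
  replace (M * (b - a)) with (scal (b - a) M) by (unfold scal; simpl; unfold mult; simpl; ring).
  apply (is_RInt_const (V := R_NormedModule)).
Qed.

Lemma Cmod_hor (s t y : R) : Cmod ((s, y) - (t, y)) = Rabs (s - t).
Proof.
  replace ((s, y) - (t, y))%C with (RtoC (s - t)); [apply Cmod_R|].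
  apply injective_projections; simpl; ring.
Qed.

Lemma Cmod_ver (s t x : R) : Cmod ((x, s) - (x, t)) = Rabs (s - t).
Proof.
  replace ((x, s) - (x, t))%C with (RtoC (s - t) * Ci)%C.
  - rewrite Cmod_mult, Cmod_Ci, Cmod_R. ring.
  - apply injective_projections; simpl; ring.
Qed.

Lemma rcont_hor (f : C -> C) (t y : R) : ccont f (t, y) -> rcont (fun s => f (s, y)) t.
Proof.
  intros H eps He. destruct (H eps He) as [d [Hd Hw]]. exists d; split; [easy|].
  intros s Hs. apply Hw. now rewrite Cmod_hor.
Qed.

Lemma rcont_ver (f : C -> C) (x t : R) : ccont f (x, t) -> rcont (fun s => f (x, s)) t.
Proof.
  intros H eps He. destruct (H eps He) as [d [Hd Hw]]. exists d; split; [easy|].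
  intros s Hs. apply Hw. now rewrite Cmod_ver.
Qed.

(** The counterclockwise boundary integral: [dz] is [dt] on the horizontal edges and [Ci dt] on the
    vertical ones. *)
Definition rectI (f : C -> C) (x1 x2 y1 y2 : R) : C :=
  (Cint (fun t => f (t, y1)) x1 x2 - Cint (fun t => f (t, y2)) x1 x2
   + Ci * (Cint (fun t => f (x2, t)) y1 y2 - Cint (fun t => f (x1, t)) y1 y2))%C.

Definition in_rect (x1 x2 y1 y2 : R) (z : C) : Prop :=
  x1 <= Re z <= x2 /\ y1 <= Im z <= y2.

(** Both integrability of [f] on the boundary and estimates only need to know
    [f] on the four edges. *)
Definition on_rect (x1 x2 y1 y2 : R) (z : C) : Prop :=
  in_rect x1 x2 y1 y2 z /\ (Re z = x1 \/ Re z = x2 \/ Im z = y1 \/ Im z = y2).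

Lemma ex_Cint_hor (f : C -> C) (x1 x2 y : R) : x1 <= x2 ->
  (forall t, x1 <= t <= x2 -> ccont f (t, y)) -> ex_Cint (fun t => f (t, y)) x1 x2.
Proof. intros Hx H. apply ex_Cint_cont; [easy|]. intros t Ht. now apply rcont_hor, H. Qed.

Lemma ex_Cint_ver (f : C -> C) (x y1 y2 : R) : y1 <= y2 ->
  (forall t, y1 <= t <= y2 -> ccont f (x, t)) -> ex_Cint (fun t => f (x, t)) y1 y2.
Proof. intros Hx H. apply ex_Cint_cont; [easy|]. intros t Ht. now apply rcont_ver, H. Qed.

Section Rect.
Variables x1 x2 y1 y2 : R.
Hypothesis Hx : x1 <= x2.
Hypothesis Hy : y1 <= y2.

Lemma on_rect_edges (P : C -> Prop) : (forall z, on_rect x1 x2 y1 y2 z -> P z) ->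
  (forall t, x1 <= t <= x2 -> P (t, y1)) /\ (forall t, x1 <= t <= x2 -> P (t, y2)) /\
  (forall t, y1 <= t <= y2 -> P (x2, t)) /\ (forall t, y1 <= t <= y2 -> P (x1, t)).
Proof.
  intros H. repeat split; intros t Ht; apply H; unfold on_rect, in_rect; simpl; lra.
Qed.

Lemma ex_edges (f : C -> C) : (forall z, on_rect x1 x2 y1 y2 z -> ccont f z) ->
  ex_Cint (fun t => f (t, y1)) x1 x2 /\ ex_Cint (fun t => f (t, y2)) x1 x2 /\
  ex_Cint (fun t => f (x2, t)) y1 y2 /\ ex_Cint (fun t => f (x1, t)) y1 y2.
Proof.
  intros H. apply on_rect_edges in H. destruct H as [H1 [H2 [H3 H4]]].
  split; [|split; [|split]].
  - now apply (ex_Cint_hor f x1 x2 y1).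
  - now apply (ex_Cint_hor f x1 x2 y2).
  - now apply (ex_Cint_ver f x2 y1 y2).
  - now apply (ex_Cint_ver f x1 y1 y2).
Qed.

Lemma rectI_plus (f g : C -> C) : (forall z, on_rect x1 x2 y1 y2 z -> ccont f z) ->
  (forall z, on_rect x1 x2 y1 y2 z -> ccont g z) ->
  rectI (fun z => f z + g z)%C x1 x2 y1 y2 = (rectI f x1 x2 y1 y2 + rectI g x1 x2 y1 y2)%C.
Proof.
  intros Hf Hg. apply ex_edges in Hf, Hg.
  destruct Hf as [F1 [F2 [F3 F4]]], Hg as [G1 [G2 [G3 G4]]].
  unfold rectI. rewrite 4!Cint_plus by easy. ring.
Qed.

Lemma rectI_scal (c : C) (f : C -> C) : (forall z, on_rect x1 x2 y1 y2 z -> ccont f z) ->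
  rectI (fun z => c * f z)%C x1 x2 y1 y2 = (c * rectI f x1 x2 y1 y2)%C.
Proof.
  intros Hf. apply ex_edges in Hf. destruct Hf as [F1 [F2 [F3 F4]]].
  unfold rectI. rewrite 4!Cint_scal by easy. ring.
Qed.

Lemma rectI_ext (f g : C -> C) : (forall z, on_rect x1 x2 y1 y2 z -> f z = g z) ->
  rectI f x1 x2 y1 y2 = rectI g x1 x2 y1 y2.
Proof.
  intros H. apply on_rect_edges in H. destruct H as [H1 [H2 [H3 H4]]].
  unfold rectI.
  rewrite (Cint_ext (fun t => f (t, y1)) (fun t => g (t, y1)) x1 x2 Hx)
    by (intros; apply H1; lra).
  rewrite (Cint_ext (fun t => f (t, y2)) (fun t => g (t, y2)) x1 x2 Hx)
    by (intros; apply H2; lra).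
  rewrite (Cint_ext (fun t => f (x2, t)) (fun t => g (x2, t)) y1 y2 Hy)
    by (intros; apply H3; lra).
  rewrite (Cint_ext (fun t => f (x1, t)) (fun t => g (x1, t)) y1 y2 Hy)
    by (intros; apply H4; lra).
  reflexivity.
Qed.

Lemma rectI_le (f : C -> C) (M : R) : (forall z, on_rect x1 x2 y1 y2 z -> ccont f z) ->
  (forall z, on_rect x1 x2 y1 y2 z -> Cmod (f z) <= M) ->
  Cmod (rectI f x1 x2 y1 y2) <= M * (2 * ((x2 - x1) + (y2 - y1))).
Proof.
  intros Hf HM. apply ex_edges in Hf. destruct Hf as [F1 [F2 [F3 F4]]].
  apply on_rect_edges in HM. destruct HM as [H1 [H2 [H3 H4]]].
  apply Cint_le_const with (M := M) in F1, F2, F3, F4; try easy.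
  unfold rectI. eapply Rle_trans; [apply Cmod_triangle|].
  rewrite Cmod_mult, Cmod_Ci.
  unfold Cminus at 1 2.
  generalize (Cmod_triangle (Cint (fun t : R => f (t, y1)) x1 x2)
    (- Cint (fun t : R => f (t, y2)) x1 x2)).
  generalize (Cmod_triangle (Cint (fun t : R => f (x2, t)) y1 y2)
    (- Cint (fun t : R => f (x1, t)) y1 y2)).
  rewrite !Cmod_opp. lra.
Qed.

Lemma rectI_const (c : C) : rectI (fun _ => c) x1 x2 y1 y2 = 0%C.
Proof. unfold rectI. rewrite !Cint_const. ring. Qed.

Lemma rectI_id : rectI (fun z => z) x1 x2 y1 y2 = 0%C.
Proof.
  assert (H : forall z, on_rect x1 x2 y1 y2 z -> ccont (fun z => z) z)
    by (intros; apply ccont_id).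
  apply ex_edges in H. destruct H as [F1 [F2 [F3 F4]]].
  unfold rectI.
  rewrite <- (Cint_minus (fun t => (t, y1)) (fun t => (t, y2))) by easy.
  rewrite <- (Cint_minus (fun t => (x2, t)) (fun t => (x1, t))) by easy.
  rewrite (Cint_ext (fun t => (t, y1) - (t, y2))%C (fun _ => (0, y1 - y2))),
    (Cint_ext (fun t => (x2, t) - (x1, t))%C (fun _ => (x2 - x1, 0))); try easy.
  - rewrite !Cint_const. apply injective_projections; simpl; ring.
  - intros t _. apply injective_projections; simpl; ring.
  - intros t _. apply injective_projections; simpl; ring.
Qed.

Lemma rectI_split_x (f : C -> C) (x : R) : x1 <= x <= x2 ->
  (forall t, x1 <= t <= x2 -> ccont f (t, y1)) ->
  (forall t, x1 <= t <= x2 -> ccont f (t, y2)) ->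
  rectI f x1 x2 y1 y2 = (rectI f x1 x y1 y2 + rectI f x x2 y1 y2)%C.
Proof.
  intros H H1 H2. unfold rectI.
  rewrite (Cint_Chasles (fun t => f (t, y1)) x1 x x2),
    (Cint_Chasles (fun t => f (t, y2)) x1 x x2).
  - ring.
  - apply ex_Cint_hor; [easy|]. intros; apply H2; lra.
  - apply ex_Cint_hor; [easy|]. intros; apply H2; lra.
  - apply ex_Cint_hor; [easy|]. intros; apply H1; lra.
  - apply ex_Cint_hor; [easy|]. intros; apply H1; lra.
Qed.

Lemma rectI_split_y (f : C -> C) (y : R) : y1 <= y <= y2 ->
  (forall t, y1 <= t <= y2 -> ccont f (x1, t)) ->
  (forall t, y1 <= t <= y2 -> ccont f (x2, t)) ->
  rectI f x1 x2 y1 y2 = (rectI f x1 x2 y1 y + rectI f x1 x2 y y2)%C.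
Proof.
  intros H H1 H2. unfold rectI.
  rewrite (Cint_Chasles (fun t => f (x1, t)) y1 y y2),
    (Cint_Chasles (fun t => f (x2, t)) y1 y y2).
  - ring.
  - apply ex_Cint_ver; [easy|]. intros; apply H2; lra.
  - apply ex_Cint_ver; [easy|]. intros; apply H2; lra.
  - apply ex_Cint_ver; [easy|]. intros; apply H1; lra.
  - apply ex_Cint_ver; [easy|]. intros; apply H1; lra.
Qed.

End Rect.

(** * Goursat's theorem by bisection *)

Lemma rectI_quarter (f : C -> C) (a b w h : R) : 0 <= w -> 0 <= h ->
  (forall z, in_rect a (a + 2 * w) b (b + 2 * h) z -> ccont f z) ->
  exists a' b', (a' = a \/ a' = a + w) /\ (b' = b \/ b' = b + h) /\
    Cmod (rectI f a (a + 2 * w) b (b + 2 * h)) / 4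
      <= Cmod (rectI f a' (a' + w) b' (b' + h)).
Proof.
  intros Hw Hh Hf.
  assert (Hs : rectI f a (a + 2 * w) b (b + 2 * h) =
    ((rectI f a (a + w) b (b + h) + rectI f a (a + w) (b + h) (b + h + h)) +
     (rectI f (a + w) (a + w + w) b (b + h)
      + rectI f (a + w) (a + w + w) (b + h) (b + h + h)))%C).
  { replace (a + w + w) with (a + 2 * w) by ring.
    replace (b + h + h) with (b + 2 * h) by ring.
    rewrite (rectI_split_x a (a + 2 * w) b (b + 2 * h)) with (x := a + w).
    2: lra.
    2,3: intros t Ht; apply Hf; unfold in_rect; simpl; lra.
    rewrite (rectI_split_y a (a + w) b (b + 2 * h)) with (y := b + h).
    2: lra.
    2,3: intros t Ht; apply Hf; unfold in_rect; simpl; lra.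
    rewrite (rectI_split_y (a + w) (a + 2 * w) b (b + 2 * h)) with (y := b + h).
    2: lra.
    2,3: intros t Ht; apply Hf; unfold in_rect; simpl; lra.
    reflexivity. }
  rewrite Hs.
  set (I1 := rectI f a (a + w) b (b + h)).
  set (I2 := rectI f a (a + w) (b + h) (b + h + h)).
  set (I3 := rectI f (a + w) (a + w + w) b (b + h)).
  set (I4 := rectI f (a + w) (a + w + w) (b + h) (b + h + h)).
  assert (T1 := Cmod_triangle (I1 + I2) (I3 + I4)).
  assert (T2 := Cmod_triangle I1 I2). assert (T3 := Cmod_triangle I3 I4).
  set (E := Cmod (I1 + I2 + (I3 + I4))) in *.
  destruct (Rle_dec (E / 4) (Cmod I1)); [exists a, b; auto|].
  destruct (Rle_dec (E / 4) (Cmod I2)); [exists a, (b + h); auto|].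
  destruct (Rle_dec (E / 4) (Cmod I3)); [exists (a + w), b; auto|].
  exists (a + w), (b + h). split; [auto|split; [auto|]]. fold I4. lra.
Qed.

(** Left endpoints increase and right endpoints decrease, so every right endpoint bounds every left
    one; [c] is the supremum of the left endpoints. *)
Lemma nested_limit (x : nat -> R) (w : R) : 0 <= w ->
  (forall n, x n <= x (S n) /\ x (S n) + w / 2 ^ S n <= x n + w / 2 ^ n) ->
  exists c, forall n, x n <= c <= x n + w / 2 ^ n.
Proof.
  intros Hw H.
  assert (Hinc : forall n m, x n <= x (n + m)%nat /\
    x (n + m)%nat + w / 2 ^ (n + m) <= x n + w / 2 ^ n).
  { intros n m. induction m as [|m IH].
    - rewrite Nat.add_0_r. lra.
    - rewrite Nat.add_succ_r. specialize (H (n + m)%nat). lra. }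
  assert (Hp : forall n, 0 <= w / 2 ^ n).
  { intros n. apply Rdiv_le_0_compat; [easy|]. apply pow_lt. lra. }
  assert (Hb : forall n m, x m <= x n + w / 2 ^ n).
  { intros n m. destruct (Nat.le_ge_cases n m) as [L|L].
    - replace m with (n + (m - n))%nat by lia.
      generalize (Hinc n (m - n)%nat) (Hp (n + (m - n))%nat). lra.
    - replace n with (m + (n - m))%nat by lia.
      generalize (Hinc m (n - m)%nat) (Hp (m + (n - m))%nat). lra. }
  destruct (completeness (fun t => exists n, t = x n)) as [c [Hc1 Hc2]].
  - exists (x O + w / 2 ^ 0). intros t [n ->]. apply Hb.
  - now exists (x O), O.
  - exists c. intros n. split.
    + apply Hc1. now exists n.
    + apply Hc2. intros t [m ->]. apply Hb.
Qed.

Lemma pow2_small (a eps : R) : 0 < eps -> exists n : nat, a / 2 ^ n < eps.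
Proof.
  intros He. destruct (Pow_x_infinity 2 ltac:(rewrite Rabs_right; lra) (Rabs a / eps + 1))
    as [N HN].
  exists N. specialize (HN N (le_n N)).
  assert (Hp : 0 < 2 ^ N) by (apply pow_lt; lra).
  rewrite Rabs_right in HN by lra.
  apply Rlt_div_l; [easy|].
  assert (Rabs a < eps * 2 ^ N).
  { rewrite Rmult_comm. apply Rlt_div_l; [easy|]. lra. }
  generalize (Rle_abs a). lra.
Qed.

Lemma Cmod_in_rect (a b w h : R) (c z : C) :
  in_rect a (a + w) b (b + h) c -> in_rect a (a + w) b (b + h) z -> Cmod (z - c) <= w + h.
Proof.
  intros [H1 H2] [H3 H4]. apply Cmod_le_box; lra.
Qed.

Theorem goursat (f : C -> C) (x1 x2 y1 y2 : R) : x1 <= x2 -> y1 <= y2 ->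
  (forall z, in_rect x1 x2 y1 y2 z -> cdiff f z) -> rectI f x1 x2 y1 y2 = 0%C.
Proof.
  intros Hx Hy Hf. apply Cmod_eq_0.
  assert (Hc : forall z, in_rect x1 x2 y1 y2 z -> ccont f z)
    by (intros; now apply cdiff_ccont, Hf).
  destruct (Rle_lt_or_eq_dec 0 _ (Cmod_ge_0 (rectI f x1 x2 y1 y2))) as [HE|]; [|easy].
  exfalso. set (E := Cmod (rectI f x1 x2 y1 y2)) in *.
  set (w := x2 - x1). set (h := y2 - y1).
  assert (Hw : forall n, 0 <= w / 2 ^ n).
  { intros n. apply Rdiv_le_0_compat; [unfold w; lra|]. apply pow_lt. lra. }
  assert (Hh : forall n, 0 <= h / 2 ^ n).
  { intros n. apply Rdiv_le_0_compat; [unfold h; lra|]. apply pow_lt. lra. }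
  assert (H2 : forall u n, u / 2 ^ n = 2 * (u / 2 ^ S n)).
  { intros u n. simpl. field. apply pow_nonzero. lra. }
  set (P := fun n (p : R * R) => x1 <= fst p /\ fst p + w / 2 ^ n <= x2 /\
    y1 <= snd p /\ snd p + h / 2 ^ n <= y2 /\
    E / 4 ^ n <= Cmod (rectI f (fst p) (fst p + w / 2 ^ n) (snd p) (snd p + h / 2 ^ n))).
  set (Q := fun n (p p' : R * R) => P (S n) p' /\
    (fst p' = fst p \/ fst p' = fst p + w / 2 ^ S n) /\
    (snd p' = snd p \/ snd p' = snd p + h / 2 ^ S n)).
  assert (Hstep : forall n p, P n p -> exists p', Q n p p').
  { intros n [a b] (A1 & A2 & B1 & B2 & HP). simpl in A1, A2, B1, B2, HP.
    rewrite (H2 w), (H2 h) in HP. rewrite (H2 w) in A2. rewrite (H2 h) in B2.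
    destruct (rectI_quarter f a b (w / 2 ^ S n) (h / 2 ^ S n)) as (a' & b' & Ha & Hb & Hq);
      try easy.
    - intros z [Z1 Z2]. apply Hc. unfold in_rect. lra.
    - exists (a', b'). unfold Q, P. cbn [fst snd].
      generalize (Hw (S n)) (Hh (S n)). intros.
      repeat split; try easy; try (destruct Ha, Hb; lra).
      apply Rle_trans with (2 := Hq).
      replace (E / 4 ^ S n) with (E / 4 ^ n / 4)
        by (simpl; field; apply pow_nonzero; lra).
      lra. }
  assert (H0 : P O (x1, y1)).
  { unfold P. simpl. unfold Rdiv. rewrite Rinv_1, !Rmult_1_r.
    replace (x1 + w) with x2 by (unfold w; ring).
    replace (y1 + h) with y2 by (unfold h; ring). unfold E. lra. }
  (* The recursion carries the invariant [P] along with the corner, because the choice of the next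
     quarter depends on it. *)
  set (g := fix g n : {p | P n p} := match n with
    | O => exist _ _ H0
    | S n => let s := g n in
      let e := constructive_indefinite_description _ (Hstep n _ (proj2_sig s)) in
      exist _ (proj1_sig e) (proj1 (proj2_sig e)) end).
  set (u := fun n => proj1_sig (g n)).
  assert (Hu : forall n, P n (u n)) by (intros n; apply (proj2_sig (g n))).
  assert (Hu' : forall n, Q n (u n) (u (S n))).
  { intros n. unfold u. cbn [g].
    apply (proj2_sig (constructive_indefinite_description _
      (Hstep n _ (proj2_sig (g n))))). }
  destruct (nested_limit (fun n => fst (u n)) w) as [cx Hcx].
  { unfold w; lra. }
  { intros n. destruct (Hu' n) as [_ [Hq _]]. rewrite (H2 w n).
    generalize (Hw (S n)). destruct Hq as [-> | ->]; lra. }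
  destruct (nested_limit (fun n => snd (u n)) h) as [cy Hcy].
  { unfold h; lra. }
  { intros n. destruct (Hu' n) as [_ [_ Hq]]. rewrite (H2 h n).
    generalize (Hh (S n)). destruct Hq as [-> | ->]; lra. }
  set (c := (cx, cy) : C).
  assert (Hin : in_rect x1 x2 y1 y2 c).
  { destruct (Hu O) as (A1 & A2 & B1 & B2 & _).
    generalize (Hcx O) (Hcy O). unfold in_rect, c; simpl in *. lra. }
  assert (Hd := Hf c Hin). apply ex_derive_C in Hd. destruct Hd as [l Hl].
  (* Any [K] above [(w + h) ^ 2] contradicts [E <= E * (w + h) ^ 2 / K] at the end; the [+ 1] keeps
     it positive for a degenerate rectangle. *)
  set (K := (w + h) * (w + h) * 2 + 1).
  assert (Hsq : 0 <= (w + h) * (w + h)) by apply Rle_0_sqr.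
  assert (HK : 0 < K) by (unfold K; lra).
  destruct (Hl (E / (2 * K))) as [d [Hdp Hd]]; [apply Rdiv_lt_0_compat; lra|].
  destruct (pow2_small (w + h) d Hdp) as [n Hn].
  destruct (Hu n) as (A1 & A2 & B1 & B2 & HP).
  set (a := fst (u n)) in *. set (b := snd (u n)) in *.
  set (wn := w / 2 ^ n) in *. set (hn := h / 2 ^ n) in *.
  assert (Hwn : 0 <= wn) by apply Hw. assert (Hhn : 0 <= hn) by apply Hh.
  assert (Hsn : wn + hn < d) by (unfold wn, hn; unfold Rdiv in *; lra).
  assert (Hcin : in_rect a (a + wn) b (b + hn) c).
  { generalize (Hcx n) (Hcy n). unfold in_rect, c; simpl. fold a b wn hn. lra. }
  assert (Hon : forall z, on_rect a (a + wn) b (b + hn) z -> ccont f z).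
  { intros z [[Z1 Z2] _]. apply Hc. unfold in_rect. lra. }
  (* The affine part of [f] at [c] integrates to zero over the boundary, which leaves only the
     remainder of first order. *)
  assert (E1 : rectI f a (a + wn) b (b + hn) =
    rectI (fun z => f z - f c - l * (z - c))%C a (a + wn) b (b + hn)).
  { assert (Hlc : forall z, on_rect a (a + wn) b (b + hn) z ->
      ccont (fun z => (l * c - f c) + (- l) * z)%C z).
    { intros z _. apply (ccont_plus (fun _ => (l * c - f c)%C)); [apply ccont_const|].
      apply ccont_mult; [apply ccont_const|apply ccont_id]. }
    rewrite (rectI_ext a (a + wn) b (b + hn) ltac:(lra) ltac:(lra)
      (fun z => f z - f c - l * (z - c))%C (fun z => f z + ((l * c - f c) + (- l) * z))%C).
    2: intros z _; ring.
    rewrite rectI_plus by (easy || lra).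
    rewrite (rectI_plus a (a + wn) b (b + hn)) with (f := fun _ => (l * c - f c)%C);
      try lra.
    2: intros z _; apply ccont_const.
    2: intros z _; apply ccont_mult; [apply ccont_const|apply ccont_id].
    rewrite rectI_scal by (lra || (intros; apply ccont_id)).
    rewrite rectI_const. rewrite rectI_id by lra. ring. }
  assert (E2 : Cmod (rectI f a (a + wn) b (b + hn)) <=
    (E / (2 * K) * (wn + hn)) * (2 * (wn + hn))).
  { rewrite E1.
    replace (2 * (wn + hn)) with (2 * (((a + wn) - a) + ((b + hn) - b))) by ring.
    apply rectI_le; try lra.
    - intros z Hz. apply Hon in Hz.
      apply (ccont_plus (fun z => f z - f c)%C (fun z => - (l * (z - c)))%C).
      + apply (ccont_plus f); [easy|apply ccont_const].
      + apply (ccont_ext_loc (fun z => (- l) * z + l * c)%C _ z 1); [lra| |].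
        * intros v _. ring.
        * apply ccont_plus; [|apply ccont_const].
          apply ccont_mult; [apply ccont_const|apply ccont_id].
    - intros z [Hz _]. assert (Hzc := Cmod_in_rect _ _ _ _ _ _ Hcin Hz).
      eapply Rle_trans; [apply Hd; lra|].
      apply Rmult_le_compat_l; [|easy]. left. apply Rdiv_lt_0_compat; lra. }
  assert (Hp : 0 < 2 ^ n) by (apply pow_lt; lra).
  assert (H4 : 4 ^ n = 2 ^ n * 2 ^ n).
  { replace 4 with (2 * 2) by ring. apply Rpow_mult_distr. }
  assert (E3 : E / 4 ^ n <= E / K * ((w + h) * (w + h)) / 4 ^ n).
  { eapply Rle_trans; [exact HP|]. eapply Rle_trans; [exact E2|].
    right. unfold wn, hn. rewrite H4. field. lra. }
  apply Rmult_le_compat_r with (r := 4 ^ n) in E3; [|rewrite H4; nra].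
  replace (E / 4 ^ n * 4 ^ n) with E in E3 by (field; rewrite H4; nra).
  replace (E / K * ((w + h) * (w + h)) / 4 ^ n * 4 ^ n)
    with (E * ((w + h) * (w + h)) / K) in E3 by (field; rewrite H4; nra).
  apply Rle_div_r in E3; [|easy]. unfold K in E3. nra.
Qed.

(** * Cauchy's formula on rectangles *)

Lemma Csub_neq (z w : C) : z <> w -> (z - w)%C <> 0%C.
Proof. intros H E. apply H. replace z with ((z - w) + w)%C by ring. rewrite E. ring. Qed.

Lemma neq_Re (z w : C) : Re z <> Re w -> z <> w.
Proof. now intros H ->. Qed.

Lemma neq_Im (z w : C) : Im z <> Im w -> z <> w.
Proof. now intros H ->. Qed.

Lemma cdiff_shift (w z : C) : cdiff (fun u => u - w)%C z.
Proof. apply cdiff_minus; [apply cdiff_id|apply cdiff_const]. Qed.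

Lemma rect_margin (x1 x2 y1 y2 : R) (z : C) : x1 < Re z < x2 -> y1 < Im z < y2 ->
  exists d, 0 < d /\ d <= Re z - x1 /\ d <= x2 - Re z /\ d <= Im z - y1 /\ d <= y2 - Im z.
Proof.
  intros Hx Hy. set (a := Rmin (Re z - x1) (x2 - Re z)).
    set (b := Rmin (Im z - y1) (y2 - Im z)).
  exists (Rmin a b). split; [repeat apply Rmin_pos; lra|].
  generalize (Rmin_l a b) (Rmin_r a b) (Rmin_l (Re z - x1) (x2 - Re z))
    (Rmin_r (Re z - x1) (x2 - Re z)) (Rmin_l (Im z - y1) (y2 - Im z))
    (Rmin_r (Im z - y1) (y2 - Im z)). fold a b. lra.
Qed.

Lemma on_rect_dist (x1 x2 y1 y2 : R) (z w : C) (d : R) :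
  d <= Re z - x1 -> d <= x2 - Re z -> d <= Im z - y1 -> d <= y2 - Im z ->
  on_rect x1 x2 y1 y2 w -> d <= Cmod (w - z).
Proof.
  intros H1 H2 H3 H4 [_ H].
  destruct (Rle_lt_dec d (Cmod (w - z))) as [L|L]; [easy|exfalso].
  generalize (Re_near w z d L) (Im_near w z d L). lra.
Qed.

(** The four rectangles to the left, to the right, below and above the square avoid [z0], so
    Goursat's theorem annihilates them. *)
Lemma rectI_excise (f : C -> C) (x1 x2 y1 y2 : R) (z0 : C) (r : R) : 0 < r ->
  x1 <= Re z0 - r -> Re z0 + r <= x2 -> y1 <= Im z0 - r -> Im z0 + r <= y2 ->
  (forall z, in_rect x1 x2 y1 y2 z -> z <> z0 -> cdiff f z) ->
  rectI f x1 x2 y1 y2 = rectI f (Re z0 - r) (Re z0 + r) (Im z0 - r) (Im z0 + r).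
Proof.
  intros Hr X1 X2 Y1 Y2 Hf.
  set (x0 := Re z0) in *. set (y0 := Im z0) in *.
  assert (Hh : forall t y, x1 <= t <= x2 -> y1 <= y <= y2 -> y <> y0 -> ccont f (t, y)).
  { intros t y Ht Hy n. apply cdiff_ccont, Hf; [easy|]. now apply neq_Im. }
  assert (Hv : forall t y, x1 <= t <= x2 -> y1 <= y <= y2 -> t <> x0 -> ccont f (t, y)).
  { intros t y Ht Hy n. apply cdiff_ccont, Hf; [easy|]. now apply neq_Re. }
  rewrite (rectI_split_x x1 x2 y1 y2) with (x := x0 - r);
    [|lra|intros; apply Hh; lra|intros; apply Hh; lra].
  rewrite (goursat f x1 (x0 - r)); try lra.
  2: { intros z [Z1 Z2]. apply Hf; [unfold in_rect; lra|]. apply neq_Re. fold x0. lra. }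
  rewrite (rectI_split_x (x0 - r) x2 y1 y2) with (x := x0 + r);
    [|lra|intros; apply Hh; lra|intros; apply Hh; lra].
  rewrite (goursat f (x0 + r) x2); try lra.
  2: { intros z [Z1 Z2]. apply Hf; [unfold in_rect; lra|]. apply neq_Re. fold x0. lra. }
  rewrite (rectI_split_y (x0 - r) (x0 + r) y1 y2) with (y := y0 - r);
    [|lra|intros; apply Hv; lra|intros; apply Hv; lra].
  rewrite (goursat f (x0 - r) (x0 + r) y1 (y0 - r)); try lra.
  2: { intros z [Z1 Z2]. apply Hf; [unfold in_rect; lra|]. apply neq_Im. fold y0. lra. }
  rewrite (rectI_split_y (x0 - r) (x0 + r) (y0 - r) y2) with (y := y0 + r);
    [|lra|intros; apply Hv; lra|intros; apply Hv; lra].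
  rewrite (goursat f (x0 - r) (x0 + r) (y0 + r) y2); try lra.
  2: { intros z [Z1 Z2]. apply Hf; [unfold in_rect; lra|]. apply neq_Im. fold y0. lra. }
  ring.
Qed.

(** This primitive of the Poisson kernel serves three times: for the integral of [1 / (z - z0)]
    around a square, as majorant on horizontal lines, and for sums over rows of zeros. *)
Lemma is_RInt_poisson (x r a b : R) : 0 < r ->
  is_RInt (fun t => r / ((t - x) ^ 2 + r ^ 2)) a b (atan ((b - x) / r) - atan ((a - x) / r)).
Proof.
  intros Hr. assert (Hp : forall t, (t - x) ^ 2 + r ^ 2 > 0).
  { intros t. generalize (pow2_ge_0 (t - x)) (pow_lt r 2 Hr). lra. }
  apply (is_RInt_derive (V := R_CompleteNormedModule)
    (fun t => atan ((t - x) / r)) (fun t => r / ((t - x) ^ 2 + r ^ 2))).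
  - intros t _. auto_derive; [easy|]. specialize (Hp t). field. simpl in *. repeat split; lra.
  - intros t _. apply (ex_derive_continuous (K := R_AbsRing) (V := R_NormedModule)).
    auto_derive. specialize (Hp t). simpl in *. lra.
Qed.

Lemma is_Cint_RtoC (g : R -> R) (a b l : R) : is_RInt g a b l ->
  is_RInt (V := CV) (fun t => RtoC (g t)) a b (RtoC l).
Proof.
  intros H. apply (is_RInt_fct_extend_pair (U := R_NormedModule) (V := R_NormedModule)
    (fun t => RtoC (g t)) a b); simpl; [easy|].
  assert (H0 := is_RInt_const (V := R_NormedModule) a b 0).
  change (scal (b - a) 0) with ((b - a) * 0) in H0. now rewrite Rmult_0_r in H0.
Qed.

(** On opposite edges the two integrands combine to a multiple of a Poisson kernel. Each pair of
    edges contributes [PI * Ci], so neither a logarithm nor a winding number is involved. *)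
Lemma rectI_inv_square (z0 : C) (r : R) : 0 < r ->
  rectI (fun z => / (z - z0))%C (Re z0 - r) (Re z0 + r) (Im z0 - r) (Im z0 + r)
  = (RtoC (2 * PI) * Ci)%C.
Proof.
  intros Hr. destruct z0 as [x0 y0]. cbn [Re Im fst snd].
  assert (Hc : forall z, on_rect (x0 - r) (x0 + r) (y0 - r) (y0 + r) z ->
    ccont (fun z => / (z - (x0, y0)))%C z).
  { intros z [_ Hz]. apply cdiff_ccont, cdiff_inv; [apply cdiff_shift|]. apply Csub_neq.
    intros ->. simpl in Hz. lra. }
  apply ex_edges in Hc; try lra. destruct Hc as [E1 [E2 [E3 E4]]].
  assert (H1 : is_RInt (V := CV)
    (fun t => 2 * Ci * RtoC (r / ((t - x0) ^ 2 + r ^ 2)))%C (x0 - r) (x0 + r)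
    (2 * Ci * RtoC (atan ((x0 + r - x0) / r) - atan ((x0 - r - x0) / r)))%C).
  { now apply is_Cint_scal, is_Cint_RtoC, is_RInt_poisson. }
  assert (H2 : is_RInt (V := CV)
    (fun t => 2 * RtoC (r / ((t - y0) ^ 2 + r ^ 2)))%C (y0 - r) (y0 + r)
    (2 * RtoC (atan ((y0 + r - y0) / r) - atan ((y0 - r - y0) / r)))%C).
  { now apply is_Cint_scal, is_Cint_RtoC, is_RInt_poisson. }
  apply (is_RInt_unique (V := CV)) in H1, H2.
  unfold rectI. rewrite <- (Cint_minus _ _ _ _ E1 E2), <- (Cint_minus _ _ _ _ E3 E4).
  assert (P2 : forall u : R, u ^ 2 + r ^ 2 <> 0) by (intros; nra).
  rewrite (Cint_ext _ (fun t => 2 * Ci * RtoC (r / ((t - x0) ^ 2 + r ^ 2)))%C), H1.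
  2: lra.
  2: { intros t _. specialize (P2 (t - x0)).
    unfold Cinv, Cminus, Copp, Cplus, Cmult, Ci, RtoC; cbn [fst snd].
    f_equal; field; nra. }
  rewrite (Cint_ext _ (fun t => 2 * RtoC (r / ((t - y0) ^ 2 + r ^ 2)))%C), H2.
  2: lra.
  2: { intros t _. specialize (P2 (t - y0)).
    unfold Cinv, Cminus, Copp, Cplus, Cmult, Ci, RtoC; cbn [fst snd].
    f_equal; field; nra. }
  replace ((x0 + r - x0) / r) with 1 by (field; lra).
  replace ((y0 + r - y0) / r) with 1 by (field; lra).
  replace ((x0 - r - x0) / r) with (- (1)) by (field; lra).
  replace ((y0 - r - y0) / r) with (- (1)) by (field; lra).
  rewrite atan_opp, atan_1.
  apply injective_projections; simpl; field.
Qed.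

(** The difference quotient [G] is bounded near [z0]. Its integral can be moved to arbitrarily small
    squares and hence vanishes, without any extension of [G] to [z0]. *)
Theorem cauchy_formula (f : C -> C) (x1 x2 y1 y2 : R) (z0 : C) :
  x1 < Re z0 < x2 -> y1 < Im z0 < y2 ->
  (forall z, in_rect x1 x2 y1 y2 z -> cdiff f z) ->
  rectI (fun z => f z / (z - z0))%C x1 x2 y1 y2 = (RtoC (2 * PI) * Ci * f z0)%C.
Proof.
  intros Hx Hy Hf.
  assert (Hz0 : in_rect x1 x2 y1 y2 z0) by (unfold in_rect; lra).
  destruct (rect_margin x1 x2 y1 y2 z0 Hx Hy) as (r & Hr & Hr').
  set (G := fun z => ((f z - f z0) / (z - z0))%C).
  assert (HG : forall z, in_rect x1 x2 y1 y2 z -> z <> z0 -> cdiff G z).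
  { intros z Hz n. apply cdiff_div; [|apply cdiff_shift|now apply Csub_neq].
    apply cdiff_minus; [now apply Hf|apply cdiff_const]. }
  assert (HI : forall z, in_rect x1 x2 y1 y2 z -> z <> z0 -> cdiff (fun z => / (z - z0))%C z).
  { intros z Hz n. apply cdiff_inv; [apply cdiff_shift|now apply Csub_neq]. }
  assert (Hon : forall z, on_rect x1 x2 y1 y2 z -> in_rect x1 x2 y1 y2 z /\ z <> z0).
  { intros z [H1 H2]. split; [easy|]. intros ->. lra. }
  assert (HG0 : rectI G x1 x2 y1 y2 = 0%C).
  { apply Cmod_eq_0. apply Rle_antisym; [|apply Cmod_ge_0].
    assert (Hd := Hf z0 Hz0). apply cdiff_caratheodory in Hd.
    destruct Hd as [phi [Hphi E]].
    destruct (ccont_bounded phi z0 Hphi) as [d [Hd HM]].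
    set (M := Cmod (phi z0) + 1) in *.
    assert (HMp : 0 < M) by (unfold M; generalize (Cmod_ge_0 (phi z0)); lra).
    apply le_epsilon. intros eps He. rewrite Rplus_0_l.
    (* The square has perimeter [8 * rho], whence [eps / (8 * M)]; its points are within
       [2 * rho < d] of [z0]. *)
    set (rho := Rmin r (Rmin (d / 3) (eps / (8 * M)))).
    assert (Hrho : 0 < rho).
    { unfold rho. repeat apply Rmin_pos; try lra. apply Rdiv_lt_0_compat; lra. }
    assert (Hrho' : rho <= r /\ rho <= d / 3 /\ rho <= eps / (8 * M)).
    { unfold rho. generalize (Rmin_l r (Rmin (d / 3) (eps / (8 * M))))
        (Rmin_r r (Rmin (d / 3) (eps / (8 * M)))) (Rmin_l (d / 3) (eps / (8 * M)))
        (Rmin_r (d / 3) (eps / (8 * M))). lra. }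
    rewrite (rectI_excise G x1 x2 y1 y2 z0 rho) by (easy || lra).
    assert (Hs : forall z,
      on_rect (Re z0 - rho) (Re z0 + rho) (Im z0 - rho) (Im z0 + rho) z ->
      in_rect x1 x2 y1 y2 z /\ z <> z0 /\ Cmod (z - z0) < d).
    { intros z [[Z1 Z2] Z3]. split; [unfold in_rect; lra|]. split; [intros ->; lra|].
      apply Rle_lt_trans with (rho + rho); [apply Cmod_le_box; lra|].
      lra. }
    eapply Rle_trans; [apply rectI_le with (M := M)|]; try lra.
    - intros z Hz. apply cdiff_ccont, HG; now apply Hs.
    - intros z Hz. destruct (Hs z Hz) as [H1 [H2 H3]]. unfold G. rewrite E.
      replace (phi z * (z - z0) / (z - z0))%C with (phi z); [now apply HM|].
      field. now apply Csub_neq.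
    - assert (rho * (8 * M) <= eps) by (apply Rle_div_r; lra). lra. }
  rewrite (rectI_ext x1 x2 y1 y2 ltac:(lra) ltac:(lra) _
    (fun z => G z + f z0 * (/ (z - z0)))%C).
  2: { intros z Hz. destruct (Hon z Hz) as [_ n]. unfold G. field. now apply Csub_neq. }
  assert (CG : forall z, on_rect x1 x2 y1 y2 z -> ccont G z).
  { intros z Hz. apply cdiff_ccont, HG; now apply Hon. }
  assert (CI : forall z, on_rect x1 x2 y1 y2 z -> ccont (fun z => / (z - z0))%C z).
  { intros z Hz. apply cdiff_ccont, HI; now apply Hon. }
  rewrite rectI_plus by (lra || easy || (intros; apply ccont_mult;
    [apply ccont_const|now apply CI])).
  rewrite rectI_scal by (lra || easy).
  rewrite HG0, (rectI_excise (fun z => / (z - z0))%C x1 x2 y1 y2 z0 r) by (easy || lra).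
  rewrite rectI_inv_square by easy. ring.
Qed.

Lemma Cmod_2PIi : Cmod (RtoC (2 * PI) * Ci) = 2 * PI.
Proof.
  rewrite Cmod_mult, Cmod_Ci, Cmod_R, Rabs_right; [ring|]. generalize PI_RGT_0; lra.
Qed.

(** * Cauchy integrals, Weierstrass' theorem, Schwarz-Pick *)

(** Composition with [Re] lets the rules for [ccont] apply to functions of a real variable. *)
Lemma rcont_ccont (f : R -> C) (t : R) :
  rcont f t <-> ccont (fun w => f (Re w)) (RtoC t).
Proof.
  split; intros H eps He; destruct (H eps He) as [d [Hd Hs]]; exists d; (split; [easy|]).
  - intros w Hw. apply Hs. eapply Rle_lt_trans; [|exact Hw].
    apply (re_le_Cmod (w - RtoC t)).
  - intros s Hst. apply (Hs (RtoC s)). rewrite <- RtoC_minus. now rewrite Cmod_R.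
Qed.

Lemma rcont_Cmod (f : R -> C) (t : R) : rcont f t -> continuous (fun s => Cmod (f s)) t.
Proof.
  intros H P [eps HP]. destruct (H eps (cond_pos eps)) as [d [Hd Hs]].
  exists (mkposreal d Hd). intros s Hst. apply HP.
  change (Rabs (Cmod (f s) - Cmod (f t)) < eps).
  eapply Rle_lt_trans; [|apply (Hs s Hst)]. apply Rabs_le.
  generalize (Cmod_triangle_rev (f s) (f t)) (Cmod_triangle_rev (f t) (f s)).
  rewrite (Cmod_sub_sym (f t)). lra.
Qed.

(** Differentiation under the integral sign with an explicit remainder: for [h = w - z0] the
    integrand of the error is [h ^ 2 * phi / ((gam - w) * (gam - z0) ^ 2)], at most
    [2 / d ^ 3 * |h| ^ 2 * |phi|] when [|h| < d / 2]. *)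
Lemma cauchy_type_cdiff (phi gam : R -> C) (a b : R) (z0 : C) (d : R) :
  a <= b -> 0 < d -> (forall t, a <= t <= b -> rcont phi t) ->
  (forall t, a <= t <= b -> rcont gam t) ->
  (forall t, a <= t <= b -> d <= Cmod (gam t - z0)) ->
  cdiff (fun z => Cint (fun t => phi t / (gam t - z))%C a b) z0.
Proof.
  intros Hab Hd Hphi Hgam Hdist.
  assert (Hrc : forall z t, a <= t <= b -> gam t <> z ->
    rcont (fun t => phi t / (gam t - z))%C t).
  { intros z t Ht n. apply rcont_ccont. apply (ccont_mult (fun w => phi (Re w))).
    - now apply rcont_ccont, Hphi.
    - apply (ccont_inv (fun w => gam (Re w) - z)%C); [|now apply Csub_neq].
      apply (ccont_plus (fun w => gam (Re w))); [now apply rcont_ccont, Hgam|].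
      apply ccont_const. }
  assert (Hdz : forall z t, a <= t <= b -> Cmod (z - z0) < d / 2 -> d / 2 <= Cmod (gam t - z)).
  { intros z t Ht Hz. generalize (Hdist t Ht) (Cmod_sub_triangle (gam t) z z0). lra. }
  assert (Hne : forall z t, a <= t <= b -> Cmod (z - z0) < d / 2 -> gam t <> z).
  { intros z t Ht Hz E. subst z. generalize (Hdz (gam t) t Ht Hz).
    rewrite Cmod_sub_diag. lra. }
  assert (H0 : Cmod (z0 - z0) < d / 2).
  { rewrite Cmod_sub_diag. lra. }
  assert (Hex : forall z, Cmod (z - z0) < d / 2 ->
    ex_Cint (fun t => phi t / (gam t - z))%C a b).
  { intros z Hz. apply ex_Cint_cont; [easy|]. intros t Ht. apply Hrc; [easy|].
    now apply Hne. }
  assert (Hex2 : ex_Cint (fun t => phi t / (gam t - z0) / (gam t - z0))%C a b).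
  { apply ex_Cint_cont; [easy|]. intros t Ht. apply rcont_ccont.
    apply (ccont_mult (fun w => phi (Re w) / (gam (Re w) - z0))%C).
    - apply (rcont_ccont (fun t => phi t / (gam t - z0))%C). apply Hrc; [easy|now apply Hne].
    - apply (ccont_inv (fun w => gam (Re w) - z0)%C); [|apply Csub_neq; now apply Hne].
      apply (ccont_plus (fun w => gam (Re w))); [now apply rcont_ccont, Hgam|].
      apply ccont_const. }
  assert (Hin : ex_RInt (fun t => Cmod (phi t)) a b).
  { apply (ex_RInt_continuous (V := R_CompleteNormedModule)).
    rewrite Rmin_left, Rmax_right by easy. intros t Ht. now apply rcont_Cmod, Hphi. }
  destruct Hin as [L HL].
  assert (HL0 : 0 <= L).
  { apply (is_RInt_le (fun _ => 0) (fun t => Cmod (phi t)) a b 0 L); try easy.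
    - assert (H := is_RInt_const (V := R_NormedModule) a b 0).
      change (scal (b - a) 0) with ((b - a) * 0) in H. now rewrite Rmult_0_r in H.
    - intros; apply Cmod_ge_0. }
  apply ex_derive_C. exists (Cint (fun t => phi t / (gam t - z0) / (gam t - z0))%C a b).
  intros eps He.
  set (K := 2 / (d * d * d) * L).
  assert (HK : 0 <= K).
  { unfold K. apply Rmult_le_pos; [|easy]. left. apply Rdiv_lt_0_compat; [lra|].
    now repeat apply Rmult_lt_0_compat. }
  exists (Rmin (d / 2) (eps / (K + 1))). split.
  { apply Rmin_pos; [lra|]. apply Rdiv_lt_0_compat; lra. }
  intros w Hw. generalize (Rmin_l (d / 2) (eps / (K + 1))) (Rmin_r (d / 2) (eps / (K + 1))).
  intros M1 M2.
  assert (Hwd : Cmod (w - z0) < d / 2) by lra.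
  assert (Hwe : Cmod (w - z0) * (K + 1) <= eps).
  { apply Rle_div_r; lra. }
  set (h := (w - z0)%C) in *.
  rewrite <- (Cint_minus _ _ _ _ (Hex w Hwd) (Hex z0 H0)).
  rewrite (Cmult_comm _ h), <- (Cint_scal h _ _ _ Hex2).
  rewrite <- (Cint_minus _ _ _ _ (ex_Cint_minus _ _ _ _ (Hex w Hwd) (Hex z0 H0))
    (ex_Cint_scal h _ _ _ Hex2)).
  apply Rle_trans with (K * (Cmod h * Cmod h)).
  2: { assert (0 <= Cmod h) by apply Cmod_ge_0. nra. }
  apply (Cint_le _ (fun t => (2 / (d * d * d) * (Cmod h * Cmod h)) * Cmod (phi t)));
    [easy| | |].
  - apply ex_Cint_minus; [apply ex_Cint_minus; [now apply Hex|now apply Hex]|].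
    now apply ex_Cint_scal.
  - replace (K * (Cmod h * Cmod h)) with ((2 / (d * d * d) * (Cmod h * Cmod h)) * L)
      by (unfold K; ring).
    now apply (is_RInt_scal (V := R_NormedModule)).
  - intros t Ht. assert (N1 := Hne w t Ht Hwd). assert (N0 := Hne z0 t Ht H0).
    apply Csub_neq in N1, N0.
    replace (phi t / (gam t - w) - phi t / (gam t - z0)
      - h * (phi t / (gam t - z0) / (gam t - z0)))%C
      with (h * h * phi t / ((gam t - w) * ((gam t - z0) * (gam t - z0))))%C
      by (unfold h; field; easy).
    rewrite Cmod_div by (repeat apply Cmult_neq_0; easy).
    rewrite !Cmod_mult.
    assert (D1 := Hdz w t Ht Hwd). assert (D0 := Hdist t Ht).
    set (A := Cmod (gam t - w)) in *. set (B := Cmod (gam t - z0)) in *.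
    assert (HAB : d * d * d / 2 <= A * (B * B)).
    { apply Rle_trans with (d / 2 * (d * d)); [lra|].
      apply Rmult_le_compat; nra. }
    assert (Hd3 : 0 < d * d * d) by (repeat apply Rmult_lt_0_compat; easy).
    replace (2 / (d * d * d) * (Cmod h * Cmod h) * Cmod (phi t))
      with (Cmod h * Cmod h * Cmod (phi t) / (d * d * d / 2)) by (field; lra).
    apply Rmult_le_compat_l.
    + repeat apply Rmult_le_pos; apply Cmod_ge_0.
    + apply Rinv_le_contravar; lra.
Qed.

Lemma rectI_cauchy_cdiff (phi : C -> C) (x1 x2 y1 y2 : R) (z0 : C) :
  x1 < Re z0 < x2 -> y1 < Im z0 < y2 ->
  (forall z, on_rect x1 x2 y1 y2 z -> ccont phi z) ->
  cdiff (fun w => rectI (fun z => phi z / (z - w))%C x1 x2 y1 y2) z0.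
Proof.
  intros Hx Hy Hphi.
  apply on_rect_edges in Hphi; [|lra..]. destruct Hphi as [P1 [P2 [P3 P4]]].
  assert (Hh : forall y t, rcont (fun s => (s, y) : C) t).
  { intros y t. apply (rcont_hor (fun z => z)), ccont_id. }
  assert (Hv : forall x t, rcont (fun s => (x, s) : C) t).
  { intros x t. apply (rcont_ver (fun z => z)), ccont_id. }
  destruct (rect_margin x1 x2 y1 y2 z0 Hx Hy) as (d & Hd & D1 & D2 & D3 & D4).
  assert (Dist := on_rect_edges x1 x2 y1 y2 ltac:(lra) ltac:(lra) (fun w => d <= Cmod (w - z0))
    (fun w => on_rect_dist x1 x2 y1 y2 z0 w d D1 D2 D3 D4)).
  destruct Dist as [E1 [E2 [E3 E4]]].
  unfold rectI. apply cdiff_plus; [apply cdiff_minus|apply cdiff_mult;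
    [apply cdiff_const|apply cdiff_minus]].
  - apply (cauchy_type_cdiff (fun t => phi (t, y1)) (fun t => (t, y1)) x1 x2 z0 d);
      auto; try lra. intros t Ht. now apply rcont_hor, P1.
  - apply (cauchy_type_cdiff (fun t => phi (t, y2)) (fun t => (t, y2)) x1 x2 z0 d);
      auto; try lra. intros t Ht. now apply rcont_hor, P2.
  - apply (cauchy_type_cdiff (fun t => phi (x2, t)) (fun t => (x2, t)) y1 y2 z0 d);
      auto; try lra. intros t Ht. now apply rcont_ver, P3.
  - apply (cauchy_type_cdiff (fun t => phi (x1, t)) (fun t => (x1, t)) y1 y2 z0 d);
      auto; try lra. intros t Ht. now apply rcont_ver, P4.
Qed.

(** Cauchy's formula for [F n] passes to the uniform limit, and the resulting integral is
    differentiable because it is of Cauchy type. *)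
Theorem weierstrass (F : nat -> C -> C) (f : C -> C) (z0 : C) (r : R) : 0 < r ->
  (forall n z, Cmod (z - z0) < r -> cdiff (F n) z) ->
  (forall eps, 0 < eps -> exists n, forall z, Cmod (z - z0) < r -> Cmod (F n z - f z) <= eps) ->
  cdiff f z0.
Proof.
  intros Hr HF Hlim.
  assert (Hc : forall z, Cmod (z - z0) < r -> ccont f z).
  { intros z Hz eps He. destruct (Hlim (eps / 4)) as [n Hn]; [lra|].
    destruct (cdiff_ccont _ _ (HF n z Hz) (eps / 4)) as [d [Hd Hw]]; [lra|].
    exists (Rmin d (r - Cmod (z - z0))). split; [apply Rmin_pos; lra|]. intros w Hwd.
    generalize (Rmin_l d (r - Cmod (z - z0))) (Rmin_r d (r - Cmod (z - z0))). intros.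
    assert (Hwr : Cmod (w - z0) < r) by (generalize (Cmod_sub_triangle w z z0); lra).
    generalize (Hn w Hwr) (Hn z Hz) (Hw w ltac:(lra)).
    rewrite (Cmod_sub_sym (F n w) (f w)).
    generalize (Cmod_sub_triangle (f w) (F n w) (f z))
      (Cmod_sub_triangle (F n w) (F n z) (f z)). lra. }
  set (s := r / 4).
  set (x1 := Re z0 - s). set (x2 := Re z0 + s). set (y1 := Im z0 - s). set (y2 := Im z0 + s).
  assert (Hin : forall z, in_rect x1 x2 y1 y2 z -> Cmod (z - z0) < r).
  { intros z [Z1 Z2]. unfold x1, x2, y1, y2, s in *.
    apply Rle_lt_trans with (r / 4 + r / 4); [apply Cmod_le_box|]; lra. }
  assert (HcR : forall z, on_rect x1 x2 y1 y2 z -> ccont f z).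
  { intros z [Hz _]. now apply Hc, Hin. }
  assert (Hs : 0 < s) by (unfold s; lra).
  assert (Hx : x1 < Re z0 < x2) by (unfold x1, x2; lra).
  assert (Hy : y1 < Im z0 < y2) by (unfold y1, y2; lra).
  apply (cdiff_ext_loc
    (fun w => / (RtoC (2 * PI) * Ci) * rectI (fun z => f z / (z - w))%C x1 x2 y1 y2)%C
    f z0 (s / 2)).
  { lra. }
  2: { apply cdiff_mult; [apply cdiff_const|]. now apply rectI_cauchy_cdiff. }
  intros w Hw.
  assert (Wre := Re_near w z0 _ Hw). assert (Wim := Im_near w z0 _ Hw).
  assert (Hwr : Cmod (w - z0) < r) by (unfold s in *; lra).
  assert (Hpi : (RtoC (2 * PI) * Ci)%C <> 0%C).
  { apply Cmod_pos_neq. rewrite Cmod_2PIi. generalize PI_RGT_0; lra. }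
  assert (Hdist : forall z, on_rect x1 x2 y1 y2 z -> s / 2 <= Cmod (z - w)).
  { intros z. apply on_rect_dist; unfold x1, x2, y1, y2; lra. }
  assert (Hne : forall z, on_rect x1 x2 y1 y2 z -> (z - w)%C <> 0%C).
  { intros z Hz. apply Cmod_pos_neq. generalize (Hdist z Hz). lra. }
  assert (E : rectI (fun z => f z / (z - w))%C x1 x2 y1 y2 = (RtoC (2 * PI) * Ci * f w)%C).
  { apply Cmod_sub_0. apply le_epsilon. intros eps He. rewrite Rplus_0_l.
    assert (HPI := PI_RGT_0).
    (* The first term collects the error of the boundary integral, whose kernel is at most [2 / s];
       the second is the error at [w] times [2 * PI]. *)
    set (K := 2 / s * (2 * ((x2 - x1) + (y2 - y1))) + 2 * PI).
    assert (HK : 0 < K).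
    { unfold K, x1, x2, y1, y2.
      assert (0 < 2 / s) by (apply Rdiv_lt_0_compat; lra).
      replace (2 * (Re z0 + s - (Re z0 - s) + (Im z0 + s - (Im z0 - s)))) with (8 * s) by ring.
      nra. }
    destruct (Hlim (eps / K)) as [n Hn]; [now apply Rdiv_lt_0_compat|].
    assert (Hd : forall (g : C -> C), (forall z, on_rect x1 x2 y1 y2 z -> ccont g z) ->
      forall z, on_rect x1 x2 y1 y2 z -> ccont (fun z => g z / (z - w))%C z).
    { intros g Hg z Hz. apply ccont_mult; [now apply Hg|].
      apply (ccont_inv (fun z => z - w)%C); [|now apply Hne].
      apply cdiff_ccont, cdiff_shift. }
    assert (CF : forall z, on_rect x1 x2 y1 y2 z -> ccont (F n) z).
    { intros z [Hz _]. now apply cdiff_ccont, HF, Hin. }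
    rewrite (rectI_ext x1 x2 y1 y2 ltac:(lra) ltac:(lra) _
      (fun z => F n z / (z - w) + (- (1)) * ((F n z - f z) / (z - w)))%C).
    2: { intros z Hz. field. now apply Hne. }
    assert (CD : forall z, on_rect x1 x2 y1 y2 z -> ccont (fun z => F n z - f z)%C z).
    { intros z Hz. apply (ccont_plus (F n) (fun z => - f z)%C); [now apply CF|].
      apply (ccont_ext_loc (fun z => - (1) * f z)%C _ z 1); [lra|intros; ring|].
      apply ccont_mult; [apply ccont_const|now apply HcR]. }
    rewrite rectI_plus.
    2-3: lra.
    2: now apply Hd.
    2: { intros z Hz. apply ccont_mult; [apply ccont_const|].
         now apply (Hd (fun z => F n z - f z)%C). }
    rewrite rectI_scal by (lra || now apply (Hd (fun z => F n z - f z)%C)).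
    rewrite (cauchy_formula (F n))
      by ((unfold x1, x2, y1, y2; lra) || (intros; now apply HF, Hin)).
    replace (RtoC (2 * PI) * Ci * F n w
      + - (1) * rectI (fun z => (F n z - f z) / (z - w))%C x1 x2 y1 y2
      - RtoC (2 * PI) * Ci * f w)%C
      with (RtoC (2 * PI) * Ci * (F n w - f w)
        - rectI (fun z => (F n z - f z) / (z - w))%C x1 x2 y1 y2)%C by ring.
    eapply Rle_trans; [apply Cmod_triangle|]. rewrite Cmod_opp, Cmod_mult, Cmod_2PIi.
    assert (B1 := Hn w Hwr).
    assert (B2 : Cmod (rectI (fun z => (F n z - f z) / (z - w))%C x1 x2 y1 y2) <=
      (eps / K * (2 / s)) * (2 * ((x2 - x1) + (y2 - y1)))).
    { apply rectI_le; try lra.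
      - now apply (Hd (fun z => F n z - f z)%C).
      - intros z Hz. rewrite Cmod_div by now apply Hne.
        apply Rmult_le_compat; try apply Cmod_ge_0.
        + left. apply Rinv_0_lt_compat, Cmod_gt_0. now apply Hne.
        + apply Hn, Hin, Hz.
        + replace (2 / s) with (/ (s / 2)) by (field; lra).
          apply Rinv_le_contravar; [lra|now apply Hdist]. }
    replace eps with (eps / K * K) by (field; lra). unfold K at 2. nra. }
  rewrite E, Cmult_assoc, Cinv_l by easy. ring.
Qed.

(** * The Schwarz-Pick inequality on the half-plane *)

Lemma Cmod_conj_gap (z a : C) :
  Cmod (z - Cconj a) ^ 2 = Cmod (z - a) ^ 2 + 4 * Im z * Im a.
Proof. rewrite !Cmod2_alt. simpl. unfold Re, Im. ring. Qed.

Lemma Cplus_conj_neq (z a : C) : 0 < Im z -> 0 < Im a -> z <> Cconj a.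
Proof. intros Hz Ha. apply neq_Im. simpl. unfold Im in *. lra. Qed.

Lemma Cmod_conj_pos (z a : C) : 0 < Im z -> 0 < Im a -> 0 < Cmod (z - Cconj a).
Proof. intros Hz Ha. now apply Cmod_gt_0, Csub_neq, Cplus_conj_neq. Qed.

(** Taking roots of high powers removes the constant [A]. With Cauchy's formula this replaces the
    maximum principle. *)
Lemma pow_growth_contra (x y A : R) : 0 <= x -> 0 <= y ->
  (forall n, x ^ S (S n) <= A * y ^ S n) -> x <= y.
Proof.
  intros Hx Hy H. destruct (Rle_lt_dec x y) as [L|L]; [easy|exfalso].
  destruct (Rle_lt_or_eq_dec 0 y Hy) as [Hy'| <-].
  - destruct (Pow_x_infinity (x / y)) with (b := A / x + 1) as [N HN].
    { rewrite Rabs_right.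
      - apply Rlt_div_r; lra.
      - apply Rle_ge, Rdiv_le_0_compat; lra. }
    specialize (HN (S N) ltac:(lia)). specialize (H N).
    assert (Hp : 0 < y ^ S N) by now apply pow_lt.
    rewrite Rabs_right in HN.
    + unfold Rdiv in HN. rewrite Rpow_mult_distr, pow_inv in HN.
      change (x ^ S (S N)) with (x * x ^ S N) in H.
      set (X := x ^ S N) in *. set (Y := y ^ S N) in *.
      clearbody X Y.
      assert (X * / Y <= A * / x).
      { apply Rle_div_l; [easy|].
        replace (A * / x * Y) with (A * Y / x) by (unfold Rdiv; ring).
        apply Rle_div_r; lra. }
      lra.
    + apply Rle_ge, pow_le, Rdiv_le_0_compat; lra.
  - specialize (H O). assert (0 < x * x) by now apply Rmult_lt_0_compat.
    replace (x ^ 2) with (x * x) in H by ring. rewrite pow_1, Rmult_0_r in H. lra.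
Qed.

(** With [b] the Blaschke quotient at [a], Cauchy's formula for [F ^ (m + 2) / b ^ (m + 1)] on a
    large rectangle, where [|F| <= 1] and [|b|] is nearly 1 on the boundary, bounds this power at
    [z] up to a constant independent of [m]. Large [m] removes the constant, and the rectangle then
    exhausts the half-plane. *)
Lemma schwarz_pick_zero (F : C -> C) (a z : C) : holomorphic F ->
  (forall w, 0 < Im w -> Cmod (F w) <= 1) -> 0 < Im a -> F a = 0%C -> 0 < Im z ->
  Cmod (F z) * Cmod (z - Cconj a) <= Cmod (z - a).
Proof.
  intros HF HF1 Ha HFa Hz.
  destruct (Ceq_dec z a) as [->|n].
  { rewrite HFa, Cmod_0, Rmult_0_l. apply Cmod_ge_0. }
  set (b := fun w => ((w - a) / (w - Cconj a))%C).
  assert (Hb : forall w, 0 < Im w -> cdiff b w).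
  { intros w Hw. apply cdiff_div; [apply cdiff_shift..|]. now apply Csub_neq, Cplus_conj_neq. }
  set (G := fun m w => (F w ^ S (S m) / b w ^ S m)%C).
  assert (HG : forall m w, 0 < Im w -> cdiff (G m) w).
  { intros m w Hw. destruct (Ceq_dec w a) as [->|nw].
    - assert (Hd := HF a Ha). apply cdiff_caratheodory in Hd.
      destruct Hd as [phi [Hphi E]].
      assert (Hphi' : forall k, ccont (fun w => phi w ^ k)%C a).
      { induction k as [|k IH]; [apply (ccont_const 1%C)|].
        now apply (ccont_mult phi (fun w => phi w ^ k)%C). }
      (* The surplus power of [F] leaves a factor [w - a] after cancellation; a continuous function
         times [w - a] is differentiable at [a]. Division by zero gives [G m a = 0], the right
         value. *)
      apply (cdiff_ext_loc (fun w => phi w ^ S (S m) * (w - Cconj a) ^ S m * (w - a))%C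
        _ a (Im a)); [easy| |].
      + intros v Hv. unfold G, b. destruct (Ceq_dec v a) as [->|nv].
        * rewrite HFa, (Cpow_S (RtoC 0)). unfold Cdiv. ring.
        * replace (F v) with (phi v * (v - a))%C by (rewrite <- E, HFa; ring).
          assert (0 < Im v).
          { assert (H := Im_near v a _ Hv). lra. }
          assert (N1 : (v - a)%C <> 0%C) by now apply Csub_neq.
          assert (N2 : (v - Cconj a)%C <> 0%C) by now apply Csub_neq, Cplus_conj_neq.
          unfold Cdiv. rewrite !Cpow_mult_l, Cpow_inv by easy.
          rewrite !(Cpow_S _ (S m)).
          generalize (Cpow_nz _ (S m) N1) (Cpow_nz _ (S m) N2).
          generalize ((v - a) ^ S m)%C ((v - Cconj a) ^ S m)%C. intros u v' Hu Hv'.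
          field. easy.
      + apply cdiff_caratheodory.
        exists (fun w => phi w ^ S (S m) * (w - Cconj a) ^ S m)%C. split.
        * apply ccont_mult; [apply Hphi'|].
          apply cdiff_ccont, cdiff_pow, cdiff_shift.
        * intros v. ring.
    - apply cdiff_div.
      + now apply cdiff_pow, HF.
      + now apply cdiff_pow, Hb.
      + apply Cpow_nz, Cmod_pos_neq. unfold b.
        rewrite Cmod_div by now apply Csub_neq, Cplus_conj_neq.
        apply Rdiv_lt_0_compat; [now apply Cmod_gt_0, Csub_neq|now apply Cmod_conj_pos]. }
  assert (Hbz : Cmod (b z) * Cmod (z - Cconj a) = Cmod (z - a)).
  { unfold b. assert (H := Cmod_conj_pos z a Hz Ha).
    rewrite Cmod_div by now apply Cmod_pos_neq. field. lra. }
  rewrite <- Hbz. apply Rmult_le_compat_r; [apply Cmod_ge_0|].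
  (* On the boundary [1 - |b w| ^ 2 = 4 * Im w * Im a / |w - Cconj a| ^ 2]. On the bottom edge
     [Im w = e] and the denominator is at least [Im a ^ 2]; on the other edges [Im w <= / e] and it
     is at least [/ e ^ 2]. *)
  set (K := 4 * (Im a + / Im a)).
  assert (HK : 0 < K).
  { unfold K. generalize (Rinv_0_lt_compat _ Ha). lra. }
  assert (Hmain : forall e, 0 < e -> K * e < 1 -> e < Im z < / e -> e < Im a < / e ->
    Rabs (Re z - Re a) < / e -> Cmod (F z) * (1 - K * e) <= Cmod (b z)).
  { intros e He HKe Hez Hea Hre. apply Rabs_def2 in Hre.
    set (x1 := Re a - / e). set (x2 := Re a + / e).
    assert (Hie : 0 < / e) by now apply Rinv_0_lt_compat.
    assert (Hbd : forall w, on_rect x1 x2 e (/ e) w -> 0 < Im w /\ 1 - K * e <= Cmod (b w)).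
    { intros w [[W1 W2] W3]. split; [lra|].
      assert (Hw : 0 < Im w) by lra.
      assert (D := Cmod_conj_pos w a Hw Ha).
      assert (E := Cmod_conj_gap w a).
      unfold b. rewrite Cmod_div by now apply Cmod_pos_neq.
      apply Rle_div_r; [easy|].
      set (p := Cmod (w - Cconj a)) in *. set (q := Cmod (w - a)) in *.
      assert (Hq : 0 <= q) by apply Cmod_ge_0.
      assert (P2 : p ^ 2 = (Re w - Re a) ^ 2 + (Im w + Im a) ^ 2).
      { unfold p. rewrite Cmod2_alt. simpl. unfold Re, Im. ring. }
      assert (H4 : 4 * Im w * Im a <= K * e * p ^ 2).
      { assert (KE : K * e = 4 * Im a * e + 4 * / Im a * e) by (unfold K; ring).
        assert (T1 : 0 < 4 * Im a * e) by (repeat apply Rmult_lt_0_compat; lra).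
        assert (T2 : 0 < 4 * / Im a * e).
        { repeat apply Rmult_lt_0_compat; try lra. now apply Rinv_0_lt_compat. }
        assert (Pp : 0 <= p ^ 2) by apply pow2_ge_0.
        assert (A1 : (Re w - Re a) ^ 2 = (/ e) ^ 2 \/ Im w = e \/ Im w = / e).
        { unfold x1, x2 in W3. destruct W3 as [W3|[W3|[W3|W3]]]; auto;
            left; rewrite W3; ring. }
        assert (Big : (/ e) ^ 2 <= p ^ 2 -> 4 * Im w * Im a <= 4 * Im a * e * p ^ 2).
        { intros H. apply Rle_trans with (4 * Im a * e * (/ e) ^ 2).
          - replace (4 * Im a * e * (/ e) ^ 2) with (4 * (/ e) * Im a) by (field; lra). nra.
          - apply Rmult_le_compat_l; lra. }
        rewrite KE, Rmult_plus_distr_r.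
        assert (0 <= 4 * / Im a * e * p ^ 2) by (apply Rmult_le_pos; lra).
        assert (0 <= 4 * Im a * e * p ^ 2) by (apply Rmult_le_pos; lra).
        destruct A1 as [A1|[A1|A1]].
        - assert (4 * Im w * Im a <= 4 * Im a * e * p ^ 2); [|lra].
          apply Big. rewrite P2, A1. generalize (pow2_ge_0 (Im w + Im a)). lra.
        - assert (4 * Im w * Im a <= 4 * / Im a * e * p ^ 2); [|lra].
          apply Rle_trans with (4 * / Im a * e * (Im a) ^ 2).
          + rewrite A1. right. field. lra.
          + apply Rmult_le_compat_l; [lra|]. rewrite P2.
            generalize (pow2_ge_0 (Re w - Re a)). nra.
        - assert (4 * Im w * Im a <= 4 * Im a * e * p ^ 2); [|lra].
          apply Big. rewrite P2, A1. generalize (pow2_ge_0 (Re w - Re a)). nra. }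
      assert (S2 : 0 <= K * e * (1 - K * e) * p ^ 2).
      { assert (0 < K * e) by now apply Rmult_lt_0_compat.
        apply Rmult_le_pos; [apply Rmult_le_pos; lra|apply pow2_ge_0]. }
      apply Rsqr_incr_0_var; [|easy].
      rewrite !Rsqr_pow2. lra. }
    assert (Hin : forall w, in_rect x1 x2 e (/ e) w -> 0 < Im w).
    { intros w [_ W]. lra. }
    assert (Hx : x1 < Re z < x2) by (unfold x1, x2; lra).
    destruct (rect_margin x1 x2 e (/ e) z Hx Hez) as (d & Hd & M1 & M2 & M3 & M4).
    assert (Hdist := fun w => on_rect_dist x1 x2 e (/ e) z w d M1 M2 M3 M4).
    set (be := 1 - K * e). assert (Hbe : 0 < be) by (unfold be; lra).
    assert (HPI := PI_RGT_0).
    set (A := / d * (2 * ((x2 - x1) + (/ e - e))) / (2 * PI)).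
    apply Rmult_le_reg_r with (/ be); [now apply Rinv_0_lt_compat|].
    replace (Cmod (F z) * be * / be) with (Cmod (F z)) by (field; lra).
    apply (pow_growth_contra _ _ A).
    - apply Cmod_ge_0.
    - apply Rmult_le_pos; [apply Cmod_ge_0|]. left. now apply Rinv_0_lt_compat.
    - intros m.
      assert (HGz : Cmod (G m z) <= / be ^ S m * A).
      { assert (E := cauchy_formula (G m) x1 x2 e (/ e) z Hx ltac:(lra)
          ltac:(intros w Hw; now apply HG, Hin)).
        apply (f_equal Cmod) in E. rewrite Cmod_mult, Cmod_2PIi in E.
        assert (B : Cmod (rectI (fun w => G m w / (w - z))%C x1 x2 e (/ e))
          <= (/ be ^ S m * / d) * (2 * ((x2 - x1) + (/ e - e)))).
        { apply rectI_le; try lra.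
          - intros w Hw. apply ccont_mult.
            + now apply cdiff_ccont, HG, (Hbd w).
            + apply (ccont_inv (fun w => w - z)%C); [apply cdiff_ccont, cdiff_shift|].
              apply Cmod_pos_neq. generalize (Hdist w Hw). lra.
          - intros w Hw. assert (Dw := Hdist w Hw).
            rewrite Cmod_div by (apply Cmod_pos_neq; lra).
            destruct (Hbd w Hw) as [Hw0 Hbw]. fold be in Hbw.
            apply Rmult_le_compat; [apply Cmod_ge_0| | |].
            + left. apply Rinv_0_lt_compat. lra.
            + unfold G. rewrite Cmod_div by (apply Cpow_nz, Cmod_pos_neq; lra).
              rewrite !Cmod_pow.
              assert (0 < be ^ S m) by now apply pow_lt.
              assert (be ^ S m <= Cmod (b w) ^ S m) by (apply pow_incr; lra).
              assert (Cmod (F w) ^ S (S m) <= 1).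
              { rewrite <- (pow1 (S (S m))). apply pow_incr. split; [apply Cmod_ge_0|].
                now apply HF1. }
              rewrite <- (Rmult_1_l (/ be ^ S m)).
              apply Rmult_le_compat; try lra.
              * apply pow_le, Cmod_ge_0.
              * left. apply Rinv_0_lt_compat. lra.
              * apply Rinv_le_contravar; lra.
            + apply Rinv_le_contravar; lra. }
        rewrite E in B. unfold A.
        apply Rmult_le_reg_l with (2 * PI); [lra|].
        replace (2 * PI * (/ be ^ S m * (/ d * (2 * (x2 - x1 + (/ e - e))) / (2 * PI))))
          with (/ be ^ S m * / d * (2 * (x2 - x1 + (/ e - e)))); [easy|].
        field. assert (0 < be ^ S m) by now apply pow_lt. lra. }
      assert (Hbzp : 0 < Cmod (b z)).
      { assert (0 < Cmod (z - a)) by now apply Cmod_gt_0, Csub_neq.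
        assert (H1 := Cmod_conj_pos z a Hz Ha).
        generalize (Cmod_ge_0 (b z)). nra. }
      unfold G in HGz. rewrite Cmod_div in HGz by (now apply Cpow_nz, Cmod_pos_neq).
      rewrite !Cmod_pow in HGz.
      assert (Hbm : 0 < Cmod (b z) ^ S m) by now apply pow_lt.
      rewrite Rpow_mult_distr, pow_inv.
      set (u := Cmod (F z) ^ S (S m)) in *. set (v := Cmod (b z) ^ S m) in *.
      set (t := be ^ S m) in *. clearbody u v t.
      apply (Rle_div_l u (/ t * A) v Hbm) in HGz. lra. }
  apply le_epsilon. intros eps Heps.
  assert (Hiz := Rinv_0_lt_compat _ Hz). assert (Hia := Rinv_0_lt_compat _ Ha).
  assert (Hke : 0 < K / eps) by now apply Rdiv_lt_0_compat.
  assert (Hab := Rabs_pos (Re z - Re a)).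
  (* Each summand takes care of one of the constraints on [e = / T]. *)
  set (T := 1 + Im z + / Im z + Im a + / Im a + Rabs (Re z - Re a) + 2 * K + K / eps).
  assert (HT : 1 < T) by (unfold T; lra).
  set (e := / T). assert (He : 0 < e) by (apply Rinv_0_lt_compat; lra).
  assert (HTe : / e = T) by apply Rinv_inv.
  assert (Hlt : forall u, 0 < u -> / u < T -> e < u).
  { intros u Hu H. unfold e. rewrite <- (Rinv_inv u). apply Rinv_lt_contravar; [|easy].
    apply Rmult_lt_0_compat; [now apply Rinv_0_lt_compat|lra]. }
  assert (E1 : e < Im z) by (apply Hlt; [easy|unfold T; lra]).
  assert (E2 : e < Im a) by (apply Hlt; [easy|unfold T; lra]).
  assert (HKe : K * e <= / 2).
  { apply Rle_div_l; [lra|]. unfold T. lra. }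
  assert (HKe' : K * e <= eps).
  { apply Rle_div_l; [lra|]. replace K with (eps * (K / eps)) at 1 by (field; lra).
    apply Rmult_le_compat_l; [lra|unfold T; lra]. }
  assert (Hfin : Cmod (F z) * (1 - K * e) <= Cmod (b z))
    by (apply Hmain; rewrite ?HTe; unfold T; lra).
  assert (Cmod (F z) <= 1) by now apply HF1.
  assert (0 <= Cmod (F z)) by apply Cmod_ge_0.
  assert (Cmod (F z) * (K * e) <= 1 * eps) by (apply Rmult_le_compat; nra).
  lra.
Qed.

(** The difference of the squared sides is [(1 - |a| ^ 2) * (1 - |u| ^ 2)]. *)
Lemma Cmod_disc_automorphism (a u : C) : Cmod a <= 1 -> Cmod u <= 1 ->
  Cmod (u - a) <= Cmod (1 - Cconj a * u).
Proof.
  intros Ha Hu. apply Rsqr_incr_0_var; [|apply Cmod_ge_0]. rewrite !Rsqr_pow2, !Cmod2_alt.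
  assert (Ha2 : Cmod a ^ 2 <= 1 ^ 2) by (apply pow_incr; split; [apply Cmod_ge_0|easy]).
  assert (Hu2 : Cmod u ^ 2 <= 1 ^ 2) by (apply pow_incr; split; [apply Cmod_ge_0|easy]).
  rewrite Cmod2_alt in Ha2, Hu2. destruct a as [a1 a2], u as [u1 u2]. simpl in *.
  assert (0 <= (1 - (a1 * a1 + a2 * a2)) * (1 - (u1 * u1 + u2 * u2)))
    by (apply Rmult_le_pos; lra).
  lra.
Qed.

(** A disc automorphism moves the value at [a] to 0, and [schwarz_pick_zero] gives
    [|s f(z) - al| <= rho * (1 + |s f(z)|)]. Since [|al| - rho >= (de - rho) / 2] and
    [1 + rho <= 2], the quotient 4 results. *)
Lemma schwarz_pick_lower (f : C -> C) (a z : C) (de rho : R) : holomorphic f ->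
  (forall w, 0 < Im w -> Cmod (f w) <= 1) -> 0 < Im a -> 0 < Im z ->
  0 <= rho < de -> de <= Cmod (f a) -> Cmod (z - a) <= rho * Cmod (z - Cconj a) ->
  (de - rho) / 4 <= Cmod (f z).
Proof.
  intros Hf Hf1 Ha Hz Hr Hfa Hza.
  assert (Hfa1 := Hf1 a Ha). assert (Hfz1 := Hf1 z Hz).
  (* Shrinking [f] keeps the denominator of the disc automorphism away from 0. *)
  set (s := (de + rho) / (2 * de)).
  assert (Hs : 0 < s < 1).
  { unfold s. split; [apply Rdiv_lt_0_compat; lra|]. apply Rlt_div_l; lra. }
  assert (Hsd : s * de = (de + rho) / 2) by (unfold s; field; lra).
  set (al := (s * f a)%C).
  assert (Hsc : forall w, Cmod (s * f w) = s * Cmod (f w)).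
  { intros w. rewrite Cmod_mult, Cmod_R, Rabs_right; lra. }
  assert (Hal : (de + rho) / 2 <= Cmod al <= s).
  { unfold al. rewrite Hsc. split; nra. }
  assert (Hsu : forall w, 0 < Im w -> Cmod (s * f w) <= s).
  { intros w Hw. rewrite Hsc. generalize (Hf1 w Hw) (Cmod_ge_0 (f w)). nra. }
  assert (Hden : forall w, 0 < Im w -> 0 < Cmod (1 - Cconj al * (s * f w))).
  { intros w Hw. generalize (Cmod_triangle_rev 1 (Cconj al * (s * f w))%C).
    rewrite Cmod_1, Cmod_mult, Cmod_conj. generalize (Hsu w Hw) (Cmod_ge_0 (s * f w)). nra. }
  set (F := fun w => ((s * f w - al) / (1 - Cconj al * (s * f w)))%C).
  assert (HFz : Cmod (F z) * Cmod (z - Cconj a) <= Cmod (z - a)).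
  { apply schwarz_pick_zero; try easy.
    - intros w Hw. assert (cdiff (fun w => s * f w)%C w).
      { apply cdiff_mult; [apply cdiff_const|now apply Hf]. }
      apply cdiff_div.
      + apply cdiff_minus; [easy|apply cdiff_const].
      + apply cdiff_minus; [apply cdiff_const|]. apply cdiff_mult; [apply cdiff_const|easy].
      + now apply Cmod_pos_neq, Hden.
    - intros w Hw. unfold F. rewrite Cmod_div by now apply Cmod_pos_neq, Hden.
      apply Rle_div_l; [now apply Hden|]. rewrite Rmult_1_l.
      apply Cmod_disc_automorphism; [lra|]. generalize (Hsu w Hw); lra.
    - unfold F. replace (s * f a - al)%C with (RtoC 0) by (unfold al; ring).
      unfold Cdiv. ring. }
  assert (Hp := Cmod_conj_pos z a Hz Ha).
  assert (HFr : Cmod (F z) <= rho).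
  { apply Rmult_le_reg_r with (1 := Hp). lra. }
  unfold F in HFr. assert (Hdz := Hden z Hz).
  rewrite Cmod_div in HFr by now apply Cmod_pos_neq.
  apply Rle_div_l in HFr; [|easy].
  assert (T1 : Cmod (1 - Cconj al * (s * f z)) <= 1 + Cmod (s * f z)).
  { eapply Rle_trans; [apply Cmod_triangle|]. rewrite Cmod_1, Cmod_opp, Cmod_mult, Cmod_conj.
    generalize (Cmod_ge_0 (s * f z)). nra. }
  assert (T2 := Cmod_triangle_rev al (s * f z)). rewrite Cmod_sub_sym in T2.
  assert (T3 : Cmod (s * f z) <= Cmod (f z))
    by (rewrite Hsc; generalize (Cmod_ge_0 (f z)); nra).
  generalize (Cmod_ge_0 (s * f z)). nra.
Qed.

(** * Blaschke products *)

Definition Clim (u : nat -> C) : C :=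
  (real (Lim_seq (fun n => Re (u n))), real (Lim_seq (fun n => Im (u n)))).

(** The rate bounds all later terms and so survives the limit. A rate that is locally uniform in a
    parameter is what [weierstrass] asks for. *)
Lemma Clim_rate (u : nat -> C) (e : nat -> R) : is_lim_seq e 0 ->
  (forall n m, (n <= m)%nat -> Cmod (u m - u n) <= e n) ->
  forall n, Cmod (Clim u - u n) <= e n.
Proof.
  intros He Hu.
  assert (He0 : forall eps, 0 < eps -> exists N, e N < eps).
  { intros eps Heps. apply is_lim_seq_spec in He. destruct (He (mkposreal eps Heps)) as [N HN].
    exists N. specialize (HN N (le_n N)). simpl in HN. rewrite Rminus_0_r in HN.
    now apply Rabs_def2 in HN. }
  assert (Hlim : forall g : C -> R, (forall z w, Rabs (g z - g w) <= Cmod (z - w)) ->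
    is_lim_seq (fun n => g (u n)) (real (Lim_seq (fun n => g (u n))))).
  { intros g Hg. apply Lim_seq_correct', ex_lim_seq_cauchy_corr. intros eps.
    destruct (He0 (eps / 2)) as [N HN]; [generalize (cond_pos eps); lra|].
    exists N. intros n m Hn Hm. eapply Rle_lt_trans; [apply Hg|].
    generalize (Cmod_sub_triangle (u n) (u N) (u m)) (Hu N n Hn) (Hu N m Hm).
    rewrite (Cmod_sub_sym (u N) (u m)). lra. }
  assert (H1 := Hlim Re (fun z w => re_le_Cmod (z - w))).
  assert (H2 := Hlim Im (fun z w => im_le_Cmod (z - w))).
  intros n. apply le_epsilon. intros eps Heps.
  apply is_lim_seq_spec in H1, H2.
  assert (Heps2 : 0 < eps / 2) by lra.
  destruct (H1 (mkposreal _ Heps2)) as [N1 HN1], (H2 (mkposreal _ Heps2)) as [N2 HN2].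
  set (m := Nat.max n (Nat.max N1 N2)).
  specialize (HN1 m ltac:(lia)). specialize (HN2 m ltac:(lia)). simpl in HN1, HN2.
  eapply Rle_trans; [apply (Cmod_sub_triangle _ (u m))|].
  assert (Hm := Hu n m ltac:(lia)).
  assert (Cmod (Clim u - u m) <= eps); [|lra].
  rewrite Cmod_sub_sym. eapply Rle_trans; [apply Cmod_le_ReIm|].
  change (Re (u m - Clim u)) with (Re (u m) - real (Lim_seq (fun n => Re (u n)))).
  change (Im (u m - Clim u)) with (Im (u m) - real (Lim_seq (fun n => Im (u n)))).
  lra.
Qed.

(** In contrast to [sum_n] the upper index is excluded, in step with the recursion of
    [blaschke_partial]. *)
Fixpoint psum (w : nat -> R) (n : nat) : R :=
  match n with O => 0 | S m => psum w m + w m end.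

Lemma psum_incr (w : nat -> R) (n m : nat) : (forall i, 0 <= w i) -> (n <= m)%nat ->
  psum w n <= psum w m.
Proof. intros Hw H. induction H as [|m _ IH]; [lra|]. simpl. specialize (Hw m). lra. Qed.

Lemma psum_le (w v : nat -> R) (n : nat) : (forall i, (i < n)%nat -> w i <= v i) ->
  psum w n <= psum v n.
Proof.
  intros H. induction n as [|n IH]; [simpl; lra|]. simpl.
  generalize (H n ltac:(lia)) (IH ltac:(intros; apply H; lia)). lra.
Qed.

Lemma psum_sum_n (w : nat -> R) (n : nat) : sum_n w n = psum w (S n).
Proof.
  induction n as [|n IH].
  - rewrite sum_O. simpl. ring.
  - rewrite sum_Sn, IH. reflexivity.
Qed.

Lemma ex_series_psum (w : nat -> R) (M : R) : (forall i, 0 <= w i) ->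
  (forall n, psum w n <= M) -> ex_series w.
Proof.
  intros Hw HM.
  destruct (ex_finite_lim_seq_incr (sum_n w) M) as [l Hl].
  - intros n. rewrite !psum_sum_n. apply psum_incr; [easy|lia].
  - intros n. rewrite psum_sum_n. apply HM.
  - now exists l.
Qed.

Lemma psum_tail (w : nat -> R) : ex_series w ->
  exists L, is_lim_seq (fun n => L - psum w n) 0 /\
    ((forall i, 0 <= w i) -> forall n, psum w n <= L).
Proof.
  intros [L HL]. exists L.
  assert (Hl : is_lim_seq (psum w) L).
  { apply is_lim_seq_incr_1. apply is_lim_seq_ext with (sum_n w); [|exact HL].
    intros n. apply psum_sum_n. }
  split.
  - replace (Finite 0) with (Rbar_minus L L) by (simpl; f_equal; ring).
    apply is_lim_seq_minus'; [apply is_lim_seq_const|exact Hl].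
  - intros Hw n. apply (is_lim_seq_incr_compare _ _ Hl).
    intros k. simpl. specialize (Hw k). lra.
Qed.

Definition factor_opt (o : option C) (z : C) : C :=
  match o with Some w => blaschke_factor w z | None => 1%C end.

Definition weight (o : option C) : R :=
  match o with Some w => Im w / (1 + Cmod w ^ 2) | None => 0 end.

(** The part of the bound on [|1 - factor|] that depends on [z] alone: [4] is the cost at [Ci], the
    rest the cost of moving from [Ci] to [z]. *)
Definition factor_const (z : C) : R := 4 + 2 * Cmod (z - Ci) * (1 + Cmod (z - Ci) / Im z).

Lemma sqr_plus_one_neq (a : C) : 0 < Im a -> a <> Ci -> (a ^ 2 + 1)%C <> 0%C.
Proof.
  intros Ha n. replace (a ^ 2 + 1)%C with ((a - Ci) * (a - Cconj Ci))%C.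
  - apply Cmult_neq_0; [now apply Csub_neq|]. apply Csub_neq, Cplus_conj_neq; simpl; lra.
  - apply injective_projections; simpl; ring.
Qed.

Lemma blaschke_unit_Cmod (a : C) : 0 < Im a ->
  Cmod (if Ceq_dec a Ci then 1%C else RtoC (Cmod (a ^ 2 + 1)) / (a ^ 2 + 1))%C = 1.
Proof.
  intros Ha. destruct (Ceq_dec a Ci) as [_|n]; [apply Cmod_1|].
  assert (H := sqr_plus_one_neq a Ha n).
  rewrite Cmod_div, Cmod_R by easy. apply Cmod_gt_0 in H.
  rewrite Rabs_right by lra. field. lra.
Qed.

Lemma Cmod_blaschke_factor (a z : C) : 0 < Im a -> 0 < Im z ->
  Cmod (blaschke_factor a z) = Cmod (z - a) / Cmod (z - Cconj a).
Proof.
  intros Ha Hz. unfold blaschke_factor.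
  rewrite Cmod_mult, blaschke_unit_Cmod, Rmult_1_l by easy.
  apply Cmod_div. now apply Csub_neq, Cplus_conj_neq.
Qed.

Lemma Cmod_blaschke_factor_sqr (a z : C) : 0 < Im a -> 0 < Im z ->
  Cmod (blaschke_factor a z) ^ 2 = 1 - 4 * Im z * Im a / Cmod (z - Cconj a) ^ 2.
Proof.
  intros Ha Hz. rewrite Cmod_blaschke_factor by easy.
  assert (H := Cmod_conj_pos z a Hz Ha). assert (E := Cmod_conj_gap z a).
  replace (4 * Im z * Im a) with (Cmod (z - Cconj a) ^ 2 - Cmod (z - a) ^ 2) by lra.
  field. lra.
Qed.

Lemma Cmod_blaschke_factor_le (a z : C) : 0 < Im a -> 0 < Im z ->
  Cmod (blaschke_factor a z) <= 1.
Proof.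
  intros Ha Hz. rewrite Cmod_blaschke_factor by easy.
  assert (H := Cmod_conj_pos z a Hz Ha). assert (E := Cmod_conj_gap z a).
  apply Rle_div_l; [easy|]. rewrite Rmult_1_l.
  apply Rsqr_incr_0_var; [|lra]. rewrite !Rsqr_pow2, E.
  assert (0 < Im z * Im a) by now apply Rmult_lt_0_compat. lra.
Qed.

(** The normalization makes the factor real and nonnegative at [Ci], so its distance from 1 there is
    controlled by its modulus; the difference quotient of the Möbius map carries the bound over to
    [z]. For [a = Ci] there is no normalization, but then the weight is [/ 2] and the trivial bound
    suffices. *)
Lemma blaschke_factor_near_one (a z : C) : 0 < Im a -> 0 < Im z ->
  Cmod (1 - blaschke_factor a z) <= Im a / (1 + Cmod a ^ 2) * factor_const z.
Proof.
  intros Ha Hz.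
  assert (HA : 0 < 1 + Cmod a ^ 2) by (generalize (pow2_ge_0 (Cmod a)); lra).
  assert (Hi : 0 < Im Ci) by (simpl; lra).
  set (P := Cmod (Ci - Cconj a)). assert (HP : 0 < P) by now apply Cmod_conj_pos.
  assert (HP2 : P ^ 2 = 1 + Cmod a ^ 2 + 2 * Im a).
  { unfold P. rewrite !Cmod2_alt. simpl. unfold Re, Im. ring. }
  set (D := Cmod (z - Cconj a)). assert (HD : 0 < D) by now apply Cmod_conj_pos.
  set (t := Cmod (z - Ci)). assert (Ht : 0 <= t) by apply Cmod_ge_0.
  assert (HDz : Im z <= D).
  { apply Rle_trans with (Rabs (Im (z - Cconj a))); [|apply im_le_Cmod].
    change (Im (z - Cconj a)) with (Im z + - - Im a). rewrite Rabs_right; lra. }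
  assert (HPD : P <= D * (1 + t / Im z)).
  { apply Rle_trans with (D + t).
    - unfold P, D, t. rewrite (Cmod_sub_sym z Ci).
      generalize (Cmod_sub_triangle Ci z (Cconj a)). lra.
    - rewrite Rmult_plus_distr_l, Rmult_1_r. apply Rplus_le_compat_l.
      apply Rle_trans with (Im z * (t / Im z)); [right; field; lra|].
      apply Rmult_le_compat_r; [|easy]. apply Rdiv_le_0_compat; lra. }
  assert (Ht1 : 0 <= t / Im z) by (apply Rdiv_le_0_compat; lra).
  set (b := fun w => ((w - a) / (w - Cconj a))%C).
  set (W := Im a / (1 + Cmod a ^ 2)).
  assert (HW : 0 <= W) by (apply Rdiv_le_0_compat; lra).
  assert (Hgap : Cmod (b Ci - b z) <= 2 * W * (t * (1 + t / Im z))).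
  { assert (N1 : (Ci - Cconj a)%C <> 0%C) by now apply Csub_neq, Cplus_conj_neq.
    assert (N2 : (z - Cconj a)%C <> 0%C) by now apply Csub_neq, Cplus_conj_neq.
    replace (b Ci - b z)%C with ((a - Cconj a) * (Ci - z) / ((Ci - Cconj a) * (z - Cconj a)))%C
      by (unfold b; field; easy).
    replace (a - Cconj a)%C with (RtoC (2 * Im a) * Ci)%C
      by (apply injective_projections; simpl; unfold Im; ring).
    rewrite Cmod_div by now apply Cmult_neq_0.
    rewrite !Cmod_mult, Cmod_R, Cmod_Ci, Rabs_right, (Cmod_sub_sym Ci z) by lra.
    fold P D t.
    assert (0 < P * D) by now apply Rmult_lt_0_compat.
    apply Rle_div_l; [easy|].
    assert (HWP : Im a <= W * P ^ 2).
    { rewrite HP2. unfold W. replace (Im a)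
      with (Im a / (1 + Cmod a ^ 2) * (1 + Cmod a ^ 2)) at 1
        by (field; lra). apply Rmult_le_compat_l; [easy|lra]. }
    assert (HWPD : Im a <= W * (P * (D * (1 + t / Im z)))).
    { eapply Rle_trans; [exact HWP|]. apply Rmult_le_compat_l; [easy|].
      replace (P ^ 2) with (P * P) by ring. apply Rmult_le_compat_l; lra. }
    apply Rmult_le_compat_l with (r := 2 * t) in HWPD; lra. }
  unfold blaschke_factor, factor_const. fold t. fold (b z).
  destruct (Ceq_dec a Ci) as [E|n].
  - assert (b0 : b Ci = 0%C) by (unfold b; rewrite E; unfold Cdiv; ring).
    rewrite b0 in Hgap. replace (0 - b z)%C with (- b z)%C in Hgap by ring.
    rewrite Cmod_opp in Hgap.
    assert (HW2 : W = / 2).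
    { unfold W. rewrite E, Cmod_Ci. simpl. field. }
    rewrite Cmult_1_l. eapply Rle_trans; [apply Cmod_triangle|].
    rewrite Cmod_1, Cmod_opp, HW2. rewrite HW2 in Hgap.
    assert (0 <= t * (1 + t / Im z)) by (apply Rmult_le_pos; lra). lra.
  - set (u := (RtoC (Cmod (a ^ 2 + 1)) / (a ^ 2 + 1))%C).
    assert (Hu : Cmod u = 1).
    { generalize (blaschke_unit_Cmod a Ha). now destruct (Ceq_dec a Ci). }
    set (q := Cmod (Ci - a)).
    (* Since [a ^ 2 + 1 = (a - Ci) * (a + Ci)], its modulus is [q * P], and the phases of [u] and
       [b Ci] cancel. *)
    assert (Hui : (u * b Ci)%C = RtoC (q / P)).
    { unfold u, b.
      assert (Q : Cmod (a ^ 2 + 1) = q * P).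
      { unfold P, q. rewrite <- (Cmod_conj (Ci - Cconj a)), <- Cmod_mult. f_equal.
        apply injective_projections; simpl; ring. }
      assert (N1 : (Ci - Cconj a)%C <> 0%C) by now apply Csub_neq, Cplus_conj_neq.
      assert (N2 : (Ci - a)%C <> 0%C) by (apply Csub_neq; congruence).
      assert (N3 : (a + Ci)%C <> 0%C).
      { replace (a + Ci)%C with (a - Cconj Ci)%C; [now apply Csub_neq, Cplus_conj_neq|].
        apply injective_projections; simpl; ring. }
      assert (NP : RtoC P <> 0%C) by (intros H; apply RtoC_inj in H; lra).
      assert (E2 : (RtoC P * RtoC P = - (a + Ci) * (Ci - Cconj a))%C).
      { rewrite <- RtoC_mult. replace (P * P) with (P ^ 2) by ring.
        rewrite HP2, Cmod2_alt. apply injective_projections; simpl; unfold Re, Im; ring. }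
      rewrite Q, RtoC_mult, RtoC_div by lra.
      replace (a ^ 2 + 1)%C with (- (Ci - a) * (a + Ci))%C
        by (apply injective_projections; simpl; ring).
      clearbody q P. revert N1 N2 N3 E2.
      generalize (Ci - Cconj a)%C (Ci - a)%C (a + Ci)%C. intros Z X Y NZ NX NY E2.
      transitivity (RtoC q * RtoC P / (- Y * Z))%C.
      - field. repeat split; try easy.
      - rewrite <- E2. field. easy. }
    assert (Hq : 0 <= q) by apply Cmod_ge_0.
    assert (Hqp : P ^ 2 = q ^ 2 + 4 * Im a).
    { unfold P, q. rewrite (Cmod_conj_gap Ci a). simpl. ring. }
    assert (Hqp' : q <= P) by nra.
    assert (H1 : q / P <= 1) by (apply Rle_div_l; lra).
    assert (Hi1 : Cmod (1 - u * b Ci) <= 4 * W).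
    { rewrite Hui, <- RtoC_minus, Cmod_R, Rabs_right by lra.
      apply Rle_trans with (4 * Im a / P ^ 2).
      - apply Rle_div_r; [nra|].
        replace ((1 - q / P) * P ^ 2) with (P * P - q * P) by (field; lra). nra.
      - unfold W, Rdiv. rewrite <- Rmult_assoc. apply Rmult_le_compat_l; [lra|].
        apply Rinv_le_contravar; lra. }
    replace (1 - u * b z)%C with ((1 - u * b Ci) + u * (b Ci - b z))%C by ring.
    eapply Rle_trans; [apply Cmod_triangle|]. rewrite Cmod_mult, Hu. lra.
Qed.

Lemma factor_opt_le (o : option C) (z : C) : (forall w, o = Some w -> 0 < Im w) -> 0 < Im z ->
  Cmod (factor_opt o z) <= 1.
Proof.
  intros Ho Hz. destruct o as [w|]; simpl.
  - apply Cmod_blaschke_factor_le; [now apply Ho|easy].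
  - rewrite Cmod_1. lra.
Qed.

Lemma weight_pos (o : option C) : (forall w, o = Some w -> 0 < Im w) -> 0 <= weight o.
Proof.
  intros Ho. destruct o as [w|]; simpl; [|lra].
  apply Rdiv_le_0_compat; [left; now apply Ho|].
  generalize (pow2_ge_0 (Cmod w)). simpl. lra.
Qed.

Lemma factor_opt_near_one (o : option C) (z : C) :
  (forall w, o = Some w -> 0 < Im w) -> 0 < Im z ->
  Cmod (1 - factor_opt o z) <= weight o * factor_const z.
Proof.
  intros Ho Hz. destruct o as [w|]; simpl.
  - apply blaschke_factor_near_one; [now apply Ho|easy].
  - rewrite Cmod_sub_diag. lra.
Qed.

Lemma factor_opt_cdiff (o : option C) (z : C) :
  (forall w, o = Some w -> 0 < Im w) -> 0 < Im z -> cdiff (factor_opt o) z.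
Proof.
  intros Ho Hz. destruct o as [w|]; [|apply cdiff_const].
  apply cdiff_mult; [apply cdiff_const|].
  apply cdiff_div; [apply cdiff_shift..|]. apply Csub_neq, Cplus_conj_neq; [easy|now apply Ho].
Qed.

Section Blaschke.
Variable a : nat -> option C.
Hypothesis Ha : blaschke_condition a.

Lemma listed_Im_pos (n : nat) (w : C) : a n = Some w -> 0 < Im w.
Proof. destruct Ha as [H _]. apply H. Qed.

Lemma partial_le (n : nat) (z : C) : 0 < Im z -> Cmod (blaschke_partial a n z) <= 1.
Proof.
  intros Hz. induction n as [|n IH]; simpl; [rewrite Cmod_1; lra|].
  fold (factor_opt (a n) z). rewrite Cmod_mult.
  generalize (factor_opt_le (a n) z (listed_Im_pos n) Hz) (Cmod_ge_0 (factor_opt (a n) z))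
    (Cmod_ge_0 (blaschke_partial a n z)). nra.
Qed.

Lemma partial_cdiff (n : nat) (z : C) : 0 < Im z -> cdiff (blaschke_partial a n) z.
Proof.
  intros Hz. induction n as [|n IH]; [apply cdiff_const|].
  apply (cdiff_mult (blaschke_partial a n) (factor_opt (a n))); [easy|].
  apply factor_opt_cdiff; [apply listed_Im_pos|easy].
Qed.

Lemma factor_const_ge0 (z : C) : 0 < Im z -> 0 <= factor_const z.
Proof.
  intros Hz. unfold factor_const. assert (Ht := Cmod_ge_0 (z - Ci)).
  assert (0 <= Cmod (z - Ci) / Im z) by now apply Rdiv_le_0_compat.
  assert (0 <= Cmod (z - Ci) * (1 + Cmod (z - Ci) / Im z)) by (apply Rmult_le_pos; lra). lra.
Qed.

Lemma partial_cauchy (n m : nat) (z : C) : 0 < Im z -> (n <= m)%nat ->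
  Cmod (blaschke_partial a m z - blaschke_partial a n z)
  <= factor_const z * (psum (fun i => weight (a i)) m - psum (fun i => weight (a i)) n).
Proof.
  intros Hz H. induction H as [|m _ IH].
  - replace (blaschke_partial a n z - blaschke_partial a n z)%C with (RtoC 0) by ring.
    rewrite Cmod_0. lra.
  - simpl. fold (factor_opt (a m) z).
    set (P := blaschke_partial a m z) in *. set (Q := blaschke_partial a n z) in *.
    replace (P * factor_opt (a m) z - Q)%C
      with ((P - Q) + - (P * (1 - factor_opt (a m) z)))%C by ring.
    eapply Rle_trans; [apply Cmod_triangle|]. rewrite Cmod_opp, Cmod_mult.
    assert (H1 := factor_opt_near_one (a m) z (listed_Im_pos m) Hz).
    assert (H2 : Cmod P <= 1) by now apply partial_le.
    assert (H3 := Cmod_ge_0 (1 - factor_opt (a m) z)). assert (H4 := Cmod_ge_0 P).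
    nra.
Qed.

Definition blaschke_lim (z : C) : C := Clim (fun n => blaschke_partial a n z).

(** The rate separates into a function of [z] and a sequence independent of [z], so convergence is
    uniform wherever [factor_const] is bounded. *)
Lemma blaschke_lim_rate : exists e : nat -> R, is_lim_seq e 0 /\ (forall n, 0 <= e n) /\
  forall z, 0 < Im z -> forall n, Cmod (blaschke_lim z - blaschke_partial a n z)
    <= factor_const z * e n.
Proof.
  destruct Ha as [_ Hs].
  destruct (psum_tail (fun i => weight (a i)) Hs) as [L [HL HL2]].
  assert (Hw : forall i, 0 <= weight (a i)) by (intros i; apply weight_pos, listed_Im_pos).
  exists (fun n => L - psum (fun i => weight (a i)) n).
  split; [exact HL|]. split.
  { intros n. generalize (HL2 Hw n). lra. }
  intros z Hz. apply Clim_rate with (e :=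
    fun n => factor_const z * (L - psum (fun i => weight (a i)) n)).
  - replace (Finite 0) with (Rbar_mult (factor_const z) 0) by (simpl; f_equal; ring).
    now apply is_lim_seq_scal_l.
  - intros n m Hnm. eapply Rle_trans; [now apply partial_cauchy|].
    apply Rmult_le_compat_l; [now apply factor_const_ge0|].
    generalize (HL2 Hw m). lra.
Qed.

Lemma blaschke_lim_cvg (z : C) (eps : R) : 0 < Im z -> 0 < eps ->
  exists N, forall n, (N <= n)%nat -> Cmod (blaschke_lim z - blaschke_partial a n z) < eps.
Proof.
  intros Hz He. destruct blaschke_lim_rate as [e [H0 [He0 H]]].
  apply is_lim_seq_spec in H0.
  assert (HK := factor_const_ge0 z Hz).
  assert (Hd : 0 < eps / (factor_const z + 1)) by (apply Rdiv_lt_0_compat; lra).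
  destruct (H0 (mkposreal _ Hd)) as [N HN]. exists N. intros n Hn.
  specialize (HN n Hn). simpl in HN. rewrite Rminus_0_r in HN. apply Rabs_def2 in HN.
  eapply Rle_lt_trans; [now apply H|].
  destruct HN as [HN _]. apply Rlt_div_r in HN; [|lra]. specialize (He0 n). lra.
Qed.

Lemma blaschke_lim_product : blaschke_product blaschke_lim.
Proof.
  exists a. split; [exact Ha|]. intros z Hz P [eps HP].
  destruct (blaschke_lim_cvg z eps Hz (cond_pos eps)) as [N HN]. exists N. intros n Hn.
  apply HP. specialize (HN n Hn). rewrite Cmod_sub_sym in HN. split.
  - eapply Rle_lt_trans; [|exact HN].
    apply (re_le_Cmod (blaschke_partial a n z - blaschke_lim z)).
  - eapply Rle_lt_trans; [|exact HN].
    apply (im_le_Cmod (blaschke_partial a n z - blaschke_lim z)).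
Qed.

Lemma blaschke_lim_ge (z : C) (m : R) : 0 < Im z ->
  (forall n, m <= Cmod (blaschke_partial a n z)) ->
  m <= Cmod (blaschke_lim z).
Proof.
  intros Hz H. apply le_epsilon. intros eps He.
  destruct (blaschke_lim_cvg z eps Hz He) as [N HN]. specialize (HN N (le_n N)).
    specialize (H N).
  generalize (Cmod_triangle_rev (blaschke_partial a N z) (blaschke_lim z)).
  rewrite (Cmod_sub_sym _ (blaschke_lim z)). lra.
Qed.

Lemma blaschke_lim_le (z : C) (m : R) (N : nat) : 0 < Im z ->
  (forall n, (N <= n)%nat -> Cmod (blaschke_partial a n z) <= m) -> Cmod (blaschke_lim z) <= m.
Proof.
  intros Hz H. apply le_epsilon. intros eps He.
  destruct (blaschke_lim_cvg z eps Hz He) as [N' HN]. specialize (HN (Nat.max N N') ltac:(lia)).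
  specialize (H (Nat.max N N') ltac:(lia)).
  generalize (Cmod_triangle_rev (blaschke_lim z) (blaschke_partial a (Nat.max N N') z)). lra.
Qed.

Lemma blaschke_lim_le1 (z : C) : 0 < Im z -> Cmod (blaschke_lim z) <= 1.
Proof. intros Hz. apply (blaschke_lim_le z 1 0 Hz). intros n _. now apply partial_le. Qed.

Lemma blaschke_lim_holomorphic : holomorphic blaschke_lim.
Proof.
  intros z0 Hz0. unfold Defs.Cplus in Hz0.
  apply (weierstrass (blaschke_partial a) blaschke_lim z0 (Im z0 / 2)); [lra| |].
  - intros n z Hz. apply partial_cdiff.
    assert (H := Im_near z z0 _ Hz). lra.
  - intros eps He. destruct blaschke_lim_rate as [e [H0 [He0 H]]].
    set (A := Cmod (z0 - Ci) + Im z0).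
    assert (HA : 0 < A) by (unfold A; generalize (Cmod_ge_0 (z0 - Ci)); lra).
    (* A bound for [factor_const] on the disc of radius [Im z0 / 2], where [Im z >= Im z0 / 2] and
       [|z - Ci| <= A]. *)
    set (K := 4 + 2 * A * (1 + A / (Im z0 / 2))).
    assert (HA2 : 0 < A / (Im z0 / 2)) by (apply Rdiv_lt_0_compat; lra).
    assert (HK : 0 < K).
    { unfold K. assert (0 < A * (1 + A / (Im z0 / 2))) by (apply Rmult_lt_0_compat; lra). lra. }
    apply is_lim_seq_spec in H0.
    assert (Hd : 0 < eps / K) by now apply Rdiv_lt_0_compat.
    destruct (H0 (mkposreal _ Hd)) as [N HN]. exists N. intros z Hz.
    specialize (HN N (le_n N)). simpl in HN. rewrite Rminus_0_r in HN. apply Rabs_def2 in HN.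
    destruct HN as [HN _]. apply Rlt_div_r in HN; [|easy].
    assert (Hi := Im_near z z0 _ Hz).
    rewrite Cmod_sub_sym. eapply Rle_trans; [apply H; lra|].
    assert (factor_const z <= K).
    { unfold factor_const, K. set (t := Cmod (z - Ci)). assert (0 <= t) by apply Cmod_ge_0.
      assert (t <= A).
      { unfold t, A. generalize (Cmod_sub_triangle z z0 Ci). lra. }
      assert (t / Im z <= A / (Im z0 / 2)).
      { apply Rmult_le_compat; [easy| |easy|apply Rinv_le_contravar; lra].
        left. apply Rinv_0_lt_compat. lra. }
      assert (0 <= t / Im z) by (apply Rdiv_le_0_compat; lra).
      assert (t * (1 + t / Im z) <= A * (1 + A / (Im z0 / 2))) by (apply Rmult_le_compat; lra).
      lra. }
    specialize (He0 N). nra.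
Qed.

Lemma blaschke_lim_Hinf : Hinf blaschke_lim.
Proof. split; [apply blaschke_lim_holomorphic|]. exists 1. intros z Hz.
  now apply blaschke_lim_le1. Qed.

Lemma partial_listed_zero (N n : nat) (w : C) : a N = Some w -> (N < n)%nat ->
  blaschke_partial a n w = 0%C.
Proof.
  intros HN H. induction H as [|n _ IH]; simpl.
  - rewrite HN. unfold blaschke_factor, Cdiv. ring.
  - rewrite IH. ring.
Qed.

Lemma blaschke_lim_listed_zero (N : nat) (w : C) : a N = Some w -> blaschke_lim w = 0%C.
Proof.
  intros HN. apply Cmod_eq_0. apply Rle_antisym; [|apply Cmod_ge_0].
  apply (blaschke_lim_le w 0 (S N)); [now apply (listed_Im_pos N)|].
  intros n Hn. rewrite (partial_listed_zero N n w HN Hn), Cmod_0. lra.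
Qed.

End Blaschke.

Lemma blaschke_lim_mult (a b c : nat -> option C) (z : C) : blaschke_condition a ->
  blaschke_condition b -> blaschke_condition c -> 0 < Im z ->
  (forall n, blaschke_partial a n z = (blaschke_partial b n z * blaschke_partial c n z)%C) ->
  blaschke_lim a z = (blaschke_lim b z * blaschke_lim c z)%C.
Proof.
  intros Ha Hb Hc Hz E. apply Cmod_sub_0. apply le_epsilon. intros eps He. rewrite Rplus_0_l.
  destruct (blaschke_lim_cvg a Ha z (eps / 3) Hz ltac:(lra)) as [N1 H1].
  destruct (blaschke_lim_cvg b Hb z (eps / 3) Hz ltac:(lra)) as [N2 H2].
  destruct (blaschke_lim_cvg c Hc z (eps / 3) Hz ltac:(lra)) as [N3 H3].
  set (n := Nat.max N1 (Nat.max N2 N3)).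
  specialize (H1 n ltac:(lia)). specialize (H2 n ltac:(lia)). specialize (H3 n ltac:(lia)).
  rewrite E in H1.
  assert (B2 := partial_le b Hb n z Hz). assert (B3 := blaschke_lim_le1 c Hc z Hz).
  set (A := blaschke_lim a z) in *. set (B := blaschke_lim b z) in *.
    set (D := blaschke_lim c z) in *.
  set (P := blaschke_partial b n z) in *. set (Q := blaschke_partial c n z) in *.
  replace (A - B * D)%C with ((A - P * Q) + (- ((B - P) * D) + - (P * (D - Q))))%C by ring.
  eapply Rle_trans; [apply Cmod_triangle|].
  eapply Rle_trans; [apply Rplus_le_compat_l, Cmod_triangle|].
  rewrite !Cmod_opp, !Cmod_mult.
  generalize (Cmod_ge_0 D) (Cmod_ge_0 P) (Cmod_ge_0 (B - P)) (Cmod_ge_0 (D - Q)). nra.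
Qed.

(** * Lower bounds for products *)

Fixpoint pprod (x : nat -> R) (n : nat) : R :=
  match n with O => 1 | S m => pprod x m * x m end.

(** Combines [1 + u / k <= exp (u / k)] with [(1 - u) * (1 + u / k) >= 1]. The room [k] left below 1
    sets the rate of the exponential. *)
Lemma one_minus_ge_exp (u k : R) : 0 < k -> 0 <= u <= 1 - k -> exp (- (u / k)) <= 1 - u.
Proof.
  intros Hk Hu.
  assert (H : 1 + u / k <= exp (u / k)) by apply exp_ineq1_le.
  rewrite exp_Ropp.
  assert (H0 : 0 <= u / k) by (apply Rdiv_le_0_compat; lra).
  apply Rle_trans with (/ (1 + u / k)); [apply Rinv_le_contravar; lra|].
  apply Rmult_le_reg_r with (1 + u / k); [lra|]. rewrite Rinv_l by lra.
  replace ((1 - u) * (1 + u / k)) with (1 + u * ((1 - k) - u) / k) by (field; lra).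
  assert (0 <= u * (1 - k - u) / k).
  { apply Rdiv_le_0_compat; [|easy]. apply Rmult_le_pos; lra. }
  lra.
Qed.

Lemma pprod_ge_exp (u : nat -> R) (k : R) (n : nat) : 0 < k ->
  (forall i, 0 <= u i <= 1 - k) ->
  exp (- (psum u n / k)) <= pprod (fun i => 1 - u i) n.
Proof.
  intros Hk Hu. induction n as [|n IH]; simpl.
  - unfold Rdiv. rewrite Rmult_0_l, Ropp_0, exp_0. lra.
  - replace (- ((psum u n + u n) / k)) with (- (psum u n / k) + - (u n / k)) by (field; lra).
    rewrite exp_plus. apply Rmult_le_compat; try (left; apply exp_pos); [easy|].
    now apply one_minus_ge_exp.
Qed.

Lemma pprod_le_exp (u : nat -> R) (n : nat) : (forall i, 0 <= u i <= 1) ->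
  pprod (fun i => 1 - u i) n <= exp (- psum u n).
Proof.
  intros Hu. induction n as [|n IH]; simpl.
  - rewrite Ropp_0, exp_0. lra.
  - replace (- (psum u n + u n)) with (- psum u n + - u n) by ring. rewrite exp_plus.
    assert (H : 1 + - u n <= exp (- u n)) by apply exp_ineq1_le.
    assert (0 <= pprod (fun i => 1 - u i) n).
    { clear -Hu. induction n as [|n IH]; simpl; [lra|].
      apply Rmult_le_pos; [easy|]. specialize (Hu n). lra. }
    specialize (Hu n). apply Rmult_le_compat; lra.
Qed.

(** The index [i0] is exempted from the union bound. *)
Lemma pprod_ge_but_one (u : nat -> R) (i0 n : nat) : (forall i, 0 <= u i <= 1) ->
  (1 - u i0) * (1 - psum (fun i => if Nat.eqb i i0 then 0 else u i) n)
    <= pprod (fun i => 1 - u i) n.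
Proof.
  intros Hu. set (v := fun i => if Nat.eqb i i0 then 0 else u i).
  assert (Hv : forall i, 0 <= v i <= 1) by (intros i; unfold v; destruct Nat.eqb; [lra|easy]).
  assert (H : 1 - psum v n <= pprod (fun i => 1 - v i) n /\ pprod (fun i => 1 - v i) n <= 1
    /\ 0 <= pprod (fun i => 1 - v i) n).
  { induction n as [|n IH]; simpl; [lra|]. specialize (Hv n). nra. }
  assert (Hp : (if Nat.ltb i0 n then (1 - u i0) else 1) * pprod (fun i => 1 - v i) n
    = pprod (fun i => 1 - u i) n).
  { clear H. induction n as [|n IH]; simpl; [ring|].
    rewrite <- IH. replace (v n) with (if Nat.eqb n i0 then 0 else u n) by easy.
    destruct (Nat.eqb_spec n i0) as [->|Hn].
    - rewrite Nat.ltb_irrefl. replace (i0 <? S i0)%nat with true; [ring|].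
      symmetry. apply Nat.ltb_lt. lia.
    - replace (i0 <? S n)%nat with (i0 <? n)%nat; [ring|].
      destruct (Nat.ltb_spec i0 n), (Nat.ltb_spec i0 (S n)); try easy; lia. }
  rewrite <- Hp. specialize (Hu i0).
  destruct (Nat.ltb i0 n); nra.
Qed.

(** This is 1 minus the squared modulus of the factor ([Cmod_blaschke_factor_sqr]). All bounds on
    Blaschke products below go through sums of defects. *)
Definition defect (z : C) (o : option C) : R :=
  match o with Some w => 4 * Im z * Im w / Cmod (z - Cconj w) ^ 2 | None => 0 end.

Lemma Cmod_partial_sqr (a : nat -> option C) (n : nat) (z : C) :
  (forall n w, a n = Some w -> 0 < Im w) -> 0 < Im z ->
  Cmod (blaschke_partial a n z) ^ 2 = pprod (fun i => 1 - defect z (a i)) n.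
Proof.
  intros Ha Hz. induction n as [|n IH].
  - simpl. rewrite Cmod_1. ring.
  - simpl blaschke_partial. rewrite Cmod_mult, Rpow_mult_distr, IH. simpl pprod. f_equal.
    destruct (a n) as [w|] eqn:E; simpl defect.
    + apply Cmod_blaschke_factor_sqr; [now apply (Ha n)|easy].
    + rewrite Cmod_1. ring.
Qed.

Lemma defect_range (z : C) (o : option C) : (forall w, o = Some w -> 0 < Im w) -> 0 < Im z ->
  0 <= defect z o <= 1.
Proof.
  intros Ho Hz. destruct o as [w|]; unfold defect; [|lra].
  assert (Hw := Ho w eq_refl). split.
  - apply Rdiv_le_0_compat; [|now apply (pow_lt _ 2), Cmod_conj_pos].
    left. repeat apply Rmult_lt_0_compat; lra.
  - generalize (Cmod_blaschke_factor_sqr w z Hw Hz)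
      (pow2_ge_0 (Cmod (blaschke_factor w z))). lra.
Qed.

(** * Additive decomposition on a strip *)

(** The mass beyond [n] of the Poisson kernel of width [d] centered at [X]. *)
Definition atan_tail (X d : R) (n : nat) : R := PI / 2 - atan ((INR n - X) / d).

Lemma atan_tail_lim (X d : R) : 0 < d -> is_lim_seq (atan_tail X d) 0.
Proof.
  intros Hd. apply is_lim_seq_spec. intros eps. assert (HPI := PI_RGT_0).
  set (e := Rmin (eps / 2) (PI / 4)).
  assert (He : 0 < e) by (apply Rmin_pos; [generalize (cond_pos eps)|]; lra).
  assert (He1 : e <= eps / 2) by apply Rmin_l. assert (He2 : e <= PI / 4) by apply Rmin_r.
  destruct (INR_unbounded (X + d * tan (PI / 2 - e))) as [N HN].
  exists N. intros n Hn. unfold atan_tail. rewrite Rminus_0_r.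
  assert (Hn' : INR N <= INR n) by now apply le_INR.
  assert (H : tan (PI / 2 - e) < (INR n - X) / d).
  { revert HN. generalize (tan (PI / 2 - e)). intros T HN. apply Rlt_div_r; lra. }
  apply atan_increasing in H. rewrite atan_tan in H by lra.
  generalize (atan_bound ((INR n - X) / d)). intros B.
  rewrite Rabs_right by lra. lra.
Qed.

Lemma atan_tail_mono (X Y d : R) (n : nat) : 0 < d -> X <= Y ->
  atan_tail X d n <= atan_tail Y d n.
Proof.
  intros Hd H. unfold atan_tail.
  assert (atan ((INR n - Y) / d) <= atan ((INR n - X) / d)); [|lra].
  destruct H as [L|L]; [|rewrite L; lra]. left. apply atan_increasing.
  apply Rmult_lt_compat_r; [now apply Rinv_0_lt_compat|lra].
Qed.

Lemma atan_tail_range (X d : R) (n : nat) : 0 <= atan_tail X d n <= PI.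
Proof. unfold atan_tail. generalize (atan_bound ((INR n - X) / d)). lra. Qed.

(** Subtracting the second fraction, whose pole lies in the lower half-plane when
    [Im zeta < b] and [0 < Im z], makes the Cauchy kernel integrable on
    horizontal lines. *)
Definition ker (b : R) (zeta z : C) : C :=
  (/ (zeta - z) - / (zeta - z - RtoC (2 * b) * Ci))%C.

Lemma ker_den_neq (b c : R) (zeta z : C) : 0 < c < b -> Im zeta = c -> 0 < Im z ->
  (zeta - z - RtoC (2 * b) * Ci)%C <> 0%C.
Proof.
  intros Hc E Hz H. apply (f_equal Im) in H.
  change (Im zeta - Im z - (2 * b * 1 + 0 * 0) = 0) in H. lra.
Qed.

Lemma ker_eq (b c : R) (zeta z : C) : 0 < c < b -> Im zeta = c -> 0 < Im z ->
  zeta <> z ->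
  ker b zeta z = (- (RtoC (2 * b) * Ci) / (zeta - z - RtoC (2 * b) * Ci) / (zeta - z))%C.
Proof.
  intros Hc E Hz n. assert (H := ker_den_neq b c zeta z Hc E Hz).
  unfold ker. field. split; [easy|now apply Csub_neq].
Qed.

Lemma ker_le (b c d s : R) (zeta z : C) : 0 < c < b -> Im zeta = c -> 0 < Im z -> 0 < s ->
  s <= Cmod (zeta - z) ^ 2 -> s <= Cmod (zeta - z - RtoC (2 * b) * Ci) ^ 2 ->
  Cmod (ker b zeta z) <= 2 * b / s.
Proof.
  intros Hc E Hz Hs H1 H2.
  assert (N : zeta <> z).
  { intros ->. rewrite Cmod_sub_diag in H1.
    simpl in H1. lra. }
  assert (N2 := ker_den_neq b c zeta z Hc E Hz).
  rewrite (ker_eq b c) by easy.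
  rewrite Cmod_div by now apply Csub_neq. rewrite Cmod_div by easy.
  rewrite Cmod_opp, Cmod_mult, Cmod_R, Cmod_Ci, Rabs_right, Rmult_1_r by lra.
  apply Csub_neq, Cmod_gt_0 in N. apply Cmod_gt_0 in N2.
  set (p := Cmod (zeta - z)) in *. set (q := Cmod (zeta - z - RtoC (2 * b) * Ci)) in *.
  unfold Rdiv. rewrite Rmult_assoc. apply Rmult_le_compat_l; [lra|].
  rewrite <- Rinv_mult. apply Rinv_le_contravar; [easy|].
  clearbody p q. apply Rsqr_incr_0_var; [|nra]. unfold Rsqr.
  replace (q * p * (q * p)) with (p ^ 2 * q ^ 2) by ring. apply Rmult_le_compat; lra.
Qed.

Lemma neq_of_dist (x c d : R) : 0 < d -> d <= Rabs (x - c) -> x <> c.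
Proof. intros Hd H ->. rewrite Rminus_diag, Rabs_R0 in H. lra. Qed.

Section Line.
Variables (psi : C -> C) (b c M : R).
Hypothesis Hc : 0 < c < b.
Hypothesis Hpsi : forall t, ccont psi (t, c).
Hypothesis HM : forall t, Cmod (psi (t, c)) <= M.

Lemma lineM : 0 <= M.
Proof. generalize (HM 0) (Cmod_ge_0 (psi (0, c))). lra. Qed.

Definition lineJ (al be : R) (z : C) : C :=
  Cint (fun t => psi (t, c) * ker b (t, c) z)%C al be.

Lemma line_ccont (z : C) (t : R) : 0 < Im z -> Im z <> c ->
  ccont (fun zeta => psi zeta * ker b zeta z)%C (t, c).
Proof.
  intros Hz n. apply ccont_mult; [apply Hpsi|].
  apply (ccont_plus (fun zeta => / (zeta - z))%C
    (fun zeta => - / (zeta - z - RtoC (2 * b) * Ci))%C).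
  - apply cdiff_ccont, cdiff_inv; [apply cdiff_shift|]. apply Csub_neq, neq_Im. simpl.
    intros E. now apply n.
  - apply cdiff_ccont, cdiff_opp, cdiff_inv.
    + apply cdiff_minus; [apply cdiff_shift|apply cdiff_const].
    + now apply (ker_den_neq b c).
Qed.

Lemma line_ex (al be : R) (z : C) : al <= be -> 0 < Im z -> Im z <> c ->
  ex_Cint (fun t => psi (t, c) * ker b (t, c) z)%C al be.
Proof.
  intros H Hz n. apply (ex_Cint_hor (fun zeta => psi zeta * ker b zeta z)%C); [easy|].
  intros t _. now apply line_ccont.
Qed.

Lemma line_ker_le (d t : R) (z : C) : 0 < d <= b -> 0 < Im z -> d <= Rabs (Im z - c) ->
  Cmod (ker b (t, c) z) <= 2 * b / d * (d / ((t - Re z) ^ 2 + d ^ 2)).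
Proof.
  intros Hd Hz Hdc.
  assert (Hs : 0 < (t - Re z) ^ 2 + d ^ 2).
  { generalize (pow2_ge_0 (t - Re z)) (pow_lt d 2 (proj1 Hd)). lra. }
  replace (2 * b / d * (d / ((t - Re z) ^ 2 + d ^ 2))) with (2 * b / ((t - Re z) ^ 2 + d ^ 2))
    by (field; lra).
  apply (ker_le b c d); try easy; rewrite Cmod2_alt.
  - change (Re ((t, c) - z)) with (t - Re z). change (Im ((t, c) - z)) with (c - Im z).
    apply Rplus_le_compat_l. rewrite <- (pow2_abs (c - Im z)). apply pow_incr.
    rewrite Rabs_minus_sym. lra.
  - replace (Re ((t, c) - z - RtoC (2 * b) * Ci)) with (t - Re z) by (simpl; unfold Re; ring).
    replace (Im ((t, c) - z - RtoC (2 * b) * Ci)) with (- (2 * b + Im z - c))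
      by (simpl; unfold Im; ring).
    (* The second pole lies [2 * b + Im z - c > b] away in height; hence the requirement
       [d <= b]. *)
    apply Rplus_le_compat_l. replace ((- (2 * b + Im z - c)) ^ 2) with ((2 * b + Im z - c) ^ 2)
      by ring. apply pow_incr. lra.
Qed.

Lemma line_bound (al be d : R) (z : C) : al <= be -> 0 < d <= b -> 0 < Im z ->
  d <= Rabs (Im z - c) ->
  Cmod (lineJ al be z) <=
  M * (2 * b / d) * (atan ((be - Re z) / d) - atan ((al - Re z) / d)).
Proof.
  intros Hab Hd Hz Hdc. assert (HM0 := lineM).
  assert (n : Im z <> c) by now apply (neq_of_dist _ _ d).
  unfold lineJ. apply (Cint_le _
    (fun t => M * (2 * b / d) * (d / ((t - Re z) ^ 2 + d ^ 2)))); [easy|now apply line_ex| |].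
  - apply (is_RInt_scal (V := R_NormedModule)
      (fun t => d / ((t - Re z) ^ 2 + d ^ 2)) al be (M * (2 * b / d))).
    now apply is_RInt_poisson.
  - intros t _. rewrite Cmod_mult, Rmult_assoc.
    apply Rmult_le_compat; try apply Cmod_ge_0; [apply HM|now apply line_ker_le].
Qed.

Lemma lineJ_cauchy (d : R) (z : C) (n m : nat) : 0 < d <= b -> 0 < Im z ->
  d <= Rabs (Im z - c) -> (n <= m)%nat ->
  Cmod (lineJ (- INR m) (INR m) z - lineJ (- INR n) (INR n) z)
  <= M * (2 * b / d) * (2 * atan_tail (Rabs (Re z)) d n).
Proof.
  intros Hd Hz Hdc Hnm. assert (HM0 := lineM).
  assert (Hnm' : INR n <= INR m) by now apply le_INR.
  assert (Hn0 : 0 <= INR n) by apply pos_INR.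
  assert (nz : Im z <> c) by now apply (neq_of_dist _ _ d).
  unfold lineJ.
  rewrite (Cint_Chasles _ (- INR m) (- INR n) (INR m)) by (apply line_ex; easy || lra).
  rewrite (Cint_Chasles _ (- INR n) (INR n) (INR m)) by (apply line_ex; easy || lra).
  fold (lineJ (- INR m) (- INR n) z) (lineJ (- INR n) (INR n) z) (lineJ (INR n) (INR m) z).
  replace (lineJ (- INR m) (- INR n) z + (lineJ (- INR n) (INR n) z + lineJ (INR n) (INR m) z)
    - lineJ (- INR n) (INR n) z)%C
    with (lineJ (- INR m) (- INR n) z + lineJ (INR n) (INR m) z)%C by ring.
  eapply Rle_trans; [apply Cmod_triangle|].
  assert (B1 := line_bound (- INR m) (- INR n) d z ltac:(lra) Hd Hz Hdc).
  assert (B2 := line_bound (INR n) (INR m) d z ltac:(lra) Hd Hz Hdc).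
  assert (A1 : atan_tail (- Re z) d n <= atan_tail (Rabs (Re z)) d n).
  { apply atan_tail_mono; [easy|]. rewrite <- Rabs_Ropp. apply Rle_abs. }
  assert (A2 : atan_tail (Re z) d n <= atan_tail (Rabs (Re z)) d n).
  { apply atan_tail_mono; [easy|]. apply Rle_abs. }
  unfold atan_tail in A1, A2 |- *.
  assert (A3 : atan ((- INR n - Re z) / d) = - atan ((INR n - - Re z) / d)).
  { rewrite <- atan_opp. f_equal. field. lra. }
  generalize (atan_bound ((- INR m - Re z) / d)) (atan_bound ((INR m - Re z) / d)).
  intros A4 A5.
  assert (HK : 0 <= M * (2 * b / d)).
  { apply Rmult_le_pos; [easy|]. apply Rdiv_le_0_compat; lra. }
  set (K := M * (2 * b / d)) in *.
  eapply Rle_trans; [apply Rplus_le_compat; [exact B1|exact B2]|].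
  rewrite <- Rmult_plus_distr_l. apply Rmult_le_compat_l; [easy|]. lra.
Qed.

Definition lineL (z : C) : C := Clim (fun n => lineJ (- INR n) (INR n) z).

Lemma lineL_rate (d : R) (z : C) (n : nat) : 0 < d <= b -> 0 < Im z -> d <= Rabs (Im z - c) ->
  Cmod (lineL z - lineJ (- INR n) (INR n) z)
    <= M * (2 * b / d) * (2 * atan_tail (Rabs (Re z)) d n).
Proof.
  intros Hd Hz Hdc. revert n. unfold lineL.
  apply Clim_rate with (u := fun n => lineJ (- INR n) (INR n) z)
    (e := fun n => M * (2 * b / d) * (2 * atan_tail (Rabs (Re z)) d n)).
  - replace (Finite 0) with (Rbar_mult (M * (2 * b / d)) (Rbar_mult 2 0))
      by (simpl; f_equal; ring).
    apply is_lim_seq_scal_l, is_lim_seq_scal_l, atan_tail_lim. lra.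
  - intros n m Hnm. now apply lineJ_cauchy.
Qed.

(** The rate at [n = 0] compares the limit with an integral over a point, so it bounds the limit
    itself. *)
Lemma lineL_bound (d : R) (z : C) : 0 < d <= b -> 0 < Im z -> d <= Rabs (Im z - c) ->
  Cmod (lineL z) <= M * (2 * b / d) * PI * 3.
Proof.
  intros Hd Hz Hdc. assert (HM0 := lineM).
  assert (H1 := lineL_rate d z 0 Hd Hz Hdc).
  assert (HK : 0 <= M * (2 * b / d)).
  { apply Rmult_le_pos; [easy|]. apply Rdiv_le_0_compat; lra. }
  set (K := M * (2 * b / d)) in *. simpl INR in H1.
  assert (H2 := line_bound (- 0) 0 d z ltac:(lra) Hd Hz Hdc). fold K in H2.
  rewrite Ropp_0 in H1, H2. rewrite Rminus_diag, Rmult_0_r in H2.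
  assert (H3 := atan_tail_range (Rabs (Re z)) d 0).
  generalize (Cmod_triangle_rev (lineL z) (lineJ 0 0 z)).
  assert (K * (2 * atan_tail (Rabs (Re z)) d 0) <= K * (2 * PI))
    by (apply Rmult_le_compat_l; lra).
  assert (0 <= K * PI) by (apply Rmult_le_pos; [easy|generalize PI_RGT_0; lra]).
  lra.
Qed.

Lemma lineJ_cdiff (al be : R) (z0 : C) : al <= be -> 0 < Im z0 -> Im z0 <> c ->
  cdiff (lineJ al be) z0.
Proof.
  intros Hab Hz Hn.
  set (d := Rabs (Im z0 - c)).
  assert (Hd : 0 < d) by (apply Rabs_pos_lt; lra).
  assert (Hr : forall t, rcont (fun t => psi (t, c)) t) by (intros t; apply rcont_hor, Hpsi).
  assert (Hg : forall c t, rcont (fun t => (t, c) : C) t).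
  { intros c' t. apply (rcont_hor (fun z => z)), ccont_id. }
  assert (D1 : forall t z, Im z <> c -> (t, c) <> z).
  { intros t z H. apply neq_Im. simpl. intros E. now apply H. }
  (* The subtracted fraction is the ordinary Cauchy kernel of the line at height [c - 2 * b], which
     lies below the real axis. *)
  apply (cdiff_ext_loc (fun z =>
    Cint (fun t => psi (t, c) / ((t, c) - z)) al be
    - Cint (fun t => psi (t, c) / ((t, (c - 2 * b)%R) - z)) al be)%C _ z0 (Rmin (Im z0) d)).
  - now apply Rmin_pos.
  - intros z Hzd. generalize (Rmin_l (Im z0) d) (Rmin_r (Im z0) d). intros M1 M2.
    assert (H := im_le_Cmod (z - z0)). change (Im (z - z0)) with (Im z - Im z0) in H.
    assert (Hi : Rabs (Im z - Im z0) < Im z0) by lra. apply Rabs_def2 in Hi.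
    assert (Hic : Im z <> c).
    { intros E. assert (H' : Rabs (Im z - Im z0) < d) by lra.
      rewrite E, Rabs_minus_sym in H'. unfold d in H'. lra. }
    unfold lineJ. rewrite <- Cint_minus.
    + apply Cint_ext; [easy|]. intros t _.
      replace ((t, (c - 2 * b)%R) - z)%C with ((t, c) - z - RtoC (2 * b) * Ci)%C
        by (apply injective_projections; simpl; ring).
      unfold ker, Cdiv. ring.
    + apply (ex_Cint_hor (fun zeta => psi zeta / (zeta - z))%C); [easy|]. intros t _.
      apply ccont_mult; [apply Hpsi|]. apply cdiff_ccont, cdiff_inv; [apply cdiff_shift|].
      now apply Csub_neq, D1.
    + apply ex_Cint_cont; [easy|]. intros t _.
      apply rcont_ccont, (ccont_mult (fun w => psi (Re w, c))).
      * now apply (rcont_ccont (fun t => psi (t, c))).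
      * apply (ccont_inv (fun w => (Re w, (c - 2 * b)%R) - z)%C).
        -- apply (ccont_plus (fun w => (Re w, (c - 2 * b)%R)) (fun _ => (- z)%C)).
           ++ now apply (rcont_ccont (fun t => (t, (c - 2 * b)%R))).
           ++ apply ccont_const.
        -- apply Csub_neq, neq_Im. simpl. intros E. rewrite <- E in Hi. unfold Im in *.
           simpl in *. lra.
  - apply cdiff_minus.
    + apply (cauchy_type_cdiff (fun t => psi (t, c)) (fun t => (t, c)) al be z0 d); try easy.
      intros t _. eapply Rle_trans; [|apply im_le_Cmod].
      change (Im ((t, c) - z0)) with (c - Im z0). rewrite Rabs_minus_sym. unfold d. lra.
    + apply (cauchy_type_cdiff (fun t => psi (t, c)) (fun t => (t, c - 2 * b)) al be z0 b);
        try easy; try lra.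
      intros t _. eapply Rle_trans; [|apply im_le_Cmod].
      change (Im ((t, (c - 2 * b)%R) - z0)) with (c - 2 * b - Im z0).
      rewrite Rabs_left; lra.
Qed.

Lemma lineL_cdiff (z0 : C) : 0 < Im z0 -> Im z0 <> c -> cdiff lineL z0.
Proof.
  intros Hz Hn. assert (HM0 := lineM).
  set (d0 := Rabs (Im z0 - c)).
  assert (Hd0 : 0 < d0) by (apply Rabs_pos_lt; lra).
  set (d := Rmin (d0 / 2) (Im z0 / 2)).
  assert (Hd : 0 < d) by (apply Rmin_pos; lra).
  assert (Hd1 : d <= d0 / 2) by apply Rmin_l. assert (Hd2 : d <= Im z0 / 2) by apply Rmin_r.
  set (d' := Rmin d b).
  assert (Hd' : 0 < d' <= b) by (split; [apply Rmin_pos; lra|apply Rmin_r]).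
  assert (Hd'd : d' <= d) by apply Rmin_l.
  assert (Hloc : forall z, Cmod (z - z0) < d ->
    0 < Im z /\ d' <= Rabs (Im z - c) /\ Im z <> c /\ Rabs (Re z) <= Rabs (Re z0) + d).
  { intros z Hzd. assert (H := im_le_Cmod (z - z0)).
    change (Im (z - z0)) with (Im z - Im z0) in H.
    assert (H' := re_le_Cmod (z - z0)). change (Re (z - z0)) with (Re z - Re z0) in H'.
    assert (Hi : Rabs (Im z - Im z0) < d) by lra.
    assert (d <= Rabs (Im z - c)).
    { generalize (Rabs_triang_inv (Im z0 - c) (Im z0 - Im z)).
      replace (Im z0 - c - (Im z0 - Im z)) with (Im z - c) by ring.
      rewrite (Rabs_minus_sym (Im z0) (Im z)). fold d0. lra. }
    apply Rabs_def2 in Hi. repeat split; try lra.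
    - apply (neq_of_dist _ _ d); lra.
    - generalize (Rabs_triang_inv (Re z) (Re z0)). lra. }
  apply (weierstrass (fun n => lineJ (- INR n) (INR n)) lineL z0 d); [easy| |].
  - intros n z Hzd. destruct (Hloc z Hzd) as (L1 & L2 & L3 & L4).
    apply lineJ_cdiff; try easy. generalize (pos_INR n). lra.
  - intros eps He.
    assert (HK : 0 <= M * (2 * b / d')).
    { apply Rmult_le_pos; [easy|]. apply Rdiv_le_0_compat; lra. }
    set (K := M * (2 * b / d')) in *.
    assert (Hl := atan_tail_lim (Rabs (Re z0) + d) d' (proj1 Hd')).
    apply is_lim_seq_spec in Hl.
    assert (Hq : 0 < eps / (2 * K + 1)) by (apply Rdiv_lt_0_compat; lra).
    destruct (Hl (mkposreal _ Hq)) as [N HN]. exists N. intros z Hzd.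
    destruct (Hloc z Hzd) as (L1 & L2 & L3 & L4).
    specialize (HN N (le_n N)). simpl in HN. rewrite Rminus_0_r in HN. apply Rabs_def2 in HN.
    destruct HN as [HN _]. apply Rlt_div_r in HN; [|lra].
    rewrite Cmod_sub_sym. eapply Rle_trans; [now apply (lineL_rate d')|]. fold K.
    assert (A := atan_tail_mono _ _ d' N (proj1 Hd') L4).
    assert (A0 := atan_tail_range (Rabs (Re z0) + d) d' N). nra.
Qed.

End Line.

(** Cauchy's formula on [[-n, n] x [c1, c2]] for [f], which is [psi] times a factor equal to 1 at
    [z]. That factor turns the Cauchy kernel into [ker], whose quadratic decay makes the vertical
    edges vanish as [n] grows. *)
Lemma line_difference (psi : C -> C) (b c1 c2 M : R) (z : C) :
  0 < c1 -> c1 < Im z < c2 -> c2 < b ->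
  (forall w, c1 <= Im w <= c2 -> cdiff psi w /\ Cmod (psi w) <= M) ->
  (lineL psi b c1 z - lineL psi b c2 z)%C = (RtoC (2 * PI) * Ci * psi z)%C.
Proof.
  intros Hc1 Hz Hc2 Hpsi.
  assert (HM0 : 0 <= M) by (generalize (proj2 (Hpsi z ltac:(lra))) (Cmod_ge_0 (psi z)); lra).
  assert (HC : forall c, c1 <= c <= c2 ->
    (forall t, ccont psi (t, c)) /\ forall t, Cmod (psi (t, c)) <= M).
  { intros c Hc. split; intros t; [apply cdiff_ccont|]; now apply Hpsi. }
  destruct (HC c1 ltac:(lra)) as [C1 M1]. destruct (HC c2 ltac:(lra)) as [C2 M2].
  set (d := Rmin (Im z - c1) (c2 - Im z)).
  assert (Hd : 0 < d) by (apply Rmin_pos; lra).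
  assert (Hd1 : d <= Im z - c1) by apply Rmin_l. assert (Hd2 : d <= c2 - Im z) by apply Rmin_r.
  assert (D1 : d <= Rabs (Im z - c1)) by (rewrite Rabs_right; lra).
  assert (D2 : d <= Rabs (Im z - c2)) by (rewrite Rabs_left; lra).
  set (f := fun w => (psi w * (- (RtoC (2 * b) * Ci) / (w - z - RtoC (2 * b) * Ci)))%C).
  assert (Hf : forall w, c1 <= Im w <= c2 -> cdiff f w).
  { intros w Hw. apply cdiff_mult; [now apply Hpsi|]. apply cdiff_div; [apply cdiff_const| |].
    - apply cdiff_minus; [apply cdiff_shift|apply cdiff_const].
    - now apply (ker_den_neq b (Im w)); try lra. }
  assert (Hfz : f z = psi z).
  { unfold f. assert (RtoC (2 * b) * Ci <> 0)%C.
    { apply Cmod_pos_neq. rewrite Cmod_mult, Cmod_R, Cmod_Ci, Rabs_right; lra. }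
    replace (z - z - RtoC (2 * b) * Ci)%C with (- (RtoC (2 * b) * Ci))%C by ring.
    revert H. generalize (RtoC (2 * b) * Ci)%C. intros k Hk. field. easy. }
  assert (Hk : forall w, c1 <= Im w <= c2 -> w <> z -> (f w / (w - z) = psi w * ker b w z)%C).
  { intros w Hw n. rewrite (ker_eq b (Im w)) by (easy || lra). unfold f, Cdiv. ring. }
  apply Cmod_sub_0. apply le_epsilon. intros eps He. rewrite Rplus_0_l.
  set (K := M * (2 * b / d)).
  assert (HK : 0 <= K).
  { unfold K. apply Rmult_le_pos; [easy|]. apply Rdiv_le_0_compat; lra. }
  assert (Hl := atan_tail_lim (Rabs (Re z)) d Hd). apply is_lim_seq_spec in Hl.
  assert (Hq : 0 < eps / (8 * K + 8)) by (apply Rdiv_lt_0_compat; lra).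
  destruct (Hl (mkposreal _ Hq)) as [N1 HN1].
  (* Each vertical edge contributes at most [Q / 2 / s ^ 2], with [s] the horizontal room between
     [z] and the edges. *)
  set (Q := 2 * (c2 - c1) * (M * (2 * b))).
  assert (HQ : 0 <= Q).
  { unfold Q. repeat apply Rmult_le_pos; lra. }
  destruct (INR_unbounded (Rabs (Re z) + 1 + 2 * Q / eps)) as [N2 HN2].
  set (n := Nat.max N1 N2).
  specialize (HN1 n ltac:(lia)). simpl in HN1. rewrite Rminus_0_r in HN1.
  apply Rabs_def2 in HN1. destruct HN1 as [HN1 _]. apply Rlt_div_r in HN1; [|lra].
  assert (R1 := lineL_rate psi b c1 M ltac:(lra) C1 M1 d z n ltac:(lra) ltac:(lra) D1).
  assert (R2 := lineL_rate psi b c2 M ltac:(lra) C2 M2 d z n ltac:(lra) ltac:(lra) D2).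
  fold K in R1, R2.
  assert (HQe : 0 <= 2 * Q / eps) by (apply Rdiv_le_0_compat; lra).
  assert (Hn2 : INR N2 <= INR n) by (apply le_INR; lia).
  set (s := INR n - Rabs (Re z)).
  assert (Hs : 1 + 2 * Q / eps <= s) by (unfold s; lra).
  assert (Hs' : Rabs (Re z) < INR n) by (unfold s in Hs; lra).
  assert (Hre := Hs'). apply Rabs_def2 in Hre.
  assert (E := cauchy_formula f (- INR n) (INR n) c1 c2 z ltac:(lra) ltac:(lra)
    ltac:(intros w [_ W]; now apply Hf)).
  rewrite Hfz in E.
  assert (E' : (RtoC (2 * PI) * Ci * psi z = lineJ psi b c1 (- INR n) (INR n) z
    - lineJ psi b c2 (- INR n) (INR n) z
    + Ci * (Cint (fun t => f (INR n, t) / ((INR n, t) - z)) c1 c2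
            - Cint (fun t => f ((- INR n)%R, t) / (((- INR n)%R, t) - z)) c1 c2))%C).
  { assert (HJ : forall c, c = c1 \/ c = c2 ->
      Cint (fun t => f (t, c) / ((t, c) - z))%C (- INR n) (INR n)
      = lineJ psi b c (- INR n) (INR n) z).
    { intros c Hc. apply Cint_ext; [lra|]. intros t _.
      apply Hk; [simpl; lra|]. apply neq_Im. simpl. lra. }
    rewrite <- E, <- !HJ by auto. reflexivity. }
  assert (V : forall x, Rabs x = INR n ->
    Cmod (Cint (fun t => f (x, t) / ((x, t) - z))%C c1 c2) <= M * (2 * b / s ^ 2) * (c2 - c1)).
  { intros x Hx.
    assert (Hsx : s <= Rabs (x - Re z)).
    { unfold s. rewrite <- Hx. apply Rabs_triang_inv. }
    assert (Hne : forall t, (x, t) <> z).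
    { intros t. apply neq_Re. simpl. intros Ex. rewrite Ex in Hsx.
      replace (Re z - Re z) with 0 in Hsx by ring. rewrite Rabs_R0 in Hsx. lra. }
    assert (Hs2 : 0 < s ^ 2) by (apply pow_lt; lra).
    assert (Hx2 : s ^ 2 <= (x - Re z) ^ 2).
    { rewrite <- (pow2_abs (x - Re z)). apply pow_incr. lra. }
    apply Cint_le_const; [lra| |].
    - apply (ex_Cint_ver (fun w => f w / (w - z))%C); [lra|]. intros t Ht.
      apply ccont_mult; [apply cdiff_ccont, Hf; simpl; lra|].
      apply cdiff_ccont, cdiff_inv; [apply cdiff_shift|now apply Csub_neq].
    - intros t Ht. rewrite Hk by (easy || simpl; lra). rewrite Cmod_mult.
      apply Rmult_le_compat; try apply Cmod_ge_0; [apply Hpsi; simpl; lra|].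
      apply (ker_le b t d); try lra; try easy.
      + rewrite Cmod2_alt. change (Re ((x, t) - z)) with (x - Re z).
        generalize (pow2_ge_0 (Im ((x, t) - z))). lra.
      + rewrite Cmod2_alt.
        replace (Re ((x, t) - z - RtoC (2 * b) * Ci)) with (x - Re z)
          by (simpl; unfold Re; ring).
        generalize (pow2_ge_0 (Im ((x, t) - z - RtoC (2 * b) * Ci))). lra. }
  assert (V1 := V (INR n) ltac:(apply Rabs_right; lra)).
  assert (V2 := V (- INR n) ltac:(rewrite Rabs_Ropp; apply Rabs_right; lra)).
  rewrite E'.
  set (I1 := Cint (fun t => f (INR n, t) / ((INR n, t) - z))%C c1 c2) in *.
  set (I2 := Cint (fun t => f ((- INR n)%R, t) / (((- INR n)%R, t) - z))%C c1 c2) in *.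
  set (J1 := lineJ psi b c1 (- INR n) (INR n) z) in *.
  set (J2 := lineJ psi b c2 (- INR n) (INR n) z) in *.
  set (L1 := lineL psi b c1 z) in *. set (L2 := lineL psi b c2 z) in *.
  replace (L1 - L2 - (J1 - J2 + Ci * (I1 - I2)))%C
    with ((L1 - J1) + (- (L2 - J2) + - (Ci * (I1 - I2))))%C by ring.
  eapply Rle_trans; [apply Cmod_triangle|].
  eapply Rle_trans; [apply Rplus_le_compat_l, Cmod_triangle|].
  rewrite !Cmod_opp, Cmod_mult, Cmod_Ci.
  assert (V3 := Cmod_triangle I1 (- I2)). rewrite Cmod_opp in V3.
  assert (V4 : M * (2 * b / s ^ 2) * (c2 - c1) <= eps / 4).
  { replace (M * (2 * b / s ^ 2) * (c2 - c1)) with (Q / 2 / s ^ 2)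
      by (unfold Q; field; lra).
    apply Rle_div_l; [apply pow_lt; lra|].
    assert (2 * Q <= s * eps).
    { apply Rle_trans with ((1 + 2 * Q / eps) * eps); [|apply Rmult_le_compat_r; lra].
      replace ((1 + 2 * Q / eps) * eps) with (eps + 2 * Q) by (field; lra). lra. }
    assert (s * eps <= s * s * eps) by nra. simpl. lra. }
  change (Cmod (I1 + - I2)%C) with (Cmod (I1 - I2)) in V3.
  nra.
Qed.

(** [Fp] and [Fm] are normalized Cauchy integrals over lines in the lower and the upper margin of
    the strip, which keep a distance from the domains [a' < Im z] and [Im z < b']. [K] depends on
    the four heights only; hence the later bounds are uniform in [f]. *)
Lemma cousin (a a' b' b : R) : 0 < a -> a < a' -> a' < b' -> b' < b ->
  exists K, 0 < K /\ forall (psi : C -> C) (M : R),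
    (forall z, a < Im z < b -> cdiff psi z /\ Cmod (psi z) <= M) ->
    exists Fp Fm : C -> C,
      (forall z, a' < Im z -> cdiff Fp z /\ Cmod (Fp z) <= K * M) /\
      (forall z, 0 < Im z < b' -> cdiff Fm z /\ Cmod (Fm z) <= K * M) /\
      (forall z, a' < Im z < b' -> (Fp z - Fm z)%C = psi z).
Proof.
  intros Ha Haa Hab Hbb. assert (HPI := PI_RGT_0).
  set (c1 := (a + a') / 2). set (c2 := (b' + b) / 2).
  set (d := Rmin ((a' - a) / 2) ((b - b') / 2)).
  assert (Hd : 0 < d) by (apply Rmin_pos; lra).
  assert (Hd1 : d <= (a' - a) / 2) by apply Rmin_l.
  assert (Hd2 : d <= (b - b') / 2) by apply Rmin_r.
  set (k := (/ (RtoC (2 * PI) * Ci))%C).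
  assert (Hk : (RtoC (2 * PI) * Ci)%C <> 0%C).
  { apply Cmod_pos_neq. rewrite Cmod_2PIi. lra. }
  assert (Hkm : Cmod k = / (2 * PI)) by (unfold k; rewrite Cmod_inv, Cmod_2PIi; easy).
  exists (2 * b / d * 3). split.
  { apply Rmult_lt_0_compat; [apply Rdiv_lt_0_compat|]; lra. }
  intros psi M Hpsi.
  assert (HC : forall c, a < c < b ->
    (forall t, ccont psi (t, c)) /\ forall t, Cmod (psi (t, c)) <= M).
  { intros c Hc. split; intros t; [apply cdiff_ccont|]; now apply Hpsi. }
  destruct (HC c1 ltac:(unfold c1; lra)) as [C1 M1].
  destruct (HC c2 ltac:(unfold c2; lra)) as [C2 M2].
  assert (HM0 := lineM psi c1 M M1).
  assert (Hbd : forall c z, 0 < c < b -> (forall t, ccont psi (t, c)) ->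
    (forall t, Cmod (psi (t, c)) <= M) -> 0 < Im z -> d <= Rabs (Im z - c) ->
    cdiff (fun z => k * lineL psi b c z)%C z /\ Cmod (k * lineL psi b c z)
      <= 2 * b / d * 3 * M).
  { intros c z Hc Hcc HcM Hz Hdc. split.
    - apply cdiff_mult; [apply cdiff_const|]. apply (lineL_cdiff psi b c M); try easy.
      now apply (neq_of_dist _ _ d).
    - assert (B := lineL_bound psi b c M Hc Hcc HcM d z ltac:(lra) Hz Hdc).
      rewrite Cmod_mult, Hkm.
      apply Rmult_le_compat_l with (r := / (2 * PI)) in B;
        [|left; apply Rinv_0_lt_compat; lra].
      eapply Rle_trans; [exact B|].
      replace (/ (2 * PI) * (M * (2 * b / d) * PI * 3)) with (2 * b / d * 3 * M / 2)
        by (field; lra).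
      assert (0 <= 2 * b / d * 3 * M); [|lra].
      repeat apply Rmult_le_pos; try lra. left. now apply Rinv_0_lt_compat. }
  exists (fun z => k * lineL psi b c1 z)%C, (fun z => k * lineL psi b c2 z)%C.
  split; [|split].
  - intros z Hz. apply Hbd; try easy; try (unfold c1; lra).
    unfold c1. rewrite Rabs_right; lra.
  - intros z Hz. apply Hbd; try easy; try (unfold c2; lra).
    unfold c2. rewrite Rabs_left; lra.
  - intros z Hz.
    assert (E := line_difference psi b c1 c2 M z ltac:(unfold c1; lra)
      ltac:(unfold c1, c2; lra) ltac:(unfold c2; lra)
      ltac:(intros w Hw; apply Hpsi; unfold c1, c2 in Hw; lra)).
    replace (k * lineL psi b c1 z - k * lineL psi b c2 z)%C
      with (k * (lineL psi b c1 z - lineL psi b c2 z))%C by ring.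
    rewrite E. unfold k. rewrite Cmult_assoc, Cinv_l by easy. ring.
Qed.

(** * Solving Bezout equations by gluing *)

(** Only [g] carries the bound [M], because [c_1] measures [g] alone; [h] merely has to be
    bounded. *)
Definition inv_by (M : R) (B f : C -> C) : Prop :=
  exists g h : C -> C, bezout B f g h /\ forall z, 0 < Im z -> Cmod (g z) <= M.

Definition unit_ball (f : C -> C) : Prop :=
  holomorphic f /\ forall z, 0 < Im z -> Cmod (f z) <= 1.

Lemma unit_ball_Hinf (f : C -> C) : unit_ball f -> Hinf f.
Proof. intros [H1 H2]. split; [easy|]. now exists 1. Qed.

Lemma Hinf_mult (f g : C -> C) : Hinf f -> Hinf g -> Hinf (fun z => f z * g z)%C.
Proof.
  intros [Hf [M HM]] [Hg [N HN]]. split.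
  - intros z Hz. apply cdiff_mult; [now apply Hf|now apply Hg].
  - exists (M * N). intros z Hz. rewrite Cmod_mult.
    apply Rmult_le_compat; try apply Cmod_ge_0; [now apply HM|now apply HN].
Qed.

Lemma Hinf_minus (f g : C -> C) : Hinf f -> Hinf g -> Hinf (fun z => f z - g z)%C.
Proof.
  intros [Hf [M HM]] [Hg [N HN]]. split.
  - intros z Hz. apply cdiff_minus; [now apply Hf|now apply Hg].
  - exists (M + N). intros z Hz. eapply Rle_trans; [apply Cmod_triangle|]. rewrite Cmod_opp.
    generalize (HM z Hz) (HN z Hz). lra.
Qed.

Lemma Hinf_plus (f g : C -> C) : Hinf f -> Hinf g -> Hinf (fun z => f z + g z)%C.
Proof.
  intros [Hf [M HM]] [Hg [N HN]]. split.
  - intros z Hz. apply cdiff_plus; [now apply Hf|now apply Hg].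
  - exists (M + N). intros z Hz. eapply Rle_trans; [apply Cmod_triangle|].
    generalize (HM z Hz) (HN z Hz). lra.
Qed.

(** [(1 - g1 f) (1 - g2 f)] is divisible by [B1 B2]. *)
Lemma inv_by_mult (M1 M2 : R) (B B1 B2 f : C -> C) : unit_ball f ->
  (forall z, 0 < Im z -> B z = (B1 z * B2 z)%C) ->
  inv_by M1 B1 f -> inv_by M2 B2 f -> inv_by (M1 + M2 + M1 * M2) B f.
Proof.
  intros Hf HB (g1 & h1 & (G1 & H1 & E1) & N1) (g2 & h2 & (G2 & H2 & E2) & N2).
  exists (fun z => (g1 z + g2 z) - (g1 z * g2 z) * f z)%C, (fun z => h1 z * h2 z)%C.
  repeat split.
  - apply Hinf_minus; [now apply Hinf_plus|].
    apply Hinf_mult; [now apply Hinf_mult|now apply unit_ball_Hinf].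
  - apply Hinf_minus; [now apply Hinf_plus|].
    apply Hinf_mult; [now apply Hinf_mult|now apply unit_ball_Hinf].
  - now apply Hinf_mult.
  - now apply Hinf_mult.
  - intros z Hz. rewrite HB by easy. generalize (E1 z Hz) (E2 z Hz). intros e1 e2.
    transitivity ((g1 z + g2 z - g1 z * g2 z * f z) * f z
      + (h1 z * B1 z) * (h2 z * B2 z))%C; [ring|].
    replace (h1 z * B1 z)%C with (1 - g1 z * f z)%C by (rewrite <- e1; ring).
    replace (h2 z * B2 z)%C with (1 - g2 z * f z)%C by (rewrite <- e2; ring).
    ring.
  - intros z Hz. eapply Rle_trans; [apply Cmod_triangle|].
    rewrite Cmod_opp, !Cmod_mult.
    generalize (Cmod_triangle (g1 z) (g2 z)) (N1 z Hz) (N2 z Hz) (proj2 Hf z Hz)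
      (Cmod_ge_0 (g1 z)) (Cmod_ge_0 (g2 z)) (Cmod_ge_0 (f z)). intros T A1 A2 A3 P1 P2 P3.
    assert (Cmod (g1 z) * Cmod (g2 z) <= M1 * M2) by (apply Rmult_le_compat; lra).
    assert (0 <= Cmod (g1 z) * Cmod (g2 z)) by now apply Rmult_le_pos.
    assert (Cmod (g1 z) * Cmod (g2 z) * Cmod (f z) <= Cmod (g1 z) * Cmod (g2 z) * 1)
      by (apply Rmult_le_compat_l; lra).
    lra.
Qed.

Definition open_set (D : C -> Prop) : Prop :=
  forall z, D z -> exists r, 0 < r /\ forall w, Cmod (w - z) < r -> D w.

Lemma cdiff_open_ext (D : C -> Prop) (f g : C -> C) (z : C) : open_set D -> D z ->
  (forall w, D w -> f w = g w) -> cdiff f z -> cdiff g z.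
Proof.
  intros O Hz E. destruct (O z Hz) as [r [Hr Hw]]. apply (cdiff_ext_loc f g z r); auto.
Qed.

(** The domains are left abstract so that one gluing serves both a high half-plane and a strip with
    a region on either side. On the overlap the two formulas agree because [F1 - F2 = / (f B)], and
    [|B| <= 1] keeps [eta] out of the explicit bound on [g]. *)
Lemma inv_by_patch (D1 D2 : C -> Prop) (F1 F2 B f : C -> C) (c eta K : R) :
  unit_ball B -> unit_ball f -> open_set D1 -> open_set D2 ->
  (forall z, 0 < Im z -> D1 z \/ D2 z) -> 0 < c -> 0 < eta ->
  (forall z, D1 z -> 0 < Im z) -> (forall z, D2 z -> 0 < Im z) ->
  (forall z, D1 z -> c <= Cmod (f z)) -> (forall z, D2 z -> eta <= Cmod (B z)) ->
  (forall z, D1 z -> cdiff F1 z /\ Cmod (F1 z) <= K) ->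
  (forall z, D2 z -> cdiff F2 z /\ Cmod (F2 z) <= K) ->
  (forall z, D1 z -> D2 z -> (F1 z - F2 z)%C = (/ (f z * B z))%C) ->
  inv_by (/ c + K) B f.
Proof.
  intros [HB HB1] [Hf Hf1] O1 O2 Hcov Hc Heta I1 I2 Hfc HBe HF1 HF2 HF.
  assert (Nf : forall z, D1 z -> f z <> 0%C).
  { intros z Hz. apply Cmod_pos_neq. generalize (Hfc z Hz). lra. }
  assert (NB : forall z, D2 z -> B z <> 0%C).
  { intros z Hz. apply Cmod_pos_neq. generalize (HBe z Hz). lra. }
  set (g := fun z => if excluded_middle_informative (D1 z)
    then (/ f z - B z * F1 z)%C else (- (B z * F2 z))%C).
  set (h := fun z => if excluded_middle_informative (D1 z)
    then (F1 z * f z)%C else (/ B z + F2 z * f z)%C).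
  assert (g1 : forall z, D1 z -> g z = (/ f z - B z * F1 z)%C).
  { intros z Hz. unfold g. now destruct excluded_middle_informative. }
  assert (h1 : forall z, D1 z -> h z = (F1 z * f z)%C).
  { intros z Hz. unfold h. now destruct excluded_middle_informative. }
  assert (g2 : forall z, D2 z -> g z = (- (B z * F2 z))%C).
  { intros z Hz. unfold g. destruct excluded_middle_informative as [d|]; [|easy].
    replace (F1 z) with (/ (f z * B z) + F2 z)%C by (rewrite <- HF by easy; ring).
    field. split; [now apply NB|now apply Nf]. }
  assert (h2 : forall z, D2 z -> h z = (/ B z + F2 z * f z)%C).
  { intros z Hz. unfold h. destruct excluded_middle_informative as [d|]; [|easy].
    replace (F1 z) with (/ (f z * B z) + F2 z)%C by (rewrite <- HF by easy; ring).
    field. split; [now apply NB|now apply Nf]. }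
  assert (Bg : forall z, 0 < Im z -> Cmod (g z) <= / c + K).
  { intros z Hz. destruct (Hcov z Hz) as [d|d].
    - rewrite g1 by easy. eapply Rle_trans; [apply Cmod_triangle|].
      rewrite Cmod_opp, Cmod_mult, Cmod_inv by now apply Nf.
      assert (/ Cmod (f z) <= / c) by (apply Rinv_le_contravar; [easy|now apply Hfc]).
      destruct (HF1 z d) as [_ H3]. generalize (HB1 z Hz) (Cmod_ge_0 (B z)) (Cmod_ge_0 (F1 z)).
      nra.
    - rewrite g2 by easy. rewrite Cmod_opp, Cmod_mult.
      assert (0 < / c) by now apply Rinv_0_lt_compat.
      destruct (HF2 z d) as [_ H3]. generalize (HB1 z Hz) (Cmod_ge_0 (B z)) (Cmod_ge_0 (F2 z)).
      nra. }
  exists g, h. split; [|exact Bg]. split; [|split].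
  - split; [|now exists (/ c + K)]. intros z Hz. destruct (Hcov z Hz) as [d|d].
    + apply (cdiff_open_ext D1 (fun z => / f z - B z * F1 z)%C); auto.
        { symmetry. now apply g1. }
        apply cdiff_minus; [apply cdiff_inv; [now apply Hf|now apply Nf]|].
        apply cdiff_mult; [now apply HB|now apply HF1].
    + apply (cdiff_open_ext D2 (fun z => - (B z * F2 z))%C); auto.
        { symmetry. now apply g2. }
        apply cdiff_opp, cdiff_mult; [now apply HB|now apply HF2].
  - split.
    + intros z Hz. destruct (Hcov z Hz) as [d|d].
      * apply (cdiff_open_ext D1 (fun z => F1 z * f z)%C); auto.
        { symmetry. now apply h1. }
        apply cdiff_mult; [now apply HF1|now apply Hf].
      * apply (cdiff_open_ext D2 (fun z => / B z + F2 z * f z)%C); auto.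
        { symmetry. now apply h2. }
        apply cdiff_plus; [apply cdiff_inv; [now apply HB|now apply NB]|].
           apply cdiff_mult; [now apply HF2|now apply Hf].
    + exists (/ eta + K). intros z Hz.
      assert (0 < / eta) by now apply Rinv_0_lt_compat.
      destruct (Hcov z Hz) as [d|d].
      * rewrite h1 by easy. rewrite Cmod_mult.
        destruct (HF1 z d) as [_ H3]. generalize (Hf1 z Hz) (Cmod_ge_0 (f z)) (Cmod_ge_0 (F1
          z)).
        nra.
      * rewrite h2 by easy. eapply Rle_trans; [apply Cmod_triangle|].
        rewrite Cmod_mult, Cmod_inv by now apply NB.
        assert (/ Cmod (B z) <= / eta) by (apply Rinv_le_contravar; [easy|now apply HBe]).
        destruct (HF2 z d) as [_ H3]. generalize (Hf1 z Hz) (Cmod_ge_0 (f z)) (Cmod_ge_0 (F2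
          z)).
        nra.
  - intros z Hz. destruct (Hcov z Hz) as [d|d].
    + rewrite g1, h1 by easy. field. now apply Nf.
    + rewrite g2, h2 by easy. field. now apply NB.
Qed.

Lemma open_Im_gt (a : R) : open_set (fun z => a < Im z).
Proof.
  intros z Hz. exists (Im z - a). split; [lra|]. intros w Hw.
  assert (H := Im_near w z _ Hw). lra.
Qed.

Lemma open_Im_lt (a : R) : open_set (fun z => Im z < a).
Proof.
  intros z Hz. exists (a - Im z). split; [lra|]. intros w Hw.
  assert (H := Im_near w z _ Hw). lra.
Qed.

Lemma open_and (D E : C -> Prop) : open_set D -> open_set E -> open_set (fun z => D z /\ E z).
Proof.
  intros HD HE z [Dz Ez]. destruct (HD z Dz) as [r [Hr H]], (HE z Ez) as [s [Hs H']].
  destruct (Rmin_witness r s) as (d' & Hd' & L1 & L2); [easy..|].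
  exists d'; split; [easy|]. intros w Hw. split; [apply H|apply H']; lra.
Qed.

Lemma open_or (D E : C -> Prop) : open_set D -> open_set E -> open_set (fun z => D z \/ E z).
Proof.
  intros HD HE z [Dz|Ez].
  - destruct (HD z Dz) as [r [Hr H]]. exists r. auto.
  - destruct (HE z Ez) as [r [Hr H]]. exists r. auto.
Qed.

Lemma inv_product_bounds (B f : C -> C) (c eta : R) (z : C) : unit_ball B -> unit_ball f ->
  0 < Im z -> 0 < c -> 0 < eta -> c <= Cmod (f z) -> eta <= Cmod (B z) ->
  cdiff (fun z => / (f z * B z))%C z /\ Cmod (/ (f z * B z)) <= / (c * eta).
Proof.
  intros [HB _] [Hf _] Hz Hc He H1 H2.
  assert (H : 0 < Cmod (f z * B z)) by (rewrite Cmod_mult; apply Rmult_lt_0_compat; lra).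
  apply Cmod_pos_neq in H. split.
  - apply cdiff_inv; [|easy]. apply cdiff_mult; [now apply Hf|now apply HB].
  - rewrite Cmod_inv, Cmod_mult by easy.
    apply Rinv_le_contravar; [now apply Rmult_lt_0_compat|].
    apply Rmult_le_compat; lra.
Qed.

Lemma inv_by_half_plane (a b c eta : R) : 0 < a < b -> 0 < c -> 0 < eta ->
  exists M, forall B f, unit_ball B -> unit_ball f ->
    (forall z, a < Im z -> c <= Cmod (f z)) ->
    (forall z, 0 < Im z < b -> eta <= Cmod (B z)) -> inv_by M B f.
Proof.
  intros Hab Hc He. set (a' := (2 * a + b) / 3). set (b' := (a + 2 * b) / 3).
  destruct (cousin a a' b' b) as [K [HK H]]; try (unfold a', b'; lra).
  exists (/ c + K * / (c * eta)). intros B f HB Hf Hfc HBe.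
  destruct (H (fun z => / (f z * B z))%C (/ (c * eta))) as (F1 & F2 & H1 & H2 & H3).
  { intros z Hz. apply inv_product_bounds; try easy; try lra; [apply Hfc|apply HBe]; lra. }
  apply (inv_by_patch (fun z => a' < Im z) (fun z => 0 < Im z /\ Im z < b') F1 F2 B f c eta);
    try easy.
  - apply open_Im_gt.
  - apply open_and; [apply open_Im_gt|apply open_Im_lt].
  - intros z Hz. destruct (Rlt_dec a' (Im z)); [now left|right]. unfold a', b' in *. lra.
  - intros z Hz. unfold a' in Hz. lra.
  - intros z Hz. apply Hfc. unfold a' in Hz. lra.
  - intros z Hz. apply HBe. unfold b' in Hz. lra.
  - intros z Hz Hz'. now apply H3.
Qed.

(** Two additive problems are solved, one below and one above the center line [y]. Correcting the
    solution of each by that of the other makes the function on the strip common to both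
    overlaps. *)
Lemma inv_by_strip (y s c eta : R) : 0 < s < y -> 0 < c -> 0 < eta ->
  exists M, forall B f, unit_ball B -> unit_ball f ->
    (forall z, y - s < Im z < y + s -> c <= Cmod (f z)) ->
    (forall z, 0 < Im z -> s / 2 <= Rabs (Im z - y) -> eta <= Cmod (B z)) -> inv_by M B f.
Proof.
  intros Hs Hc He.
  (* Both [f] and [B] are bounded below at distances from [s / 2] to [s] from [y]; the eighths leave
     margins inside that range. *)
  set (a1 := y - 7 * s / 8). set (b1 := y - 5 * s / 8).
  set (a2 := y + 5 * s / 8). set (b2 := y + 7 * s / 8).
  destruct (cousin (y - s) a1 b1 (y - s / 2)) as [K [HK H]]; try (unfold a1, b1; lra).
  destruct (cousin (y + s / 2) a2 b2 (y + s)) as [L [HL H']]; try (unfold a2, b2; lra).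
  exists (/ c + (K + L) * / (c * eta)). intros B f HB Hf Hfc HBe'.
  assert (HBe : forall z, 0 < Im z -> (Im z <= y - s / 2 \/ y + s / 2 <= Im z) ->
    eta <= Cmod (B z)).
  { intros z Hz [Hz'|Hz']; apply HBe'; try easy.
    - rewrite Rabs_left1; lra.
    - rewrite Rabs_right; lra. }
  destruct (H (fun z => / (f z * B z))%C (/ (c * eta))) as (F1 & F2 & H1 & H2 & H3).
  { intros z Hz. apply inv_product_bounds; try easy; try lra; [apply Hfc|apply HBe]; lra. }
  destruct (H' (fun z => / (f z * B z))%C (/ (c * eta))) as (G1 & G2 & H1' & H2' & H3').
  { intros z Hz. apply inv_product_bounds; try easy; try lra; [apply Hfc|apply HBe]; lra. }
  assert (Hsub : forall F G z, cdiff F z /\ Cmod (F z) <= K * / (c * eta) ->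
    cdiff G z /\ Cmod (G z) <= L * / (c * eta) ->
    cdiff (fun z => F z - G z)%C z /\ Cmod (F z - G z) <= (K + L) * / (c * eta)).
  { intros F G z [P1 P2] [Q1 Q2]. split; [now apply cdiff_minus|].
    eapply Rle_trans; [apply Cmod_triangle|]. rewrite Cmod_opp. lra. }
  (* Below the strip [(F1 - G2) - (F2 - G2) = F1 - F2], above it [(F1 - G2) - (F1 - G1) = G1 - G2].
     The jump at height [y] is harmless, since the outer region keeps away from it. *)
  set (Fo := fun z => if Rlt_dec (Im z) y then (F2 z - G2 z)%C else (F1 z - G1 z)%C).
  apply (inv_by_patch (fun z => a1 < Im z /\ Im z < b2)
    (fun z => (0 < Im z /\ Im z < b1) \/ a2 < Im z) (fun z => F1 z - G2 z)%C Fo B f c eta);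
    try easy; unfold a1, b1, a2, b2 in *.
  - apply open_and; [apply open_Im_gt|apply open_Im_lt].
  - apply open_or; [apply open_and; [apply open_Im_gt|apply open_Im_lt]|apply open_Im_gt].
  - intros z Hz. lra.
  - intros z Hz. lra.
  - intros z Hz. lra.
  - intros z Hz. apply Hfc. lra.
  - intros z Hz. apply HBe; lra.
  - intros z Hz. apply Hsub; [apply H1|apply H2']; lra.
  - intros z [Hz|Hz].
    + assert (E : forall w, Im w < y -> (F2 w - G2 w)%C = Fo w).
      { intros w Hw. unfold Fo. now destruct Rlt_dec. }
      destruct (Hsub F2 G2 z) as [P1 P2]; [apply H2; lra|apply H2'; lra|].
      split; [|rewrite <- E by lra; easy].
      apply (cdiff_open_ext (fun z => Im z < y) (fun z => F2 z - G2 z)%C); auto;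
        [apply open_Im_lt|lra].
    + assert (E : forall w, y < Im w -> (F1 w - G1 w)%C = Fo w).
      { intros w Hw. unfold Fo. destruct Rlt_dec; [lra|easy]. }
      destruct (Hsub F1 G1 z) as [P1 P2]; [apply H1; lra|apply H1'; lra|].
      split; [|rewrite <- E by lra; easy].
      apply (cdiff_open_ext (fun z => y < Im z) (fun z => F1 z - G1 z)%C); auto;
        [apply open_Im_gt|lra].
  - intros z Hz [Hz'|Hz']; unfold Fo; destruct Rlt_dec; try lra.
    + rewrite <- H3 by lra. ring.
    + rewrite <- H3' by lra. ring.
Qed.

(** * Suprema and the finiteness of [c_1] *)

Lemma Hinf_norm_le (g : C -> C) (M : R) : (forall z, 0 < Im z -> Cmod (g z) <= M) ->
  Rbar_le (Hinf_norm g) M.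
Proof.
  intros H. apply (Lub_Rbar_correct (fun r => exists z, Defs.Cplus z /\ r = Cmod (g z))).
  intros r [z [Hz ->]]. now apply H.
Qed.

Lemma c_1_finite (de M : R) (B : C -> C) :
  (forall f, admissible de B f -> inv_by M B f) -> Rbar_lt (c_1 de B) p_infty.
Proof.
  intros H. apply Rbar_le_lt_trans with (Finite M); [|easy].
  unfold c_1, Rbar_lub. destruct Rbar_ex_lub as [l [Hl1 Hl2]]. simpl. apply Hl2.
  intros s [f [Hf ->]]. destruct (H f Hf) as (g & h & Hb & Hg).
  unfold inverse_norm, Rbar_glb. destruct Rbar_ex_glb as [l' [Hl1' Hl2']]. simpl.
  apply Rbar_le_trans with (Hinf_norm g).
  - apply Hl1'. now exists g, h.
  - now apply Hinf_norm_le.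
Qed.

Lemma admissible_unit_ball (de : R) (B f : C -> C) : admissible de B f -> unit_ball f.
Proof.
  intros [[Hf _] [_ H]]. split; [easy|]. intros z Hz.
  assert (L := proj1 (Lub_Rbar_correct (fun r => exists z, Defs.Cplus z /\ r = Cmod (f z)))).
  assert (Rbar_le (Cmod (f z)) 1); [|easy].
  eapply Rbar_le_trans; [apply L|exact H]. now exists z.
Qed.

(** * Sums over rows of points *)

(** Enumerates the integers as [0, -1, 1, -2, 2, ...]. *)
Definition int_enum (j : nat) : R :=
  if Nat.even j then INR (Nat.div2 j) else - (INR (Nat.div2 j) + 1).

Lemma int_enum_double (n : nat) : int_enum (2 * n) = INR n.
Proof.
  unfold int_enum. rewrite Nat.div2_double. replace (Nat.even (2 * n)) with true; [easy|].
  symmetry. apply Nat.even_spec. now exists n.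
Qed.

Lemma int_enum_succ_double (n : nat) : int_enum (S (2 * n)) = - (INR n + 1).
Proof.
  unfold int_enum. rewrite Nat.div2_succ_double.
    replace (Nat.even (S (2 * n))) with false; [easy|].
  symmetry. rewrite Nat.even_succ. apply Bool.not_true_is_false. intros H.
  apply Nat.odd_spec in H. destruct H as [m Hm]. lia.
Qed.

Lemma Rabs_int_enum_le (j : nat) : Rabs (int_enum j) <= INR j.
Proof.
  destruct (Nat.Even_or_Odd j) as [[n ->]|[n ->]].
  - rewrite int_enum_double, Rabs_right by (apply Rle_ge, pos_INR). apply le_INR. lia.
  - rewrite Nat.add_1_r, int_enum_succ_double, Rabs_Ropp, Rabs_right.
    + rewrite <- S_INR. apply le_INR. lia.
    + generalize (pos_INR n). lra.
Qed.

Lemma int_enum_near (t : R) : exists j, Rabs (t - int_enum j) <= 1.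
Proof.
  destruct (Rle_dec 0 t) as [H|H].
  - destruct (nfloor_ex t H) as [n Hn]. exists (2 * n)%nat. rewrite int_enum_double.
    rewrite Rabs_right; lra.
  - destruct (nfloor_ex (- t) ltac:(lra)) as [n Hn]. exists (S (2 * n)).
    rewrite int_enum_succ_double.
    rewrite Rabs_right; lra.
Qed.

(** For [t] in [[u, u + p]], [(t - x) ^ 2 + h ^ 2 <= 2 * (u - x) ^ 2 + 2 * p ^ 2 + h ^ 2], at most
    three times the value at [u] because [p <= h]. The point is thus charged to the Poisson integral
    over the adjacent interval. *)
Lemma point_le_atan (x p h u : R) : 0 < p <= h ->
  / ((x - u) ^ 2 + h ^ 2) <= 3 / (p * h) * (atan ((u + p - x) / h) - atan ((u - x) / h)).
Proof.
  intros Hp.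
  assert (H2 : 0 < h ^ 2) by (apply pow_lt; lra).
  set (D := (x - u) ^ 2 + h ^ 2).
    assert (HD : 0 < D) by (generalize (pow2_ge_0 (x - u)); unfold D; lra).
  assert (H : p * (h / (3 * D)) <= atan ((u + p - x) / h) - atan ((u - x) / h)).
  { apply (is_RInt_le (fun _ => h / (3 * D)) (fun t => h / ((t - x) ^ 2 + h ^ 2)) u (u + p)).
    - lra.
    - assert (I := is_RInt_const (V := R_NormedModule) u (u + p) (h / (3 * D))).
      change (scal (u + p - u) (h / (3 * D))) with ((u + p - u) * (h / (3 * D))) in I.
      replace (u + p - u) with p in I by ring. exact I.
    - apply is_RInt_poisson. lra.
    - intros t Ht. apply Rmult_le_compat_l; [lra|]. apply Rinv_le_contravar.
      + generalize (pow2_ge_0 (t - x)). lra.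
      + unfold D. assert (0 <= (t - u) ^ 2 <= p ^ 2)
        by (split; [apply pow2_ge_0|apply pow_incr; lra]).
        generalize (pow2_ge_0 ((t - u) - (u - x))) (pow2_ge_0 (x - u)). intros. nra. }
  replace (/ D) with (3 / (p * h) * (p * (h / (3 * D)))) by (field; lra).
  apply Rmult_le_compat_l; [|easy]. left. apply Rdiv_lt_0_compat; nra.
Qed.

(** The intervals charged to the points tile a segment, so the arctangents telescope to at most
    [PI <= 4]. *)
Lemma row_sum (x p h : R) (n : nat) : 0 < p <= h ->
  psum (fun j => / ((x - int_enum j * p) ^ 2 + h ^ 2)) n <= 12 / (p * h).
Proof.
  intros Hp.
  assert (Hpos : forall j, 0 <= / ((x - int_enum j * p) ^ 2 + h ^ 2)).
  { intros j. left. apply Rinv_0_lt_compat.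
    generalize (pow2_ge_0 (x - int_enum j * p)) (pow_lt h 2 ltac:(lra)). lra. }
  (* With an even number of terms the indices fill a symmetric range of integers. *)
  apply Rle_trans with (psum (fun j => / ((x - int_enum j * p) ^ 2 + h ^ 2)) (2 * n)).
  { apply psum_incr; [easy|lia]. }
  assert (H : psum (fun j => / ((x - int_enum j * p) ^ 2 + h ^ 2)) (2 * n) <=
    3 / (p * h) * (atan ((INR n * p - x) / h) - atan ((- INR n * p - x) / h))).
  { induction n as [|n IH].
    - simpl. rewrite Ropp_0, Rminus_diag. lra.
    - replace (2 * S n)%nat with (S (S (2 * n))) by lia.
      change (psum (fun j => / ((x - int_enum j * p) ^ 2 + h ^ 2)) (S (S (2 * n))))
        with (psum (fun j => / ((x - int_enum j * p) ^ 2 + h ^ 2)) (2 * n)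
          + / ((x - int_enum (2 * n) * p) ^ 2 + h ^ 2)
            + / ((x - int_enum (S (2 * n)) * p) ^ 2 + h ^ 2)).
      rewrite int_enum_double, int_enum_succ_double.
      assert (A1 := point_le_atan x p h (INR n * p) Hp).
      assert (A2 := point_le_atan x p h (- (INR n + 1) * p) Hp).
      rewrite S_INR.
      replace (INR n * p + p - x) with ((INR n + 1) * p - x) in A1 by ring.
      replace (- (INR n + 1) * p + p - x) with (- INR n * p - x) in A2 by ring.
      lra. }
  eapply Rle_trans; [exact H|].
  replace (12 / (p * h)) with (3 / (p * h) * 4) by (field; lra).
  apply Rmult_le_compat_l.
  - left. apply Rdiv_lt_0_compat; nra.
  - generalize (atan_bound ((INR n * p - x) / h)) (atan_bound ((- INR n * p - x) / h)) PI_4.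
    lra.
Qed.

(** * Sums over pairs in Cantor's enumeration *)

Definition lsum {T : Type} (f : T -> R) (l : list T) : R :=
  fold_right (fun t s => f t + s) 0 l.

Lemma lsum_app {T : Type} (f : T -> R) (l1 l2 : list T) :
  lsum f (l1 ++ l2) = lsum f l1 + lsum f l2.
Proof. induction l1 as [|t l1 IH]; simpl; [ring|]. rewrite IH. ring. Qed.

Lemma lsum_pos {T : Type} (f : T -> R) (l : list T) : (forall t, 0 <= f t) -> 0 <= lsum f l.
Proof. intros Hf. induction l as [|t l IH]; simpl; [lra|]. specialize (Hf t). lra. Qed.

Lemma lsum_incl {T : Type} (f : T -> R) (l1 l2 : list T) : (forall t, 0 <= f t) ->
  NoDup l1 -> incl l1 l2 -> lsum f l1 <= lsum f l2.
Proof.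
  intros Hf H. revert l2. induction H as [|t l1 Hn Hd IH]; intros l2 Hi.
  - now apply lsum_pos.
  - destruct (in_split t l2) as (a & b & ->); [apply Hi; now left|].
    rewrite lsum_app. simpl.
    assert (lsum f l1 <= lsum f (a ++ b)).
    { apply IH. intros u Hu. specialize (Hi u (or_intror Hu)).
      apply in_app_or in Hi. apply in_or_app. destruct Hi as [Hi|[->|Hi]]; auto. easy. }
    rewrite lsum_app in H. lra.
Qed.

Lemma psum_lsum {T : Type} (f : T -> R) (g : nat -> T) (n : nat) :
  psum (fun i => f (g i)) n = lsum f (map g (seq 0 n)).
Proof.
  induction n as [|n IH]; [easy|]. rewrite seq_S, map_app, lsum_app, <- IH. simpl. ring.
Qed.

Lemma lsum_list_prod (F : nat * nat -> R) (l : list nat) (n : nat) :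
  lsum F (list_prod l (seq 0 n)) = lsum (fun k => psum (fun j => F (k, j)) n) l.
Proof.
  induction l as [|k l IH]; [easy|]. simpl list_prod. rewrite lsum_app, IH. simpl. f_equal.
  now rewrite psum_lsum.
Qed.

Lemma of_nat_inj (m n : nat) : Cantor.of_nat m = Cantor.of_nat n -> m = n.
Proof. intros H. rewrite <- (cancel_to_of m), <- (cancel_to_of n). now rewrite H. Qed.

Lemma NoDup_map_of_nat (n : nat) : NoDup (map Cantor.of_nat (seq 0 n)).
Proof. apply Injective_map_NoDup; [exact of_nat_inj|apply seq_NoDup]. Qed.

(** The first [n] pairs are distinct and lie in the square of side [n], which can be summed row by
    row. *)
Lemma psum_cantor_le (F : nat * nat -> R) (c : nat -> R) (n : nat) : (forall t, 0 <= F t) ->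
  (forall k m, psum (fun j => F (k, j)) m <= c k) ->
  psum (fun i => F (Cantor.of_nat i)) n <= psum c n.
Proof.
  intros HF Hc. rewrite psum_lsum.
  apply Rle_trans with (lsum F (list_prod (seq 0 n) (seq 0 n))).
  - apply lsum_incl; [easy|apply NoDup_map_of_nat|].
    intros [k j] H. apply in_map_iff in H. destruct H as [i [E Hi]].
    apply in_seq in Hi. assert (L := to_nat_non_decreasing k j).
    rewrite <- E, cancel_to_of in L. apply in_prod; apply in_seq; lia.
  - rewrite lsum_list_prod, <- (map_id (seq 0 n)), <- (psum_lsum _ (fun i => i)).
    apply psum_le. intros i _. apply Hc.
Qed.

(** The first [m] entries of row [k] all occur among the first [N] pairs; the other terms are
    nonnegative. *)
Lemma psum_cantor_ge (F : nat * nat -> R) (k m : nat) : (forall t, 0 <= F t) ->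
  exists N, forall n, (N <= n)%nat ->
    psum (fun j => F (k, j)) m <= psum (fun i => F (Cantor.of_nat i)) n.
Proof.
  intros HF.
  assert (H : exists N, forall j, (j < m)%nat -> (Cantor.to_nat (k, j) < N)%nat).
  { induction m as [|m [N IH]]; [exists O; lia|].
    exists (N + S (Cantor.to_nat (k, m)))%nat. intros j Hj.
    destruct (Nat.eq_dec j m) as [->|]; [lia|]. specialize (IH j ltac:(lia)). lia. }
  destruct H as [N HN]. exists N. intros n Hn.
  rewrite (psum_lsum F (fun j => (k, j))), (psum_lsum F).
  apply lsum_incl; [easy| |].
  - apply Injective_map_NoDup; [|apply seq_NoDup]. intros j j' E. now injection E.
  - intros t H. apply in_map_iff in H. destruct H as [j [<- Hj]]. apply in_seq in Hj.
    apply in_map_iff. exists (Cantor.to_nat (k, j)). split; [apply cancel_of_to|].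
    apply in_seq. specialize (HN j ltac:(lia)). lia.
Qed.

Lemma psum_scal (c : R) (w : nat -> R) (n : nat) : psum (fun i => c * w i) n = c * psum w n.
Proof. induction n as [|n IH]; simpl; [ring|]. rewrite IH. ring. Qed.

Lemma psum_geom_from (c t : R) (K n : nat) : 0 <= c -> 0 < t < 1 ->
  psum (fun k => if Nat.leb K k then c * t ^ k else 0) n <= c / (1 - t) * t ^ K.
Proof.
  intros Hc Ht.
  assert (H : psum (fun k => if Nat.leb K k then c * t ^ k else 0) n
    <= c / (1 - t) * (t ^ K - t ^ Nat.max K n)).
  { induction n as [|n IH].
    - rewrite Nat.max_0_r. simpl. lra.
    - simpl psum. destruct (Nat.leb_spec K n).
      + replace (Nat.max K (S n)) with (S n) by lia. replace (Nat.max K n) with n in IH by lia.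
        simpl pow.
        replace (c / (1 - t) * (t ^ K - t * t ^ n))
          with (c / (1 - t) * (t ^ K - t ^ n) + c * t ^ n) by (field; lra). lra.
      + replace (Nat.max K (S n)) with K by lia. replace (Nat.max K n) with K in IH by lia.
        lra. }
  eapply Rle_trans; [exact H|]. apply Rmult_le_compat_l; [apply Rdiv_le_0_compat; lra|].
  generalize (pow_lt t (Nat.max K n)). lra.
Qed.

Lemma psum_single (c : R) (K n : nat) : 0 <= c ->
  psum (fun k => if Nat.eqb k K then c else 0) n <= c.
Proof.
  intros Hc.
  assert (H : psum (fun k => if Nat.eqb k K then c else 0) n = if Nat.ltb K n then c else 0).
  { induction n as [|n IH]; [easy|]. simpl psum. rewrite IH.
    destruct (Nat.ltb_spec K n), (Nat.eqb_spec n K), (Nat.ltb_spec K (S n)); try lia; lra. }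
  rewrite H. destruct Nat.ltb; lra.
Qed.

(** Beyond some index the terms are at most [1 / 2], and the finitely many earlier ones have a
    maximum below 1, so one [k] serves for all in [pprod_ge_exp]. *)
Lemma pprod_lower (u : nat -> R) (M : R) : (forall i, 0 <= u i < 1) ->
  (forall n, psum u n <= M) -> exists c, 0 < c /\ forall n, c <= pprod (fun i => 1 - u i) n.
Proof.
  intros Hu HM.
  assert (Hu0 : forall i, 0 <= u i) by (intros i; apply Hu).
  destruct (psum_tail u (ex_series_psum u M Hu0 HM)) as [L [HL HL2]].
  specialize (HL2 Hu0).
  apply is_lim_seq_spec in HL. assert (Hh : 0 < / 2) by lra.
  destruct (HL (mkposreal _ Hh)) as [N HN]. simpl in HN.
  assert (Htail : forall i, (N <= i)%nat -> u i <= 1 / 2).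
  { intros i Hi. specialize (HN i Hi). rewrite Rminus_0_r in HN. apply Rabs_def2 in HN.
    generalize (HL2 (S i)). simpl. lra. }
  assert (Hk : exists k, 0 < k <= / 2 /\ forall i, (i < N)%nat -> u i <= 1 - k).
  { clear - Hu. induction N as [|N [k [Hk IH]]].
    - exists (/ 2). split; [lra|]. lia.
    - exists (Rmin k (1 - u N)). generalize (Rmin_l k (1 - u N)) (Rmin_r k (1 - u N)).
      intros. split; [split; [apply Rmin_pos; [lra|specialize (Hu N); lra]|lra]|].
      intros i Hi. destruct (Nat.eq_dec i N) as [->|]; [lra|].
      specialize (IH i ltac:(lia)). lra. }
  destruct Hk as [k [Hk Hk2]].
  assert (Hall : forall i, 0 <= u i <= 1 - k).
  { intros i. split; [apply Hu0|]. destruct (Nat.lt_ge_cases i N) as [H|H]; [now apply Hk2|].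
    generalize (Htail i H). lra. }
  exists (exp (- (M / k))). split; [apply exp_pos|]. intros n.
  eapply Rle_trans; [|apply (pprod_ge_exp u k n); [lra|easy]].
  assert (psum u n / k <= M / k).
  { apply Rmult_le_compat_r; [left; apply Rinv_0_lt_compat; lra|apply HM]. }
  destruct (Rle_lt_or_eq_dec (- (M / k)) (- (psum u n / k)) ltac:(lra)) as [H1|H1].
  - left. now apply exp_increasing.
  - rewrite H1. lra.
Qed.

Lemma blaschke_lim_ge_sqr (a : nat -> option C) (z : C) (m : R) : blaschke_condition a ->
  0 < Im z ->
  0 <= m -> (forall n, m ^ 2 <= pprod (fun i => 1 - defect z (a i)) n) ->
    m <= Cmod (blaschke_lim a z).
Proof.
  intros Ha Hz Hm H. apply blaschke_lim_ge; [easy..|]. intros n.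
  apply Rsqr_incr_0_var; [|apply Cmod_ge_0].
    rewrite !Rsqr_pow2, Cmod_partial_sqr; [easy| |easy].
  now apply listed_Im_pos.
Qed.

Lemma blaschke_lim_ge_exp (a : nat ->
  option C) (z : C) (k S : R) : blaschke_condition a -> 0 < Im z ->
  0 < k -> 0 <= S -> (forall i, defect z (a i) <= 1 - k) ->
  (forall n, psum (fun i => defect z (a i)) n <= S) ->
    exp (- (S / k)) <= Cmod (blaschke_lim a z).
Proof.
  intros Ha Hz Hk HS Hu HSn. apply blaschke_lim_ge_sqr; try easy; [left; apply exp_pos|].
  intros n.
  assert (HSk : 0 <= S / k) by (apply Rdiv_le_0_compat; lra).
  assert (Hm : forall s t, s <= t -> exp (- t) <= exp (- s)).
  { intros s t [L|<-]; [|lra]. left. apply exp_increasing. lra. }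
  (* The square root is not exploited: [m ^ 2 <= m] for [m = exp (- (S / k)) <= 1]. *)
  apply Rle_trans with (exp (- (S / k))).
  - assert (E1 : exp (- (S / k)) <= 1) by (rewrite <- exp_0, <- Ropp_0; now apply Hm).
    generalize (exp_pos (- (S / k))). nra.
  - eapply Rle_trans; [|apply (pprod_ge_exp (fun i => defect z (a i)) k n); [easy|]].
    + apply Hm. apply Rmult_le_compat_r; [left; now apply Rinv_0_lt_compat|apply HSn].
    + intros i. split; [|apply Hu]. apply defect_range; [now apply listed_Im_pos|easy].
Qed.

(** A defect equals 1 only at a listed zero, so elsewhere a bounded sum of defects keeps the product
    away from 0. *)
Lemma blaschke_lim_nonzero (a : nat -> option C) (z : C) (S : R) : blaschke_condition a ->
  0 < Im z ->
  (forall n, a n <> Some z) -> (forall n, psum (fun i => defect z (a i)) n <= S) ->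
  blaschke_lim a z <> 0%C.
Proof.
  intros Ha Hz Hn HS.
  destruct (pprod_lower (fun i => defect z (a i)) S) as [c [Hc H]]; [|easy|].
  - intros i. destruct (defect_range z (a i) (listed_Im_pos a Ha i) Hz) as [H0 H1].
    split; [easy|]. destruct H1 as [H1|H1]; [easy|exfalso].
    specialize (Hn i). destruct (a i) as [w|] eqn:E; [|simpl in H1; lra].
    assert (Hw := listed_Im_pos a Ha i w E).
    assert (B := Cmod_blaschke_factor_sqr w z Hw Hz). unfold defect in H1. rewrite H1 in B.
    rewrite Cmod_blaschke_factor in B by easy.
    assert (P1 : 0 < Cmod (z - w)).
    { apply Cmod_gt_0, Csub_neq. congruence. }
    assert (P2 := Cmod_conj_pos z w Hz Hw).
    assert (0 < (Cmod (z - w) / Cmod (z - Cconj w)) ^ 2); [|lra].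
    apply pow_lt. now apply Rdiv_lt_0_compat.
  - apply Cmod_pos_neq. apply Rlt_le_trans with (Rmin c 1); [apply Rmin_pos; lra|].
    apply blaschke_lim_ge_sqr; try easy; [apply Rmin_glb; lra|]. intros n.
      eapply Rle_trans; [|apply H].
    generalize (Rmin_l c 1) (Rmin_r c 1) (Rmin_glb c 1 0 ltac:(lra) ltac:(lra)). nra.
Qed.

(** * The zero set *)

Lemma pow_le_anti (t : R) (m n : nat) : 0 < t < 1 -> (m <= n)%nat -> t ^ n <= t ^ m.
Proof.
  intros Ht H. replace n with (m + (n - m))%nat by lia. rewrite pow_add.
  assert (0 < t ^ m) by (apply pow_lt; lra).
  assert (t ^ (n - m) <= 1) by (rewrite <- (pow1 (n - m)); apply pow_incr; lra).
  nra.
Qed.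

Lemma pow_small (t eps : R) : 0 < t < 1 -> 0 < eps -> exists N, forall n, (N <= n)%nat ->
  t ^ n < eps.
Proof.
  intros Ht He. destruct (pow_lt_1_zero t) with (y := eps) as [N HN]; [|easy|].
  - rewrite Rabs_right; lra.
  - exists N. intros n Hn. specialize (HN n Hn). rewrite Rabs_right in HN; [easy|].
    apply Rle_ge. left. apply pow_lt. lra.
Qed.

Lemma Rdiv_le_cross (a b c d : R) : 0 < b -> 0 < d -> a * d <= c * b -> a / b <= c / d.
Proof.
  intros Hb Hd H. apply Rmult_le_reg_r with (b * d); [now apply Rmult_lt_0_compat|].
  replace (a / b * (b * d)) with (a * d) by (field; lra).
  replace (c / d * (b * d)) with (c * b) by (field; lra). exact H.
Qed.

Section Zeros.
Variable d1 : R.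
Hypothesis Hd1 : 0 < d1 < 1.

(** [/ theta] is the ratio of heights of two vertically aligned points at pseudo-hyperbolic distance
    [d1]. It bounds every [ratio k] from below and is the base of all geometric estimates. *)
Definition theta : R := (1 - d1) / (1 + d1).
(** [hole k] is the pseudo-hyperbolic radius of the gap between the rows [k] and [k + 1];
    it tends to [d1], slowly enough for the Blaschke product vanishing at the centers of
    the gaps [n ^ 2] with [n] large to stay above [d1] on the rows. *)
Definition slack (k : nat) : R := theta ^ Nat.sqrt k * ((1 - d1) / 2).
Definition hole (k : nat) : R := d1 + slack k.
(** The ratio of heights of vertically aligned points at pseudo-hyperbolic distance [hole k]. *)
Definition ratio (k : nat) : R := (1 + hole k) / (1 - hole k).
(** The ratio is squared because [mid k], the center of the gap, is at distance [hole k] from each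
    of the two rows. *)
Fixpoint height (k : nat) : R :=
  match k with O => 1 | S k => ratio k ^ 2 * height k end.
Definition mid (k : nat) : R := ratio k * height k.
(** Growth makes [B] tend to 0 at the gap centers; the rate stays below the rate
    [(/ theta) ^ (2 * k)] of the heights, as the Blaschke condition requires. The factor [2 / d1]
    keeps [spacing k] at most [d1 / 2] times the height. *)
Definition density (k : nat) : R := 2 / d1 * (/ theta) ^ k.
Definition spacing (k : nat) : R := height k / density k.
Definition zero (kj : nat * nat) : C :=
  (int_enum (snd kj) * spacing (fst kj), height (fst kj)).

Lemma theta_range : 0 < theta < 1.
Proof.
  unfold theta. split; [apply Rdiv_lt_0_compat; lra|]. apply Rlt_div_l; lra.
Qed.

Lemma slack_range (k : nat) : 0 < slack k <= (1 - d1) / 2.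
Proof.
  unfold slack. assert (H := theta_range).
  assert (0 < theta ^ Nat.sqrt k) by (apply pow_lt; lra).
  assert (theta ^ Nat.sqrt k <= 1) by (rewrite <- (pow1 (Nat.sqrt k)); apply pow_incr; lra).
  split; [apply Rmult_lt_0_compat; lra|]. nra.
Qed.

Lemma ratio_range (k : nat) : / theta <= ratio k <= (3 + d1) / (1 - d1).
Proof.
  assert (H := slack_range k). unfold ratio, hole, theta.
  replace (/ ((1 - d1) / (1 + d1))) with ((1 + d1) / (1 - d1)) by (field; lra).
  split.
  - apply Rdiv_le_cross; nra.
  - apply Rdiv_le_cross; nra.
Qed.

Lemma inv_theta_gt1 : 1 < / theta.
Proof. assert (H := theta_range). rewrite <- Rinv_1. apply Rinv_lt_contravar; lra. Qed.

Lemma ratio_gt1 (k : nat) : 1 < ratio k.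
Proof. generalize (ratio_range k) inv_theta_gt1. lra. Qed.

Lemma hole_ratio (k : nat) : hole k * (ratio k + 1) = ratio k - 1.
Proof. assert (H := slack_range k). unfold ratio, hole. field. lra. Qed.

Lemma height_growth (k n : nat) :
  height k * (/ theta) ^ (2 * n) <= height (k + n) /\ 0 < height k.
Proof.
  assert (H0 : forall k, 0 < height k).
  { induction k0 as [|k0 IH]; cbn [height]; [lra|].
    apply Rmult_lt_0_compat; [|easy]. apply pow_lt. generalize (ratio_gt1 k0). lra. }
  split; [|easy]. induction n as [|n IH].
  - rewrite Nat.add_0_r. simpl. lra.
  - rewrite Nat.add_succ_r. cbn [height].
    replace (2 * S n)%nat with (2 + 2 * n)%nat by lia. rewrite pow_add.
    replace (height k * ((/ theta) ^ 2 * (/ theta) ^ (2 * n)))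
      with ((/ theta) ^ 2 * (height k * (/ theta) ^ (2 * n))) by ring.
    apply Rmult_le_compat; [apply pow2_ge_0| |apply pow_incr|easy].
    + apply Rmult_le_pos; [left; apply H0|]. apply pow_le. generalize inv_theta_gt1. lra.
    + generalize (ratio_range (k + n)) inv_theta_gt1. lra.
Qed.

Lemma height_pos (k : nat) : 0 < height k.
Proof. apply (height_growth k 0). Qed.

Lemma height_le (k n : nat) : (k <= n)%nat -> height k <= height n.
Proof.
  intros H. replace n with (k + (n - k))%nat by lia.
  destruct (height_growth k (n - k)) as [G P].
  assert (1 <= (/ theta) ^ (2 * (n - k))) by (apply pow_R1_Rle; generalize inv_theta_gt1; lra).
  nra.
Qed.

Lemma height_S (k : nat) : height (S k) = ratio k * mid k.
Proof. unfold mid. simpl. ring. Qed.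

Lemma height_mid (k : nat) : height k < mid k < height (S k).
Proof.
  rewrite height_S. unfold mid. assert (H := ratio_gt1 k). assert (P := height_pos k).
  split; [nra|]. assert (0 < ratio k * height k) by nra. nra.
Qed.

Lemma density_ge (k : nat) : 2 / d1 <= density k.
Proof.
  unfold density. assert (0 < 2 / d1) by (apply Rdiv_lt_0_compat; lra).
  assert (1 <= (/ theta) ^ k) by (apply pow_R1_Rle; generalize inv_theta_gt1; lra). nra.
Qed.

Lemma density_gt1 (k : nat) : 1 < density k.
Proof.
  apply Rlt_le_trans with (2 / d1); [|apply density_ge]. apply Rlt_div_r; lra.
Qed.

Lemma inv_density (k : nat) : / density k = d1 / 2 * theta ^ k.
Proof.
  unfold density. rewrite pow_inv. field. assert (H := theta_range).
  split; [apply pow_nonzero; lra|lra].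
Qed.

Lemma spacing_range (k : nat) : 0 < spacing k <= height k.
Proof.
  unfold spacing. assert (H := density_gt1 k). assert (P := height_pos k).
  split; [apply Rdiv_lt_0_compat; lra|]. apply Rle_div_l; [lra|]. nra.
Qed.

Lemma spacing_eq (k : nat) : spacing k = height k * (d1 / 2 * theta ^ k).
Proof. unfold spacing, Rdiv at 1. now rewrite inv_density. Qed.

(** The number of zeros per unit of length decays geometrically with the row. Both the Blaschke
    condition and the smallness of the defects of high rows rest on this. *)
Lemma density_height (k : nat) : / spacing k <= 2 / d1 * theta ^ k.
Proof.
  unfold spacing. assert (H := density_gt1 k). assert (P := height_pos k).
  assert (T := theta_range).
  destruct (height_growth 0 k) as [G _]. simpl height in G. rewrite Rmult_1_l in G.
  simpl plus in G.
  replace (/ (height k / density k)) with (density k * / height k) by (field; lra).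
  unfold density. rewrite Rmult_assoc. apply Rmult_le_compat_l.
  - left. apply Rdiv_lt_0_compat; lra.
  - assert (Hp : 0 < (/ theta) ^ k) by (apply pow_lt, Rinv_0_lt_compat; lra).
    apply Rle_trans with ((/ theta) ^ k * / (/ theta) ^ (2 * k)).
    + apply Rmult_le_compat_l; [lra|]. apply Rinv_le_contravar; [|exact G].
      apply pow_lt, Rinv_0_lt_compat; lra.
    + replace (2 * k)%nat with (k + k)%nat by lia. rewrite pow_add.
      right. rewrite pow_inv. field. apply pow_nonzero. lra.
Qed.

Lemma zero_Im_pos (t : nat * nat) : 0 < Im (zero t).
Proof. apply height_pos. Qed.

(** Subproducts keep the enumeration of the whole zero set, filling with [None]. *)
Definition select (p : nat -> bool) (n : nat) : option C :=
  if p (fst (Cantor.of_nat n)) then Some (zero (Cantor.of_nat n)) else None.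

Definition rows_from (K : nat) : nat -> option C := select (fun k => Nat.leb K k).
Definition row (K : nat) : nat -> option C := select (fun k => Nat.eqb k K).

Lemma select_pos (p : nat -> bool) (n : nat) (w : C) : select p n = Some w -> 0 < Im w.
Proof.
  unfold select. destruct p; [|easy]. intros E. injection E as <-. apply zero_Im_pos.
Qed.

Lemma psum_select (p : nat -> bool) (G : option C -> R) (c : nat -> R) (n : nat) :
  G None = 0 -> (forall t, 0 <= G (Some (zero t))) ->
  (forall k m, p k = true -> psum (fun j => G (Some (zero (k, j)))) m <= c k) ->
  psum (fun i => G (select p i)) n <= psum (fun k => if p k then c k else 0) n.
Proof.
  intros G0 HG Hc.
  apply (psum_cantor_le
    (fun t => G (if p (fst t) then Some (zero t) else None))).
  - intros t. destruct p; [apply HG|lra].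
  - intros k m. simpl fst. destruct (p k) eqn:E; [now apply Hc|].
    rewrite G0. clear. induction m as [|m IH]; simpl; lra.
Qed.

(** * Blaschke condition and defects of the rows *)

Lemma row_weight (k m : nat) (x : R) (h c : R) : 0 <= c -> height k <= h ->
  psum (fun j => c * / ((x - Re (zero (k, j))) ^ 2 + h ^ 2)) m <= c * (12 / (spacing k * h)).
Proof.
  intros Hc Hh. rewrite psum_scal. apply Rmult_le_compat_l; [easy|].
  assert (S := spacing_range k). apply (row_sum x (spacing k) h m). lra.
Qed.

Lemma select_condition (p : nat -> bool) : blaschke_condition (select p).
Proof.
  assert (T := theta_range).
  split; [apply select_pos|].
  apply (ex_series_psum (fun n => weight (select p n)) (24 / d1 / (1 - theta))).
  { intros i. apply weight_pos, select_pos. }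
  assert (Hd : 0 <= 24 / d1) by (apply Rdiv_le_0_compat; lra).
  intros n. apply Rle_trans with (psum (fun k => if p k then 24 / d1 * theta ^ k else 0) n).
  - apply psum_select; [easy|intros t; apply weight_pos; intros w E; injection E as <-;
      apply zero_Im_pos|].
    intros k m _. assert (P := height_pos k). assert (Sp := spacing_range k).
    eapply Rle_trans; [|eapply Rle_trans; [apply (row_weight k m 0 (height k) (height k));
      lra|]].
    + apply psum_le. intros j _. cbn [weight].
      change (Im (zero (k, j))) with (height k).
      apply Rmult_le_compat_l; [lra|]. rewrite Cmod2_alt.
      change (Im (zero (k, j))) with (height k).
      apply Rinv_le_contravar; [|generalize (Re (zero (k, j))); intros; nra].
      generalize (pow2_ge_0 (0 - Re (zero (k, j)))) (pow_lt (height k) 2 P). lra.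
    + replace (height k * (12 / (spacing k * height k))) with (12 * / spacing k)
      by (field; lra).
      generalize (density_height k). intros D.
      replace (24 / d1 * theta ^ k) with (12 * (2 / d1 * theta ^ k)) by (field; lra). lra.
  - rewrite <- (Rmult_1_r (24 / d1 / (1 - theta))).
    eapply Rle_trans; [|apply (psum_geom_from (24 / d1) theta 0 n); easy].
    apply psum_le. intros i _. simpl. destruct (p i); [lra|].
    apply Rmult_le_pos; [easy|]. apply pow_le; lra.
Qed.

Lemma defect_zero (z : C) (k j : nat) :
  defect z (Some (zero (k, j))) =
  4 * Im z * height k * / ((Re z - Re (zero (k, j))) ^ 2 + (Im z + height k) ^ 2).
Proof.
  unfold defect, Rdiv. change (Im (zero (k, j))) with (height k). f_equal. f_equal.
  rewrite Cmod2_alt. simpl. unfold Re, Im. simpl. ring.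
Qed.

Lemma defect_zero_pos (z : C) (t : nat * nat) : 0 < Im z -> 0 <= defect z (Some (zero t)).
Proof.
  intros Hz. apply defect_range; [|easy]. intros w E. injection E as <-. apply zero_Im_pos.
Qed.

(** The bound is linear in [Im z] and geometric in [K]: below any given height the rows from a large
    [K] on contribute almost nothing. *)
Lemma rows_from_defect (K n : nat) (z : C) : 0 < Im z ->
  psum (fun i => defect z (rows_from K i)) n <= Im z * (96 / d1) / (1 - theta) * theta ^ K.
Proof.
  intros Hz. assert (T := theta_range).
  assert (Hd : 0 < 96 / d1) by (apply Rdiv_lt_0_compat; lra).
  eapply Rle_trans; [|apply (psum_geom_from (Im z * (96 / d1)) theta K n); [nra|easy]].
  apply (psum_select (fun k => Nat.leb K k) (defect z)); [easy|intros;
    now apply defect_zero_pos|].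
  intros k m _. assert (P := height_pos k). assert (Sp := spacing_range k).
  eapply Rle_trans; [|eapply Rle_trans;
    [apply (row_weight k m (Re z) (height k) (4 * Im z * height k)); nra|]].
  - apply psum_le. intros j _. rewrite defect_zero. apply Rmult_le_compat_l; [nra|].
    apply Rinv_le_contravar; [generalize (pow2_ge_0 (Re z - Re (zero (k, j)))); nra|nra].
  - replace (4 * Im z * height k * (12 / (spacing k * height k)))
      with (48 * Im z * / spacing k) by (field; lra).
    replace (Im z * (96 / d1) * theta ^ k) with (48 * Im z * (2 / d1 * theta ^ k))
      by (field; lra).
    apply Rmult_le_compat_l; [lra|apply density_height].
Qed.

(** For one row the bound is uniform in [z], since [Im z] is absorbed by the denominator
    [Im z + height K]. *)
Lemma row_defect (K n : nat) (z : C) : 0 < Im z ->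
  psum (fun i => defect z (row K i)) n <= 48 * density K.
Proof.
  intros Hz. assert (D := density_gt1 K).
  eapply Rle_trans; [|apply (psum_single (48 * density K) K n); lra].
  apply (psum_select (fun k => Nat.eqb k K) (defect z) (fun _ => 48 * density K));
    [easy|intros; now apply defect_zero_pos|].
  intros k m E. apply Nat.eqb_eq in E. subst k.
  assert (P := height_pos K). assert (Sp := spacing_range K).
  eapply Rle_trans; [|eapply Rle_trans;
    [apply (row_weight K m (Re z) (Im z + height K) (4 * Im z * height K)); nra|]].
  - apply psum_le. intros j _. rewrite defect_zero. lra.
  - replace (density K) with (height K * / spacing K) by (unfold spacing; field; lra).
    replace (4 * Im z * height K * (12 / (spacing K * (Im z + height K))))
      with (48 * (height K * / spacing K) * (Im z / (Im z + height K))) by (field; lra).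
    assert (Im z / (Im z + height K) <= 1) by (apply Rle_div_l; lra).
    assert (0 < / spacing K) by (apply Rinv_0_lt_compat; lra).
    assert (0 < height K * / spacing K) by now apply Rmult_lt_0_compat. nra.
Qed.

Lemma rows_from_lower (K : nat) (b : R) : 0 < b ->
  b * (96 / d1) / (1 - theta) * theta ^ K <= / 2 ->
  forall z, 0 < Im z < b -> exp (- (1)) <= Cmod (blaschke_lim (rows_from K) z).
Proof.
  intros Hb HK z Hz. assert (T := theta_range).
  assert (Hs : forall n, psum (fun i => defect z (rows_from K i)) n <= / 2).
  { intros n. eapply Rle_trans; [apply rows_from_defect; lra|]. eapply Rle_trans; [|exact HK].
    apply Rmult_le_compat_r; [apply pow_le; lra|].
    apply Rmult_le_compat_r; [left; apply Rinv_0_lt_compat; lra|].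
    apply Rmult_le_compat_r; [|lra]. left. apply Rdiv_lt_0_compat; lra. }
  (* A total defect of at most [/ 2] also bounds each single defect, so [k] and [S] are both
     [/ 2]. *)
  replace (- (1)) with (- (/ 2 / / 2)) by field.
  apply blaschke_lim_ge_exp; try lra; try easy; [apply select_condition|].
  intros i. generalize (Hs (S i)). simpl.
  assert (0 <= psum (fun i => defect z (rows_from K i)) i); [|lra].
  apply (psum_incr (fun i => defect z (rows_from K i)) 0 i); [|lia].
  intros n. apply defect_range; [apply select_pos|easy].
Qed.

Lemma row_lower (K : nat) : exists eta, 0 < eta /\ forall z, 0 < Im z ->
  d1 * height K / 4 <= Rabs (Im z - height K) -> eta <= Cmod (blaschke_lim (row K) z).
Proof.
  (* [t / (t + 2 * height K)] increases with [t]; at [t = d1 * height K / 4] it equals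
     [d1 / (d1 + 8)]. *)
  set (kap := (d1 / (d1 + 8)) ^ 2).
  assert (Hk0 : 0 < d1 / (d1 + 8)) by (apply Rdiv_lt_0_compat; lra).
  assert (Hk : 0 < kap) by now apply pow_lt.
  assert (Hk1 : kap <= 1).
  { unfold kap. rewrite <- (pow1 2). apply pow_incr. split; [lra|]. apply Rle_div_l; lra. }
  exists (exp (- (48 * density K / kap))). split; [apply exp_pos|].
  intros z Hz Hd. assert (P := height_pos K). assert (D := density_gt1 K).
  apply blaschke_lim_ge_exp; try easy; try lra; [apply select_condition| |].
  2: { intros n. now apply row_defect. }
  intros i. unfold row, select.
  destruct (Cantor.of_nat i) as [k j]. simpl fst.
  destruct (Nat.eqb_spec k K) as [->|_]; [|simpl; lra].
  rewrite defect_zero.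
  set (t := Rabs (Im z - height K)) in *.
  assert (Ht : (Im z - height K) ^ 2 = t ^ 2) by (unfold t; now rewrite pow2_abs).
  assert (Hs : Im z + height K <= t + 2 * height K).
  { generalize (Rle_abs (Im z - height K)). fold t. lra. }
  set (X := (Re z - Re (zero (K, j))) ^ 2). assert (HX : 0 <= X) by apply pow2_ge_0.
  set (Y := (Im z + height K) ^ 2). assert (HY : 0 < Y) by (apply pow_lt; lra).
  assert (HkY : kap * Y <= t ^ 2).
  { unfold kap, Y. rewrite <- Rpow_mult_distr. apply pow_incr.
    split; [apply Rmult_le_pos; lra|].
    apply Rle_trans with (d1 / (d1 + 8) * (t + 2 * height K)); [apply Rmult_le_compat_l; lra|].
    apply Rmult_le_reg_r with (d1 + 8); [lra|].
    replace (d1 / (d1 + 8) * (t + 2 * height K) * (d1 + 8)) with (d1 * (t + 2 * height K))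
      by (field; lra). nra. }
  apply Rle_div_l; [lra|].
  assert (E : 4 * Im z * height K = Y - t ^ 2) by (rewrite <- Ht; unfold Y; ring).
  rewrite E. nra.
Qed.

Lemma rows_from_split (K n : nat) (z : C) :
  blaschke_partial (rows_from K) n z =
  (blaschke_partial (row K) n z * blaschke_partial (rows_from (S K)) n z)%C.
Proof.
  induction n as [|n IH]; simpl; [ring|]. rewrite IH.
  unfold rows_from, row, select. generalize (fst (Cantor.of_nat n)). intros k.
  destruct (Nat.leb_spec K k), (Nat.eqb_spec k K), (Nat.leb_spec (S K) k); try lia; ring.
Qed.

(** * Pseudo-hyperbolic distance to the nearest zero *)

Lemma row_near (k : nat) (z : C) : 0 < Im z ->
  exists j, Cmod (z - zero (k, j)) ^ 2 <= spacing k ^ 2 + (Im z - height k) ^ 2.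
Proof.
  intros Hz. assert (Sp := spacing_range k).
  destruct (int_enum_near (Re z / spacing k)) as [j Hj]. exists j. rewrite Cmod2_alt.
  change (Im (z - zero (k, j))) with (Im z - height k).
  apply Rplus_le_compat_r.
  replace (Re (z - zero (k, j))) with (spacing k * (Re z / spacing k - int_enum j)).
  - rewrite <- pow2_abs. apply pow_incr. split; [apply Rabs_pos|].
    rewrite Rabs_mult, Rabs_right by lra. nra.
  - change (Re (z - zero (k, j))) with (Re z - int_enum j * spacing k). field. lra.
Qed.

Lemma conj_ge (k j : nat) (z : C) : 0 < Im z ->
  (Im z + height k) ^ 2 <= Cmod (z - Cconj (zero (k, j))) ^ 2.
Proof.
  intros Hz. rewrite Cmod2_alt.
  replace (Im (z - Cconj (zero (k, j)))) with (Im z + height k)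
    by (change (Im z + height k = Im z + - - height k); ring).
  generalize (pow2_ge_0 (Re (z - Cconj (zero (k, j))))). lra.
Qed.

Lemma near_from_sqr (k j : nat) (z : C) (rho : R) : 0 < Im z -> 0 <= rho ->
  Cmod (z - zero (k, j)) ^ 2 <= rho ^ 2 * (Im z + height k) ^ 2 ->
  Cmod (z - zero (k, j)) <= rho * Cmod (z - Cconj (zero (k, j))).
Proof.
  intros Hz Hr H. apply Rsqr_incr_0_var; [|apply Rmult_le_pos; [easy|apply Cmod_ge_0]].
  rewrite !Rsqr_pow2, Rpow_mult_distr. eapply Rle_trans; [exact H|].
  apply Rmult_le_compat_l; [apply pow2_ge_0|now apply conj_ge].
Qed.

(** The horizontal and the vertical distance are each at most [d1 * height k / 2], and the
    denominator is at least [height k]. The strip thus lies within radius [d1] of zeros, whatever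
    the size of the neighboring gaps. *)
Lemma strip_near (k : nat) (z : C) : Rabs (Im z - height k) < d1 * height k / 2 ->
  exists j, Cmod (z - zero (k, j)) <= d1 * Cmod (z - Cconj (zero (k, j))).
Proof.
  intros H. assert (P := height_pos k). apply Rabs_def2 in H.
  assert (Hz : 0 < Im z) by nra.
  destruct (row_near k z Hz) as [j Hj]. exists j.
  apply near_from_sqr; [easy|lra|]. eapply Rle_trans; [exact Hj|].
  assert (Hs : spacing k <= d1 * height k / 2).
  { rewrite spacing_eq. assert (T := theta_range).
    assert (theta ^ k <= 1) by (rewrite <- (pow1 k); apply pow_incr; lra).
    assert (0 < height k * (d1 / 2)) by (apply Rmult_lt_0_compat; lra). nra. }
  assert (Sp := spacing_range k).
  assert (A3 : height k ^ 2 <= (Im z + height k) ^ 2) by (apply pow_incr; lra).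
  nra.
Qed.

(** The row on the same side of [mid k] is within pseudo-hyperbolic distance [hole k] vertically,
    and the spacing of the zeros adds at most [theta ^ k]. *)
Lemma gap_near (k : nat) (z : C) (rho : R) : 0 <= rho ->
  hole k + theta ^ k <= rho -> height k <= Im z <= height (S k) ->
  exists t, Cmod (z - zero t) <= rho * Cmod (z - Cconj (zero t)).
Proof.
  intros Hr Hrho Hz. assert (T := theta_range). assert (Hh := slack_range k).
  assert (P := height_pos k). assert (Q := ratio_gt1 k). assert (HR := hole_ratio k).
  assert (Hho : 0 < hole k) by (unfold hole; lra).
  (* Only the vertical distance to a row [l], either [k] or [S k], remains to be bounded. *)
  assert (G : forall l, (k <= l)%nat -> Rabs (Im z - height l) <= hole k * (Im z + height l) ->
    exists t, Cmod (z - zero t) <= rho * Cmod (z - Cconj (zero t))).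
  { intros l Hl H. destruct (row_near l z ltac:(lra)) as [j Hj]. exists (l, j).
    assert (Pl := height_pos l).
    apply near_from_sqr; [lra|easy|]. eapply Rle_trans; [exact Hj|].
    assert (Hs : spacing l <= theta ^ k * (Im z + height l)).
    { rewrite spacing_eq. assert (theta ^ l <= theta ^ k) by now apply pow_le_anti.
      assert (0 < theta ^ l) by (apply pow_lt; lra).
      apply Rle_trans with (height l * theta ^ k); [apply Rmult_le_compat_l; nra|].
      rewrite Rmult_comm. apply Rmult_le_compat_l; lra. }
    assert (Sp := spacing_range l).
    rewrite <- (pow2_abs (Im z - height l)).
    assert (A0 := Rabs_pos (Im z - height l)).
    apply Rle_trans with ((spacing l + Rabs (Im z - height l)) ^ 2); [nra|].
    rewrite <- Rpow_mult_distr. apply pow_incr. split; [lra|].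
    apply Rle_trans with ((hole k + theta ^ k) * (Im z + height l)); [lra|].
    apply Rmult_le_compat_r; lra. }
  destruct (Rle_dec (Im z) (mid k)) as [L|L].
  - apply (G k); [lia|]. rewrite Rabs_right by lra. unfold mid in L.
    (* [(t - 1) / (t + 1)] increases with [t = Im z / height k <= ratio k]. *)
    assert (0 < 1 - hole k) by (unfold hole; lra).
    assert ((1 - hole k) * Im z <= (1 - hole k) * (ratio k * height k))
      by (apply Rmult_le_compat_l; lra).
    nra.
  - apply (G (S k)); [lia|]. rewrite Rabs_left1 by lra. rewrite height_S in *.
    replace (- (Im z - ratio k * mid k)) with (ratio k * mid k - Im z) by ring.
    nra.
Qed.

Lemma height_locate (K n : nat) (t : R) : height K <= t < height (K + n) ->
  exists k, (K <= k)%nat /\ height k <= t <= height (S k).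
Proof.
  induction n as [|n IH]; intros H.
  - rewrite Nat.add_0_r in H. lra.
  - destruct (Rlt_dec t (height (K + n))) as [L|L]; [apply IH; lra|].
    exists (K + n)%nat. split; [lia|]. rewrite Nat.add_succ_r in H. lra.
Qed.

Lemma height_unbounded (t : R) : exists n, t < height n.
Proof.
  destruct (Pow_x_infinity (/ theta)) with (b := t + 1) as [N HN].
  { generalize inv_theta_gt1. intros. rewrite Rabs_right; lra. }
  exists N. destruct (height_growth 0 N) as [G _]. simpl height in G. simpl plus in G.
  specialize (HN (2 * N)%nat ltac:(lia)). assert (T := inv_theta_gt1).
  rewrite Rabs_right in HN; [lra|]. apply Rle_ge, pow_le. lra.
Qed.

Lemma high_near (rho : R) : d1 < rho -> exists K, forall z, height K <= Im z ->
  exists t, Cmod (z - zero t) <= rho * Cmod (z - Cconj (zero t)).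
Proof.
  intros Hr. assert (T := theta_range).
  destruct (pow_small theta ((rho - d1) / 2) T ltac:(lra)) as [N HN].
  (* From this row on [Nat.sqrt k] is at least [N], so both [slack k] and [theta ^ k] are below
     [(rho - d1) / 2]. *)
  exists (N * N)%nat. intros z Hz.
  destruct (height_unbounded (Im z)) as [n Hn].
  destruct (height_locate (N * N) n (Im z)) as (k & Hk & Hkz).
  { split; [easy|]. eapply Rlt_le_trans; [exact Hn|]. apply height_le. lia. }
  apply (gap_near k); [lra| |easy].
  unfold hole, slack.
  assert (Hs : (N <= Nat.sqrt k)%nat).
  { apply Nat.sqrt_le_square. lia. }
  assert (Hkk : (Nat.sqrt k <= k)%nat) by apply Nat.sqrt_le_lin.
  assert (A1 := HN (Nat.sqrt k) Hs). assert (A2 := HN k ltac:(lia)).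
  assert (0 < theta ^ Nat.sqrt k) by (apply pow_lt; lra). nra.
Qed.

Lemma blaschke_lim_zero (t : nat * nat) : blaschke_lim (rows_from 0) (zero t) = 0%C.
Proof.
  apply (blaschke_lim_listed_zero (rows_from 0) (select_condition _) (Cantor.to_nat t)).
  unfold rows_from, select. now rewrite cancel_of_to.
Qed.

Lemma blaschke_lim_zero_inv (z : C) : 0 < Im z -> blaschke_lim (rows_from 0) z = 0%C ->
  exists t, z = zero t.
Proof.
  intros Hz H0. apply NNPP. intros H.
  apply (blaschke_lim_nonzero (rows_from 0) z (Im z * (96 / d1) / (1
    - theta) * theta ^ 0)) in H0; try easy.
  - apply select_condition.
  - intros n. unfold rows_from, select. simpl Nat.leb. intros E. apply H.
    exists (Cantor.of_nat n). now injection E.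
  - intros n. now apply rows_from_defect.
Qed.

(** About [density k] zeros of row [k] lie within horizontal distance [height k] of the gap center,
    each with a defect at least a fixed [u0]. The sum of defects is therefore unbounded in [k], and
    the product tends to 0. *)
Lemma small_at_mid (eps : R) : 0 < eps -> exists K, forall k, (K <= k)%nat ->
  Cmod (blaschke_lim (rows_from 0) (0, mid k)) <= eps.
Proof.
  intros He. assert (T := theta_range).
  set (qm := (3 + d1) / (1 - d1)).
  assert (Hqm : 1 < qm) by (apply Rlt_div_r; lra).
  (* For [|x| <= h] and ratio [q] the defect is at least [4 * q * h ^ 2 / (5 * q ^ 2 * h ^ 2)], and
     [qm] bounds every ratio. *)
  set (u0 := 4 / (5 * qm)). assert (Hu0 : 0 < u0) by (apply Rdiv_lt_0_compat; lra).
  destruct (INR_unbounded (/ (eps ^ 2 * u0))) as [N HN].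
  destruct (pow_small theta (2 / d1 / (INR N + 1)) T) as [K HK].
  { assert (0 < 2 / d1) by (apply Rdiv_lt_0_compat; lra).
    apply Rdiv_lt_0_compat; [easy|]. generalize (pos_INR N). lra. }
  exists K. intros k Hk. assert (P := height_pos k). assert (Q := ratio_gt1 k).
  assert (Hz : 0 < Im (0, mid k)) by (simpl; generalize (height_mid k); lra).
  assert (Hden : INR N <= density k).
  { specialize (HK k Hk). assert (D := density_gt1 k). assert (I := inv_density k).
    assert (Ht : theta ^ k = 2 / d1 * / density k) by (rewrite I; field; lra).
    rewrite Ht in HK. unfold Rdiv in HK.
    apply Rmult_lt_reg_l in HK; [|apply Rdiv_lt_0_compat; lra].
    apply Rinv_lt_cancel in HK; lra. }
  set (F := fun t => defect (0, mid k) (Some (zero t))).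
  destruct (psum_cantor_ge F k N) as [n0 Hn0].
  { intros t. now apply defect_zero_pos. }
  apply (blaschke_lim_le (rows_from 0) (select_condition _) _ eps n0 Hz). intros n Hn.
  specialize (Hn0 n Hn).
  assert (Hsum : INR N * u0 <= psum (fun i => defect (0, mid k) (rows_from 0 i)) n).
  { eapply Rle_trans; [|exact Hn0].
    assert (Hj : forall j, (j < N)%nat -> u0 <= F (k, j)).
    { intros j Hj. unfold F. rewrite defect_zero. cbn [Re Im fst snd].
      assert (Hx : Rabs (int_enum j * spacing k) <= height k).
      { rewrite Rabs_mult. assert (Sp := spacing_range k).
        rewrite (Rabs_right (spacing k)) by lra.
        assert (X := Rabs_int_enum_le j). assert (INR j <= INR N) by (apply le_INR; lia).
        apply Rle_trans with (density k * spacing k); [apply Rmult_le_compat_r; lra|].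
        right. unfold spacing. field. generalize (density_gt1 k). lra. }
      set (x := int_enum j * spacing k) in *.
      assert (Hx2 : (0 - x) ^ 2 <= height k ^ 2).
      { rewrite <- (pow2_abs (0 - x)). replace (0 - x) with (- x) by ring. rewrite Rabs_Ropp.
        apply pow_incr. split; [apply Rabs_pos|easy]. }
      unfold mid. set (q := ratio k) in *. set (h := height k) in *.
      assert (Hq : q <= qm) by apply (ratio_range k).
      change (Re (zero (k, j))) with x.
      assert (HD : (0 - x) ^ 2 + (q * h + h) ^ 2 <= 5 * q ^ 2 * h ^ 2).
      { assert (0 < h ^ 2) by now apply pow_lt.
        replace ((q * h + h) ^ 2) with ((q + 1) ^ 2 * h ^ 2) by ring.
        assert ((q + 1) ^ 2 + 1 <= 5 * q ^ 2) by nra. nra. }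
      assert (HD0 : 0 < (0 - x) ^ 2 + (q * h + h) ^ 2).
      { generalize (pow2_ge_0 (0 - x)). intros. assert (0 < (q * h + h) ^ 2); [|lra].
        apply pow_lt. nra. }
      apply Rle_trans with (4 * (q * h) * h * / (5 * q ^ 2 * h ^ 2)).
      - replace (4 * (q * h) * h * / (5 * q ^ 2 * h ^ 2)) with (4 / (5 * q)) by (field; lra).
        unfold u0. apply Rmult_le_compat_l; [lra|]. apply Rinv_le_contravar; lra.
      - apply Rmult_le_compat_l; [|now apply Rinv_le_contravar].
        assert (0 < q * h) by (apply Rmult_lt_0_compat; lra). nra. }
    clear - Hj. induction N as [|N IH]; [simpl; lra|]. rewrite S_INR. simpl psum.
    generalize (Hj N ltac:(lia)) (IH ltac:(intros; apply Hj; lia)). lra. }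
  apply Rsqr_incr_0_var; [|lra]. rewrite !Rsqr_pow2.
  rewrite Cmod_partial_sqr by (apply select_pos || easy).
  eapply Rle_trans; [apply (pprod_le_exp (fun i => defect (0, mid k) (rows_from 0 i)))|].
  { intros i. apply defect_range; [apply select_pos|easy]. }
  set (S := psum (fun i => defect (0, mid k) (rows_from 0 i)) n) in *.
  assert (He2 : 0 < eps ^ 2) by now apply pow_lt.
  assert (HS : / eps ^ 2 < S).
  { apply Rlt_le_trans with (2 := Hsum).
    apply Rmult_lt_reg_r with (/ u0); [now apply Rinv_0_lt_compat|].
    replace (INR N * u0 * / u0) with (INR N) by (field; lra).
    rewrite <- Rinv_mult. lra. }
  rewrite exp_Ropp. rewrite <- (Rinv_inv (eps ^ 2)).
  apply Rinv_le_contravar; [now apply Rinv_0_lt_compat|].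
  generalize (exp_ineq1_le S). lra.
Qed.

(** * Invertibility above the threshold *)

(** On the strip of half-width [d1 * height k / 2], [strip_near] and Schwarz-Pick give
    [|f| >= (de - d1) / 4]; outside half that width [row_lower] bounds the row product below. *)
Lemma row_inverse (k : nat) (de : R) : d1 < de -> exists M, forall f, unit_ball f ->
  (forall t, de <= Cmod (f (zero t))) -> inv_by M (blaschke_lim (row k)) f.
Proof.
  intros Hde. assert (P := height_pos k). destruct (row_lower k) as [eta [He Hs]].
  destruct (inv_by_strip (height k) (d1 * height k / 2) ((de - d1) / 4) eta) as [M HM];
    try nra.
  exists M. intros f Hf Hfz. apply HM; [|easy| |].
  - split; [apply blaschke_lim_holomorphic, select_condition|].
    apply blaschke_lim_le1, select_condition.
  - intros z Hz.
    assert (Hz' : Rabs (Im z - height k) < d1 * height k / 2) by (apply Rabs_def1; lra).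
    destruct (strip_near k z Hz') as [j Hj].
    destruct Hf as [Hf1 Hf2]. apply (schwarz_pick_lower f (zero (k, j))); try easy; nra.
  - intros z Hz H. apply Hs; [easy|]. lra.
Qed.

Lemma rows_from_inverse (de : R) : d1 < de -> exists K M, forall f, unit_ball f ->
  (forall t, de <= Cmod (f (zero t))) -> inv_by M (blaschke_lim (rows_from K)) f.
Proof.
  intros Hde. assert (T := theta_range). set (rho := (d1 + de) / 2).
  destruct (high_near rho) as [K0 HK0]; [unfold rho; lra|].
  assert (P := height_pos K0). set (b := 2 * height K0).
  set (A := b * (96 / d1) / (1 - theta)).
  assert (HA : 0 < A).
  { unfold A, b. apply Rdiv_lt_0_compat; [|lra]. apply Rmult_lt_0_compat; [lra|].
    apply Rdiv_lt_0_compat; lra. }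
  (* The bound of [rows_from_defect] below height [b] becomes at most [/ 2], as [rows_from_lower]
     requires. *)
  destruct (pow_small theta (/ (2 * A)) T) as [K HK]; [apply Rinv_0_lt_compat; lra|].
  specialize (HK K (le_n K)).
  destruct (inv_by_half_plane (height K0) b ((de - rho) / 4) (exp (- (1)))) as [M HM];
    try (unfold b, rho; lra); [apply exp_pos|].
  exists K, M. intros f Hf Hfz. apply HM; [|easy| |].
  - split; [apply blaschke_lim_holomorphic, select_condition|].
    apply blaschke_lim_le1, select_condition.
  - intros z Hz. destruct (HK0 z ltac:(lra)) as [t Ht].
    destruct Hf as [Hf1 Hf2]. apply (schwarz_pick_lower f (zero t)); try easy.
    + apply zero_Im_pos.
    + lra.
    + unfold rho. lra.
  - intros z Hz. apply (rows_from_lower K b); [unfold b; lra| |easy]. fold A.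
    apply Rmult_lt_compat_l with (r := A) in HK; [|easy].
    replace (A * / (2 * A)) with (/ 2) in HK by (field; lra). lra.
Qed.

(** Induction on the number of discarded rows: each step restores the lowest missing neighbor of the
    tail, row [K], at the cost of a larger constant. *)
Lemma whole_inverse (de : R) : d1 < de -> exists M, forall f, unit_ball f ->
  (forall t, de <= Cmod (f (zero t))) -> inv_by M (blaschke_lim (rows_from 0)) f.
Proof.
  intros Hde. destruct (rows_from_inverse de Hde) as [K HK]. revert HK.
  induction K as [|K IH]; [easy|]. intros [M HM]. apply IH.
  destruct (row_inverse K de Hde) as [M' HM'].
  exists (M' + M + M' * M). intros f Hf Hfz.
  apply (inv_by_mult M' M _ (blaschke_lim (row K)) (blaschke_lim (rows_from (S K)))); auto.
  intros z Hz. apply blaschke_lim_mult; try apply select_condition; [easy|].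
  intros n. apply rows_from_split.
Qed.

(** * A non-invertible function at the threshold *)

Lemma exists_argmin (D : nat -> nat) : exists n0, forall n, (D n0 <= D n)%nat.
Proof.
  assert (H : forall m n, (D n <= m)%nat -> exists n0, forall n, (D n0 <= D n)%nat).
  { induction m as [|m IH]; intros n Hn.
    - exists n. intros n'. lia.
    - destruct (classic (exists n', (D n' <= m)%nat)) as [[n' H]|H]; [now apply (IH n')|].
      exists n. intros n'. destruct (Nat.le_gt_cases (D n') m); [|lia]. exfalso. apply H.
        now exists n'. }
  now apply (H (D O) O).
Qed.

Lemma Cmod_conj_imaginary_sqr (z : C) (v : R) :
  Cmod (z - Cconj (0, v)) ^ 2 = Re z ^ 2 + (Im z + v) ^ 2.
Proof. rewrite Cmod2_alt. simpl. unfold Re, Im. ring. Qed.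

Lemma mid_pos (k : nat) : 0 < mid k.
Proof. generalize (height_mid k) (height_pos k). lra. Qed.

(** The sum of truncated differences is the distance between [l] and [k]. Heights of rows differ by
    at least [/ theta ^ 2] per step; since [mid k] already lies above row [k], one power is lost for
    the rows above it, whence [e + 1]. *)
Lemma defect_gap_center_far (l j k e : nat) : (e + 1 <= 2 * ((l - k) + (k - l)))%nat ->
  defect (zero (l, j)) (Some (0, mid k)) <= 4 * theta ^ e.
Proof.
  intros He. assert (T := theta_range). assert (V := mid_pos k).
  assert (P := height_pos l).
  unfold defect. rewrite Cmod_conj_imaginary_sqr.
  change (Im (zero (l, j))) with (height l). change (Im (0, mid k)) with (mid k).
  set (y := height l) in *. set (v := mid k) in *.
  set (X := Re (zero (l, j)) ^ 2). assert (HX : 0 <= X) by apply pow2_ge_0.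
  assert (Hpe : 0 < theta ^ e) by (apply pow_lt; lra).
  assert (H : y <= theta ^ e * v \/ v <= theta ^ e * y).
  { destruct (Nat.le_gt_cases l k) as [L|L].
    - left. destruct (height_growth l (k - l)) as [G _].
      replace (l + (k - l))%nat with k in G by lia. fold y in G.
      assert (Hv : height k <= v) by (left; apply height_mid; easy).
      rewrite pow_inv in G. set (w := theta ^ (2 * (k - l))) in *.
      assert (Hw : 0 < w) by (apply pow_lt; lra).
      assert (Hwe : w <= theta ^ e) by (apply pow_le_anti; [easy|lia]).
      assert (y <= w * v).
      { apply Rmult_le_reg_r with (/ w); [now apply Rinv_0_lt_compat|].
        replace (w * v * / w) with v by (field; lra). lra. }
      nra.
    - right. destruct (height_growth (S k) (l - S k)) as [G PS].
      replace (S k + (l - S k))%nat with l in G by lia. fold y in G.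
      rewrite pow_inv in G. set (w := theta ^ (2 * (l - S k))) in *.
      assert (Hw : 0 < w) by (apply pow_lt; lra).
      assert (Hwe : theta * w <= theta ^ e).
      { unfold w. change (theta ^ S (2 * (l - S k)) <= theta ^ e).
        apply pow_le_anti; [easy|lia]. }
      assert (Hv : v <= theta * height (S k)).
      { rewrite height_S. fold v. destruct (ratio_range k) as [Q _].
        apply Rmult_le_compat_l with (r := theta) in Q; [|lra].
        rewrite Rinv_r in Q by lra. nra. }
      assert (height (S k) <= w * y).
      { apply Rmult_le_reg_r with (/ w); [now apply Rinv_0_lt_compat|].
        replace (w * y * / w) with y by (field; lra). exact G. }
      assert (theta * height (S k) <= theta * (w * y)) by (apply Rmult_le_compat_l; lra).
      nra. }
  assert (HD : 0 < X + (y + v) ^ 2).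
  { assert (0 < (y + v) ^ 2); [apply pow_lt|]; lra. }
  apply Rle_div_l; [easy|].
  assert (H2 : y * v <= theta ^ e * (y + v) ^ 2).
  { destruct H as [H|H].
    - apply Rle_trans with (theta ^ e * (v * v)); [nra|]. apply Rmult_le_compat_l; nra.
    - apply Rle_trans with (theta ^ e * (y * y)); [nra|]. apply Rmult_le_compat_l; nra. }
  assert (0 <= theta ^ e * X) by (apply Rmult_le_pos; lra).
  nra.
Qed.

(** Every row is separated from [mid k] by a ratio of heights at least [ratio k], that is, by
    pseudo-hyperbolic distance at least [hole k]; a horizontal offset only increases this
    distance. *)
Lemma defect_gap_center (l j k : nat) :
  hole k ^ 2 <= 1 - defect (zero (l, j)) (Some (0, mid k)).
Proof.
  assert (V := mid_pos k). assert (P := height_pos l).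
  assert (Q := ratio_gt1 k). assert (HR := hole_ratio k).
  assert (Sl := slack_range k).
  assert (Hh : 0 < hole k < 1) by (unfold hole; lra).
  unfold defect. rewrite Cmod_conj_imaginary_sqr.
  change (Im (zero (l, j))) with (height l). change (Im (0, mid k)) with (mid k).
  set (X := Re (zero (l, j)) ^ 2). assert (HX : 0 <= X) by apply pow2_ge_0.
  assert (H : ratio k * height l <= mid k \/ ratio k * mid k <= height l).
  { destruct (Nat.le_gt_cases l k) as [L|L].
    - left. unfold mid. apply Rmult_le_compat_l; [lra|]. now apply height_le.
    - right. rewrite <- height_S. apply height_le. lia. }
  set (y := height l) in *. set (v := mid k) in *. set (q := ratio k) in *.
  set (h := hole k) in *.
  assert (Hq : (1 - h) * q = 1 + h) by lra.
  assert (H1 : h * (y + v) <= Rabs (y - v)).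
  { destruct H as [H|H].
    - assert ((1 - h) * (q * y) <= (1 - h) * v) by (apply Rmult_le_compat_l; lra).
      rewrite Rabs_left1; nra.
    - assert ((1 - h) * (q * v) <= (1 - h) * y) by (apply Rmult_le_compat_l; lra).
      rewrite Rabs_right; nra. }
  assert (H2 : h ^ 2 * (y + v) ^ 2 <= (y - v) ^ 2).
  { rewrite <- (pow2_abs (y - v)), <- Rpow_mult_distr. apply pow_incr. split; [nra|easy]. }
  assert (HD : 0 < X + (y + v) ^ 2).
  { assert (0 < (y + v) ^ 2); [apply pow_lt|]; lra. }
  replace (1 - 4 * y * v / (X + (y + v) ^ 2)) with ((X + (y - v) ^ 2) / (X + (y + v) ^ 2))
    by (field; lra).
  apply (Rle_div_r (h ^ 2) (X + (y - v) ^ 2) (X + (y + v) ^ 2) HD).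
  assert (h ^ 2 <= 1) by (rewrite <- (pow1 2); apply pow_incr; lra).
  assert (h ^ 2 * X <= 1 * X) by (now apply Rmult_le_compat_r).
  lra.
Qed.

(** At the gap [(n + N) ^ 2] the slack is [theta ^ (n + N)] up to a constant, while the spread of
    the squares makes the influence of the other centers decay with the same exponent and a smaller
    constant. *)
Definition gap_centers (N n : nat) : option C := Some (0, mid ((n + N) * (n + N))).

Lemma gap_centers_condition (N : nat) : blaschke_condition (gap_centers N).
Proof.
  assert (T := theta_range).
  assert (Hpos : forall n w, gap_centers N n = Some w -> 0 < Im w).
  { intros n w E. injection E as <-. apply mid_pos. }
  split; [exact Hpos|].
  apply (ex_series_psum (fun n => weight (gap_centers N n)) (1 / (1 - theta) * theta ^ 0)).
  { intros i. apply weight_pos, Hpos. }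
  intros n. eapply Rle_trans; [|apply (psum_geom_from 1 theta 0 n); [lra|easy]].
  apply psum_le. intros i _. unfold gap_centers, weight. cbn [Nat.leb].
  set (k := ((i + N) * (i + N))%nat). assert (V := mid_pos k).
  rewrite Cmod2_alt. change (Im (0, mid k)) with (mid k). change (Re (0, mid k)) with 0.
  assert (Hg : (/ theta) ^ i <= mid k).
  { destruct (height_growth 0 k) as [G _]. simpl height in G. simpl plus in G.
    assert (M := height_mid k).
    assert ((/ theta) ^ i <= (/ theta) ^ (2 * k)); [|lra].
    apply Rle_pow; [generalize (inv_theta_gt1); lra|]. unfold k. nia. }
  rewrite pow_inv in Hg. set (v := mid k) in *.
  assert (Hp : 0 < theta ^ i) by (apply pow_lt; lra).
  assert (Hg2 : 1 <= theta ^ i * v).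
  { apply Rmult_le_compat_l with (r := theta ^ i) in Hg; [|lra]. rewrite Rinv_r in Hg; lra. }
  apply Rle_div_l; [nra|]. nra.
Qed.

(** For a zero in row [l] let [n0] be the index of the nearest square. Its factor has squared
    modulus at least [(d1 + sl) ^ 2], and the defects of all other factors together are at most
    [sl], the slack of that gap. *)
Lemma gap_centers_lower : exists N, forall t, d1
  <= Cmod (blaschke_lim (gap_centers N) (zero t)).
Proof.
  assert (T := theta_range).
  (* This makes the geometric sum [4 * theta ^ (n0 + N + N0) / (1 - theta)] at most
     [theta ^ (n0 + N) * (1 - d1) / 2], which is [sl]. *)
  destruct (pow_small theta ((1 - d1) / 2 * (1 - theta) / 4) T) as [N0 HN0].
  { apply Rdiv_lt_0_compat; [|lra]. apply Rmult_lt_0_compat; lra. }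
  set (N := S N0). exists N. intros [l j].
  specialize (HN0 N0 (le_n N0)).
  set (kk := fun n => ((n + N) * (n + N))%nat).
  destruct (exists_argmin (fun n => (l - kk n) + (kk n - l))%nat) as [n0 Hn0].
  set (u := fun n => defect (zero (l, j)) (gap_centers N n)).
  assert (Hz : 0 < Im (zero (l, j))) by apply (zero_Im_pos).
  assert (Hu : forall n, 0 <= u n <= 1).
  { intros n. apply defect_range; [|easy]. intros w E. injection E as <-. apply mid_pos. }
  set (sl := slack (kk n0)).
  assert (Hsl : sl = theta ^ (n0 + N) * ((1 - d1) / 2)).
  { unfold sl, slack, kk. now rewrite Nat.sqrt_square. }
  assert (Hfar : forall n, n <> n0 -> u n <= 4 * theta ^ (n0 + N + N0) * theta ^ n).
  { intros n Hn. rewrite Rmult_assoc, <- pow_add. apply defect_gap_center_far. fold (kk n).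
    (* Two squares differ by at least the sum of their roots. As [n0] is nearest to [l], this is at
       most twice the distance from [kk n] to [l]; with [N = S N0] it yields exactly the exponent
       [n0 + N + N0 + n] plus one. *)
    specialize (Hn0 n). assert (Hd : (n0 + n + 2 * N <= (kk n - kk n0) + (kk n0 - kk n))%nat).
    { unfold kk. destruct (Nat.lt_ge_cases n0 n) as [L|L].
      - assert (E : (n = n0 + S (n - S n0))%nat) by lia. rewrite E. nia.
      - assert (E : (n0 = n + S (n0 - S n))%nat) by lia. rewrite E. nia. }
    unfold N in *. lia. }
  assert (Hsum : forall M, psum (fun n => if Nat.eqb n n0 then 0 else u n) M <= sl).
  { intros M.
    set (c := 4 * theta ^ (n0 + N + N0)).
    assert (Hc : 0 <= c) by (unfold c; apply Rmult_le_pos; [lra|apply pow_le; lra]).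
    apply Rle_trans with (c / (1 - theta) * theta ^ 0).
    - eapply Rle_trans; [|apply (psum_geom_from c theta 0 M); easy].
      apply psum_le. intros n _. cbn [Nat.leb]. destruct (Nat.eqb_spec n n0) as [_|H].
      + apply Rmult_le_pos; [easy|apply pow_le; lra].
      + now apply Hfar.
    - rewrite Hsl. unfold c. rewrite pow_add. simpl (theta ^ 0). rewrite Rmult_1_r.
      apply Rle_div_l; [lra|].
      assert (0 < theta ^ (n0 + N)) by (apply pow_lt; lra). nra. }
  apply blaschke_lim_ge_sqr; [apply gap_centers_condition|easy|lra|]. intros M.
  eapply Rle_trans; [|apply (pprod_ge_but_one u n0 M Hu)].
  assert (Hh : hole (kk n0) ^ 2 <= 1 - u n0) by apply defect_gap_center.
  assert (Sl := slack_range (kk n0)). fold sl in Sl.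
  unfold hole in Hh. fold sl in Hh. specialize (Hsum M).
  (* Since [sl <= (1 - d1) / 2], the gain in the first factor outweighs the loss in the second. *)
  apply Rle_trans with ((d1 + sl) ^ 2 * (1 - sl)).
  - assert (0 <= sl * (2 * d1 + sl - d1 ^ 2 - 2 * d1 * sl - sl ^ 2)).
    { apply Rmult_le_pos; [lra|]. nra. }
    nra.
  - apply Rmult_le_compat; try lra. apply pow2_ge_0.
Qed.

End Zeros.

Theorem theorem10 :
  forall delta1 : R, 0 < delta1 < 1 ->
  exists B : C -> C,
    blaschke_product B /\
    (forall delta : R, delta1 < delta <= 1 -> Rbar_lt (c_1 delta B) p_infty) /\
    (exists f : C -> C, admissible delta1 B f /\ ~ invertible_mod B f).
Proof.
  intros d1 Hd1. exists (blaschke_lim (rows_from d1 0)). split; [|split].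
  - apply blaschke_lim_product. now apply select_condition.
  - intros de Hde. destruct (whole_inverse d1 Hd1 de) as [M HM]; [lra|].
    apply (c_1_finite de M). intros f Hf. apply HM.
    + now apply admissible_unit_ball in Hf.
    + intros t. destruct Hf as [_ [Hf _]]. apply Hf. split.
      * now apply zero_Im_pos.
      * now apply blaschke_lim_zero.
  - destruct (gap_centers_lower d1 Hd1) as [N HN].
    set (f := blaschke_lim (gap_centers d1 N)) in *.
    assert (Hc := gap_centers_condition d1 Hd1 N).
    assert (Hf : Hinf f) by now apply blaschke_lim_Hinf.
    exists f. split.
    + split; [easy|]. split.
      * intros l [Hl H0]. split.
        -- destruct (blaschke_lim_zero_inv d1 Hd1 l Hl H0) as [t ->]. apply HN.
        -- apply (Lub_Rbar_correct (fun r => exists z, Defs.Cplus z /\ r = Cmod (f z))).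
           now exists l.
      * apply (Hinf_norm_le f 1). intros z Hz. now apply blaschke_lim_le1.
    + intros (g & h & _ & [_ [M HM]] & E).
      (* Where [f] vanishes, [h B = 1]; this is impossible once [|B| <= e], because
         [(Rabs M + 1) * e < 1]. *)
      set (e := / (Rabs M + 2)).
      assert (He : 0 < e) by (apply Rinv_0_lt_compat; generalize (Rabs_pos M); lra).
      destruct (small_at_mid d1 Hd1 e He) as [K HK].
      (* The center listed at index [K] is a zero of [f], and its gap number is at least [K], so [B]
         is small there. *)
      set (k := ((K + N) * (K + N))%nat). set (w := (0, mid d1 k) : C).
      assert (Hw : 0 < Im w) by now apply mid_pos.
      assert (Hfw : f w = 0%C) by now apply (blaschke_lim_listed_zero (gap_centers d1 N) Hc K).
      specialize (E w Hw). rewrite Hfw in E.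
      specialize (HK k ltac:(unfold k; nia)). fold w in HK.
      apply (f_equal Cmod) in E. rewrite Cmod_1 in E.
      replace (g w * 0 + h w * blaschke_lim (rows_from d1 0) w)%C
        with (h w * blaschke_lim (rows_from d1 0) w)%C in E by ring.
      rewrite Cmod_mult in E.
      assert (B1 : Cmod (h w) <= Rabs M + 1) by (generalize (HM w Hw) (Rle_abs M); lra).
      assert (B2 : Cmod (h w) * Cmod (blaschke_lim (rows_from d1 0) w) <= (Rabs M + 1) * e)
        by (apply Rmult_le_compat; try apply Cmod_ge_0; easy).
      assert ((Rabs M + 1) * e < 1); [|lra].
      unfold e. apply Rlt_div_l; generalize (Rabs_pos M); lra.
Qed.
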